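(* Let $n\ge3$ and let $M$ be a closed connected $n$-dimensional spin manifold with a fixed spin structure. The Hessian of the functional $\mathcal E_{n-1}+\mathcal E_n$ on $\mathcal S_1$ at a critical point $s$ is positive semi-definite.
   Context: Setting. $M$ carries a spin structure $\widetilde{\mathcal P}\to\mathcal P$: a principal $\widetilde{\mathrm{GL}}^+$-bundle double-covering the bundle $\mathcal P$ of oriented frames, where $\widetilde{\mathrm{GL}}^+$ is the universal cover of $\mathrm{GL}^+(n,\mathbb R)$. $\Delta_n$ is a real irreducible module of the real Clifford algebra $\mathrm{Cl}_n$ (convention $x\cdot x=-|x|^2$), with a $\mathrm{Spin}(n)$-invariant scalar product for which Clifford multiplication by vectors is skew-symmetric. For a Riemannian metric $g$, $\widetilde{\mathcal P}^g\subset\widetilde{\mathcal P}$ is the induced $\mathrm{Spin}(n)$-reduction and $\Sigma^g=\widetilde{\mathcal P}^g\times_{\mathrm{Spin}(n)}\Delta_n$ is the real spinor bundle, with fibre metric $\langle\cdot,\cdot\rangle_g$ and spin Levi-Civita connection $\nabla^g$. The universal spinor bundle is $\Sigma=\widetilde{\mathcal P}\times_{\mathrm{Spin}(n)}\Delta_n$; its smooth sections over $M$ are pairs $s=(g,\psi)$ with $g$ a Riemannian metric on $M$ and $\psi\in\Gamma(M,\Sigma^g)$. $\mathcal S_1$ is the Fréchet manifold of such pairs with $|\psi|_g\equiv1$. Functionals. For $s=(g,\psi)\in\mathcal S_1$, $T_r(X_0,\dots,X_r)=\langle\nabla^g_{X_0}\psi,X_1\cdot\ldots\cdot X_r\cdot\psi\rangle_g$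 and $\mathcal E_r(s)=\frac12\int_M|T_r|_g^2\,\mathrm{vol}^g$. A critical point is an $s\in\mathcal S_1$ at which the differential of the functional vanishes on $T_s\mathcal S_1$; the Hessian there is the second derivative, a quadratic form on $T_s\mathcal S_1$. *)

(* Defs.v *)
From HB Require Import structures.
From mathcomp Require Import all_boot all_order all_algebra.
From mathcomp Require Import all_classical all_reals all_analysis.

Set Implicit Arguments.
Unset Strict Implicit.
Unset Printing Implicit Defensive.

Import Order.TTheory GRing.Theory Num.Theory.
Import numFieldNormedType.Exports.

Local Open Scope classical_set_scope.
Local Open Scope ring_scope.

Section Smooth.
Context {R : realType}.

Definition pderiv {d} {W : normedModType R} (k : 'I_d) (f : 'cV[R]_d -> W) :
  'cV[R]_d -> W := fun x => 'D_(delta_mx k 0) f x.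

Definition smooth_on {d} {W : normedModType R} (U : set 'cV[R]_d)
    (f : 'cV[R]_d -> W) : Prop :=
  forall (s : seq 'I_d) (x : 'cV[R]_d), U x ->
    {for x, continuous (foldr pderiv f s)} /\
    forall k : 'I_d, derivable (foldr pderiv f s) x (delta_mx k 0).

Definition jacobian_mx {d m} (f : 'cV[R]_d -> 'cV[R]_m) (x : 'cV[R]_d) :
  'M[R]_(m, d) := \matrix_(a < m, b < d) pderiv b f x a 0.

(* Points of R x R^n are encoded as column vectors of height 1 + n. *)
Definition time {n} (z : 'cV[R]_(1 + n)) : R := usubmx z 0 0.
Definition space {n} (z : 'cV[R]_(1 + n)) : 'cV[R]_n := dsubmx z.

Definition dot {n} (u v : 'cV[R]_n) : R := \sum_k u k 0 * v k 0.

(* Integration over R^n as an iterated Lebesgue integral; it is only used for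
   nonnegative Borel functions, where Tonelli's theorem applies. *)
Fixpoint integral_Rn (n : nat) : ('cV[R]_n -> \bar R) -> \bar R :=
  match n with
  | 0 => fun f => f 0
  | m.+1 => fun f => (\int[lebesgue_measure]_(t in [set: R])
      integral_Rn (fun x : 'cV[R]_m => f (col_mx (t%:M : 'M[R]_1) x)))%E
  end.

End Smooth.

(* The smooth structure and the orientation are given by an arbitrary oriented
   atlas; [om_inv i] is the inverse of the chart [om_chart i], and both are
   meaningful only on [om_dom i] and [om_cod i].  Second countability is not
   required: it is automatic for the compact manifolds considered below. *)
Record oriented_manifold (R : realType) (n : nat) := OrientedManifold {
  om_pt :> topologicalType;
  om_idx : Type;
  om_dom : om_idx -> set om_pt;
  om_cod : om_idx -> set 'cV[R]_n;
  om_chart : om_idx -> om_pt -> 'cV[R]_n;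
  om_inv : om_idx -> 'cV[R]_n -> om_pt;
  om_hausdorff : hausdorff_space om_pt;
  om_cover : forall y, exists i, om_dom i y;
  om_dom_open : forall i, open (om_dom i);
  om_cod_open : forall i, open (om_cod i);
  om_chart_cod : forall i y, om_dom i y -> om_cod i (om_chart i y);
  om_inv_dom : forall i x, om_cod i x -> om_dom i (om_inv i x);
  om_chartK : forall i y, om_dom i y -> om_inv i (om_chart i y) = y;
  om_invK : forall i x, om_cod i x -> om_chart i (om_inv i x) = x;
  om_chart_cont : forall i, {within om_dom i, continuous (om_chart i)};
  om_inv_cont : forall i, {within om_cod i, continuous (om_inv i)};
  om_trans_smooth : forall i j,
    smooth_on [set x | om_cod i x /\ om_dom j (om_inv i x)]
      (fun x => om_chart j (om_inv i x));
  om_trans_det : forall i j x, om_cod i x -> om_dom j (om_inv i x) ->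
    0 < \det (jacobian_mx (fun x' => om_chart j (om_inv i x')) x) }.

Definition closed_connected {R : realType} {n} (M : oriented_manifold R n) :
  Prop := compact [set: M] /\ connected [set: M].

(* The differential of the coordinate change from chart i to chart j. *)
Definition trans_jac {R : realType} {n} (M : oriented_manifold R n)
    (i j : om_idx M) (x : 'cV[R]_n) : 'M[R]_n :=
  jacobian_mx (fun x' => om_chart j (om_inv i x')) x.

HB.mixin Record Group_isTopGroup G of Group G & Topological G := {
  mulg_cont : continuous (fun ab : G * G => (ab.1 * ab.2)%g);
  invg_cont : continuous (fun a : G => (a^-1)%g)
}.

#[short(type="topGroupType")]
HB.structure Definition TopGroup :=
  { G of Group G & Topological G & Group_isTopGroup G }.

(* [p] is a covering map onto the open subset [B]: every point of [B] has an
   evenly covered neighbourhood [V], with sheets indexed by [D]. *)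
Definition covering_map {X Y : topologicalType} (p : X -> Y) (B : set Y) :
    Prop :=
  [/\ continuous p, range p = B &
    forall y, B y -> exists V : set Y, [/\ open V, V y, V `<=` B &
      exists (D : Type) (s : D -> Y -> X),
        [/\ forall d, {within V, continuous (s d)},
            forall d, open (s d @` V),
            forall d v, V v -> p (s d v) = v &
            forall x, V (p x) -> exists! d, s d (p x) = x]]].

(* Paths and homotopies on [0, 1] are taken to be restrictions of continuous
   maps on R and R^2. *)
Definition simply_connected (R : realType) (X : topologicalType) : Prop :=
  (forall x y : X, exists f : R -> X, [/\ continuous f, f 0 = x & f 1 = y]) /\
  (forall f : R -> X, continuous f -> f 0 = f 1 ->
    exists H : R * R -> X, [/\ continuous H,
      forall t, 0 <= t <= 1 -> H (0, t) = f t,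
      forall t, 0 <= t <= 1 -> H (1, t) = f 0 &
      forall u, 0 <= u <= 1 -> H (u, 0) = f 0 /\ H (u, 1) = f 0]).

Definition GLpos (R : realType) n : set 'M[R]_n := [set A : 'M[R]_n | 0 < \det A].
Definition SOset (R : realType) n : set 'M[R]_n :=
  [set A : 'M[R]_n | A^T *m A = 1%:M /\ \det A = 1].

Definition is_universal_cover_GLpos {R : realType} {n} {G : topGroupType}
    (proj : G -> 'M[R]_n) : Prop :=
  [/\ forall a b : G, proj (a * b)%g = proj a *m proj b,
      covering_map proj (@GLpos R n) & simply_connected R G].

(* By the universal property of Cl_n, a module structure on R^N is the same as
   a linear Clifford map [c].  The invariant scalar product is made the standard
   one of R^N by the choice of an orthonormal basis. *)
Definition is_spin_module {R : realType} {n N}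
    (c : {linear 'cV[R]_n -> 'M[R]_N}) : Prop :=
  [/\ forall x, c x *m c x = (- dot x x)%:M,
      forall x, (c x)^T = - c x,
      (0 < N)%N &
      forall V : {vspace 'cV[R]_N},
        (forall x v, v \in V -> c x *m v \in V) -> V = 0%VS \/ V = fullv].

(* Spin(n) consists of the products of an even number of unit vectors.  It acts
   faithfully on an irreducible Cl_n-module, hence is identified with its image
   in End(R^N). *)
Definition spin_set {R : realType} {n N} (c : {linear 'cV[R]_n -> 'M[R]_N}) :
    set 'M[R]_N :=
  [set A | exists s : seq 'cV[R]_n, [/\ ~~ odd (size s),
    {in s, forall u, dot u u = 1} & A = \big[mulmx/1%:M]_(u <- s) c u]].

(* [kappa] is the isomorphism over SO(n) of the preimage of SO(n) in the
   universal cover with Spin(n); its values elsewhere are irrelevant. *)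
Definition is_spin_identification {R : realType} {n N} {G : topGroupType}
    (proj : G -> 'M[R]_n) (c : {linear 'cV[R]_n -> 'M[R]_N})
    (kappa : G -> 'M[R]_N) : Prop :=
  let H := [set a | SOset (proj a)] in
  [/\ set_bij H (spin_set c) kappa,
      {within H, continuous kappa},
      forall a b, H a -> H b -> kappa (a * b)%g = kappa a *m kappa b &
      forall a x, H a -> kappa a *m c x = c (proj a *m x) *m kappa a].

(* A principal G-bundle over M with an equivariant map, over the identity of M,
   to the bundle of oriented frames (which is then a covering with fibre the
   kernel of [proj]).  A frame at [y] in [om_dom i] is recorded by the invertible
   matrix whose columns are its vectors in the chart i: [ss_frame i p] is the
   matrix in chart i of the frame below p, and is meaningful only if
   [ss_base p] lies in [om_dom i]. *)
Record spin_structure (R : realType) (n : nat) (M : oriented_manifold R n)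
    (G : topGroupType) (proj : G -> 'M[R]_n) := SpinStructure {
  ss_tot :> topologicalType;
  ss_act : ss_tot -> G -> ss_tot;
  ss_base : ss_tot -> M;
  ss_frame : om_idx M -> ss_tot -> 'M[R]_n;
  ss_act1 : forall p, ss_act p 1%g = p;
  ss_actM : forall p a b, ss_act p (a * b)%g = ss_act (ss_act p a) b;
  ss_act_cont : continuous (fun pa : ss_tot * G => ss_act pa.1 pa.2);
  ss_base_cont : continuous ss_base;
  ss_base_act : forall p a, ss_base (ss_act p a) = ss_base p;
  ss_free : forall p a, ss_act p a = p -> a = 1%g;
  ss_transitive : forall p q, ss_base p = ss_base q ->
    exists a, q = ss_act p a;
  ss_loc_triv : forall y : M, exists V : set M, [/\ open V, V y &
    exists (sigma : M -> ss_tot) (tau : ss_tot -> G),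
      [/\ {within V, continuous sigma},
          forall y', V y' -> ss_base (sigma y') = y',
          {within ss_base @^-1` V, continuous tau} &
          forall p, V (ss_base p) -> p = ss_act (sigma (ss_base p)) (tau p)]];
  ss_frame_cont : forall i,
    {within ss_base @^-1` om_dom i, continuous (ss_frame i)};
  ss_frame_det : forall i p, om_dom i (ss_base p) -> 0 < \det (ss_frame i p);
  ss_frame_trans : forall i j p,
    om_dom i (ss_base p) -> om_dom j (ss_base p) ->
    ss_frame j p =
      trans_jac i j (om_chart i (ss_base p)) *m ss_frame i p;
  ss_frame_act : forall i p a, om_dom i (ss_base p) ->
    ss_frame i (ss_act p a) = ss_frame i p *m proj a }.

Section UniversalSpinors.
Context {R : realType} {n N : nat} {M : oriented_manifold R n}
  {G : topGroupType} {proj : G -> 'M[R]_n}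
  (c : {linear 'cV[R]_n -> 'M[R]_N}) (kappa : G -> 'M[R]_N)
  {P : spin_structure M proj}.

(* Raw data of a section s = (g, psi): [us_metric i x] is the Gram matrix of g
   at the point of coordinates [x] in chart i; [us_spinor] represents psi as an
   equivariant function on the orthonormal spin frames: the value of psi at
   [ss_base p] is the class [p, us_spinor p].  Values outside of the codomains
   of the charts, resp. at non-orthonormal spin frames, are irrelevant. *)
Record univ_section := UnivSection {
  us_metric : om_idx M -> 'cV[R]_n -> 'M[R]_n;
  us_spinor : P -> 'cV[R]_N }.

Implicit Types (s : univ_section) (gamma : R -> univ_section).

Definition orthonormal_spin_frame s : set P :=
  [set p | forall i, om_dom i (ss_base p) ->
    (ss_frame i p)^T *m us_metric s i (om_chart i (ss_base p)) *m ss_frame i p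
    = 1%:M].

Definition metric_tensor s : Prop :=
  [/\ forall i x, om_cod i x -> (us_metric s i x)^T = us_metric s i x,
      forall i x, om_cod i x -> forall u : 'cV[R]_n, u != 0 ->
        0 < dot u (us_metric s i x *m u) &
      forall i j x, om_cod i x -> om_dom j (om_inv i x) ->
        us_metric s i x = (trans_jac i j x)^T *m
          us_metric s j (om_chart j (om_inv i x)) *m trans_jac i j x].

Definition unit_spinor s : Prop :=
  (forall p a, orthonormal_spin_frame s p -> SOset (proj a) ->
     kappa a *m us_spinor s (ss_act p a) = us_spinor s p) /\
  (forall p, orthonormal_spin_frame s p ->
     dot (us_spinor s p) (us_spinor s p) = 1).

(* Smoothness of a family (g_t, psi_t) jointly in (t, x).  The spinors are
   tested in all local trivialisations of the universal spinor bundle along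
   the family, i.e. in all families [e] of local sections, defined on an open
   subset [W] of R x M, of the bundles of orthonormal spin frames of the g_t;
   such a section is smooth if it is continuous and the underlying family of
   frames is smooth. *)
Definition smooth_family gamma : Prop :=
  (forall i, smooth_on [set z : 'cV[R]_(1 + n) | om_cod i (space z)]
     (fun z => us_metric (gamma (time z)) i (space z))) /\
  (forall (i : om_idx M) (W : set (R * M)) (e : R -> M -> P),
     let U := [set z : 'cV[R]_(1 + n) |
       om_cod i (space z) /\ W (time z, om_inv i (space z))] in
     open W ->
     {within W, continuous (fun w => e w.1 w.2)} ->
     (forall t y, W (t, y) ->
        ss_base (e t y) = y /\ orthonormal_spin_frame (gamma t) (e t y)) ->
     smooth_on U
       (fun z => ss_frame i (e (time z) (om_inv i (space z)))) ->
     smooth_on U (fun z =>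
       us_spinor (gamma (time z)) (e (time z) (om_inv i (space z))))).

(* Smooth curves in S_1: by the exponential law for spaces of sections over a
   compact manifold, these are the jointly smooth families. *)
Definition S1_curve gamma : Prop :=
  (forall t, metric_tensor (gamma t) /\ unit_spinor (gamma t)) /\
  smooth_family gamma.

(* A section is smooth if and only if it is smooth as a constant family. *)
Definition S1 s : Prop := S1_curve (fun _ => s).

(* Smooth local sections over V of the bundle of orthonormal spin frames
   (smoothness being tested in chart i). *)
Definition local_spin_frame s (i : om_idx M) (V : set M) (e : M -> P) : Prop :=
  [/\ open V, {within V, continuous e},
      forall y, V y -> ss_base (e y) = y /\ orthonormal_spin_frame s (e y) &
      smooth_on [set x | om_cod i x /\ V (om_inv i x)]
        (fun x => ss_frame i (e (om_inv i x)))].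

Section Local.
Variables (s : univ_section) (i : om_idx M) (e : M -> P).

Let g (x : 'cV[R]_n) : 'M[R]_n := us_metric s i x.
Let E (x : 'cV[R]_n) : 'M[R]_n := ss_frame i (e (om_inv i x)).
Let v (x : 'cV[R]_n) : 'cV[R]_N := us_spinor s (e (om_inv i x)).

(* The entry (b, k) of [christoffel a x] is the Christoffel symbol
   Gamma^b_(a k). *)
Definition christoffel (a : 'I_n) (x : 'cV[R]_n) : 'M[R]_n :=
  \matrix_(b, k) (2^-1 * \sum_l invmx (g x) b l *
    (pderiv a g x l k + pderiv k g x l a - pderiv l g x a k)).

(* The entry (l, k) is g(e_l, nabla_a e_k). *)
Definition connection_form (a : 'I_n) (x : 'cV[R]_n) : 'M[R]_n :=
  (E x)^T *m g x *m (pderiv a E x + christoffel a x *m E x).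

(* nabla_a psi = d_a psi + 1/4 sum_(k, l) g(nabla_a e_k, e_l) e_k . e_l . psi *)
Definition spin_nabla (a : 'I_n) (x : 'cV[R]_n) : 'cV[R]_N :=
  pderiv a v x + 4^-1 *: \sum_k \sum_l connection_form a x l k *:
    (c (delta_mx k 0) *m c (delta_mx l 0) *m v x).

(* T_r, on vectors given by their coordinates in chart i; a vector X acts on
   spinors through its coordinates [invmx (E x) *m X] in the frame e. *)
Definition T_tensor r (x : 'cV[R]_n) (X : 'I_r.+1 -> 'cV[R]_n) : R :=
  dot (\sum_a X ord0 a 0 *: spin_nabla a x)
    ((\big[mulmx/1%:M]_(j < r) c (invmx (E x) *m X (lift ord0 j))) *m v x).

Definition T_sqnorm r (x : 'cV[R]_n) : R :=
  \sum_(K : {ffun 'I_r.+1 -> 'I_n})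
    T_tensor x (fun j => col (K j) (E x)) ^+ 2.

End Local.

(* The squared norm of T_r at y is the common value of the local expressions
   in all charts and local spin frames around y. *)
Definition T_normsq r s (y : M) : R :=
  let values := [set q | exists i V e,
    [/\ local_spin_frame s i V e, V y, om_dom i y &
        q = T_sqnorm s i e r (om_chart i y)]] in
  xget 0 [set q | values = [set q]].

(* The integral of a nonnegative f against vol^g: the supremum, over finite
   families of disjoint Borel sets [A k] contained in chart domains, of the sums
   of the integrals of f over the [A k]; it is reached at any finite Borel
   partition of M subordinate to the atlas. *)
Definition integral_vol s (f : M -> R) : \bar R :=
  ereal_sup [set q | exists (m : nat) (i : 'I_m -> om_idx M)
    (A : 'I_m -> set M),
    [/\ forall k, <<s [set U : set M | open U] >> (A k),
        forall k, A k `<=` om_dom (i k),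
        trivIset [set: 'I_m] A &
        q = (\sum_(k < m) integral_Rn (fun x =>
          (\1_[set x' | om_cod (i k) x' /\ A k (om_inv (i k) x')] x *
           f (om_inv (i k) x) * Num.sqrt (\det (us_metric s (i k) x)))%:E))%E]].

Definition energy r s : R := 2^-1 * fine (integral_vol s (T_normsq r s)).

(* Tangent vectors of S_1 at s are the velocities at 0 of the smooth curves
   gamma in S_1 with gamma 0 = s.  The differential of F maps the velocity of
   gamma to the first derivative of F \o gamma at 0; at a critical point the
   Hessian of F maps it to the second derivative. *)
Definition differential (F : univ_section -> R) gamma : R :=
  derive1 (fun t => F (gamma t)) 0.

Definition hessian (F : univ_section -> R) gamma : R :=
  derive1n 2 (fun t => F (gamma t)) 0.

Definition critical_point (F : univ_section -> R) s : Prop :=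
  S1 s /\ forall gamma, S1_curve gamma -> gamma 0 = s ->
    differential F gamma = 0.

Definition hessian_psd (F : univ_section -> R) s : Prop :=
  forall gamma, S1_curve gamma -> gamma 0 = s -> 0 <= hessian F gamma.

End UniversalSpinors.

Arguments univ_section {R n} N {M G proj} P.

(* Main.v *)
(** Replacing [g] by [lambda^2 g] and transporting the spinor multiplies both
    energies by [lambda^(n-2)]. As [n >= 3], criticality along this scaling curve
    forces [E_(n-1) + E_n] to vanish at [s], which is thus an absolute minimum,
    and the second derivative along any curve is nonnegative there.

    Since derivatives and [T_normsq] are total, this needs the continuity of the
    energy along the curve at [s]. The density of [T_r] does not depend on the
    frame and chart at [s], so zero energy on a compact manifold, which has finite
    volume, means [T_r = 0]. Computing in smooth families of orthonormal spin
    frames, compactness then makes [T_r] uniformly small along the curve, while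
    the volume densities stay comparable to that of [s]. *)

Require Import Defs.
From HB Require Import structures.
From mathcomp Require Import all_boot all_order all_algebra.
From mathcomp Require Import all_classical all_reals all_analysis.
From mathcomp Require Import measurable_realfun.
From mathcomp Require Import ring lra.
Import Defs.

Set Implicit Arguments.
Unset Strict Implicit.
Unset Printing Implicit Defensive.

Import Order.TTheory GRing.Theory Num.Theory.
Import numFieldNormedType.Exports.

Local Open Scope classical_set_scope.
Local Open Scope ring_scope.

(** * Calculus in coordinates *)

(** The densities are never shown to be Borel, so they are integrated only through facts valid for
    arbitrary nonnegative functions. The heaviest step is finite volume: the atlas is arbitrary and
    [integral_vol] ranges over all finite Borel families, so the bound must not depend on the charts
    used. The pieces are carried to one reference chart, where an outer measure built from dyadic
    cells dominates, up to a constant, the volume computed in any other chart. This replaces the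
    change of variables formula; the constant is harmless because only finiteness matters.
    Finiteness itself is essential, as [fine] sends an infinite integral to 0. Spinors are
    equivariant functions on spin frames, so scaling needs a continuous lift of scalar matrices to
    [G] which is central in [G]. Only the derivative slot of [T_r] rescales, by [lambda^-1] for
    every [r]; together with [lambda^n] from the volume this is the exponent [n - 2]. Since [G] has
    no smooth structure, transitions between spin frames are merely continuous, and their spinorial
    derivative is recovered from the smooth matrices below them by averaging over the Clifford
    generators. *)

Section PartialDerivatives.
Context {R : realType}.

Lemma cvg_mxP {T : Type} {F : set_system T} {FF : Filter F} {m p}
    (f : T -> 'M[R]_(m, p)) (A : 'M[R]_(m, p)) :
  f x @[x --> F] --> A <-> forall i j, f x i j @[x --> F] --> A i j.
Proof.
split=> [fA i j|fA]; first exact: (cvg_comp _ _ fA (@coord_continuous _ _ _ i j A)).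
apply/cvgrPdist_le => /= e e0; near=> x.
rewrite [leLHS]/Num.Def.normr/= mx_normrE (bigmax_le _ (ltW e0))//= => i _.
rewrite !mxE; move: i; near: x; apply: filter_forall => /= i.
by have /cvgrPdist_le /(_ _ e0) := fA i.1 i.2.
Unshelve. all: by end_near. Qed.

Lemma mx_norm_coord {m p} (A : 'M[R]_(m, p)) i j : `|A i j| <= `|A|.
Proof.
by rewrite [leRHS]/Num.Def.normr/= mx_normrE; apply: le_trans (le_bigmax _ _ (i, j)).
Qed.

Lemma mx_norm_le {m p} (A : 'M[R]_(m, p)) (e : R) : 0 <= e ->
  (forall i j, `|A i j| <= e) -> `|A| <= e.
Proof.
move=> e0 Ae; rewrite [leLHS]/Num.Def.normr/= mx_normrE (bigmax_le _ e0)//= => i _; exact: Ae.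
Qed.

Lemma cvg_shift0 {T : Type} {F : set_system T} {FF : Filter F} {V : normedModType R}
    (u : T -> V) (x : V) :
  (forall e, 0 < e -> \forall t \near F, `|u t| <= e) -> u t + x @[t --> F] --> x.
Proof.
move=> u0; apply/cvgrPdist_le => e e0; have := u0 e e0; apply: filterS => t.
by rewrite opprD addrCA subrr addr0 normrN.
Qed.

Lemma is_derive_line {V : normedModType R} (f : V -> R) (y v : V) (t : R) :
  derivable f (t *: v + y) v ->
  is_derive t 1 (fun u => f (u *: v + y)) ('D_v f (t *: v + y)).
Proof.
move=> df.
have H : h^-1 *: (f ((h *: 1 + t) *: v + y) - f (t *: v + y)) @[h --> 0^'] -->
   'D_v f (t *: v + y).
  apply: cvg_trans df; apply: near_eq_cvg; near=> h => /=.
  by rewrite [h *: 1]mulr1 scalerDl addrA.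
by apply: DeriveDef; [apply/cvg_ex; eexists; exact: H | exact/cvg_lim].
Unshelve. all: by end_near. Qed.

Lemma MVT_direction {V : normedModType R} (f : V -> R) (y v : V) :
  (forall t, 0 <= t <= 1 -> derivable f (t *: v + y) v) ->
  exists2 t, 0 <= t <= 1 & f (v + y) - f y = 'D_v f (t *: v + y).
Proof.
move=> df.
have [|t||t t01 E] := @MVT_segment R (fun u => f (u *: v + y))
  (fun u => 'D_v f (u *: v + y)) 0 1.
- exact: ler01.
- rewrite in_itv/= => /andP[/ltW t0 /ltW t1].
  by apply/is_derive_line/df/andP.
- apply: derivable_within_continuous => t; rewrite in_itv/= => /df/is_derive_line.
  by case.
- exists t; first by move: t01; rewrite in_itv.
  by move: E; rewrite scale1r scale0r add0r subr0 mulr1.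
Qed.

Lemma deriveZ_direction {V : normedModType R} (f : V -> R) (y v : V) (h : R) :
  derivable f y v -> is_derive y (h *: v) f (h * 'D_v f y).
Proof.
move=> df; have [->|h0] := eqVneq h 0.
  by rewrite scale0r mul0r; exact: is_derive0.
have H : k^-1 *: (f (k *: (h *: v) + y) - f y) @[k --> 0^'] --> h * 'D_v f y.
  have : (fun k : R => k * h) k @[k --> 0^'] --> (0 : R)^'.
    move=> A [e /= e0 eA]; exists (e / `|h|); first by rewrite /= divr_gt0 ?normr_gt0.
    move=> k /=; rewrite sub0r normrN => ke k0; apply: eA => /=.
      by rewrite sub0r normrN normrM -ltr_pdivlMr ?normr_gt0.
    by rewrite mulf_neq0.
  move=> /(cvg_comp _ _)/(_ df) H.
  have : h * (k * h)^-1 *: (f ((k * h) *: v + y) - f y) @[k --> 0^'] --> h * 'D_v f y.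
    under eq_fun do rewrite -scalerA.
    by apply: cvgZl_tmp; exact: H.
  apply: cvg_trans; apply: near_eq_cvg; near=> k.
  by rewrite scalerA invfM [k^-1 * _]mulrC mulrA divff// mul1r.
by apply: DeriveDef; [apply/cvg_ex; eexists; exact: H | exact/cvg_lim].
Unshelve. all: by end_near. Qed.

Lemma MVT_coord {d} (f : 'cV[R]_d -> R) (k : 'I_d) (y : 'cV[R]_d) (h : R) :
  (forall t, 0 <= t <= 1 -> derivable f (t *: (h *: delta_mx k 0) + y) (delta_mx k 0)) ->
  exists2 t, 0 <= t <= 1 &
    f (h *: delta_mx k 0 + y) - f y = h * pderiv k f (t *: (h *: delta_mx k 0) + y).
Proof.
move=> df; have [t t01|t t01 ->] := @MVT_direction _ f y (h *: delta_mx k 0).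
  by case: (deriveZ_direction h (df _ t01)).
by exists t => //; case: (deriveZ_direction h (df _ t01)).
Qed.

(* The increment is split along the coordinate path from [x] to [x + h]. *)
Lemma increment_pderiv {d} (f : 'cV[R]_d -> R) (x : 'cV[R]_d) (r : R) :
  (forall k y, `|y| < r -> derivable f (y + x) (delta_mx k 0)) ->
  forall h : 'cV[R]_d, `|h| < r -> exists xi : 'I_d -> 'cV[R]_d,
    (forall k, `|xi k| <= `|h|) /\
    f (h + x) - f x = \sum_k h k 0 * pderiv k f (xi k + x).
Proof.
move=> df h hr.
pose p j : 'cV[R]_d := \col_k (if (k < j)%N then h k 0 else 0).
have pS (k : 'I_d) : p k.+1 = h k 0 *: delta_mx k 0 + p k.
  apply/matrixP => a b; rewrite !mxE (ord1 b) eqxx andbT ltnS leq_eqVlt.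
  have [->|ak] := eqVneq a k; first by rewrite eqxx ltnn mulr1 addr0.
  by rewrite (inj_eq val_inj) (negPf ak) mulr0 add0r.
have step (k : 'I_d) : exists xi : 'cV[R]_d, `|xi| <= `|h| /\
    f (p k.+1 + x) - f (p k + x) = h k 0 * pderiv k f (xi + x).
  have bnd t : 0 <= t <= 1 -> `|t *: (h k 0 *: delta_mx k 0) + p k| <= `|h|.
    move=> /andP[t0 t1]; apply: mx_norm_le => // a b.
    rewrite !mxE (ord1 b) eqxx andbT; have [->|ak] := eqVneq a k.
      rewrite ltnn addr0 mulr1 normrM ger0_norm//.
      rewrite (le_trans _ (mx_norm_coord h k 0))// ler_piMl//.
    rewrite mulr0 mulr0 add0r; case: ifP => _; last by rewrite normr0.
    exact: mx_norm_coord.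
  have [t t01|t t01 E] := @MVT_coord d f k (p k + x) (h k 0).
    by rewrite addrA; apply/df/le_lt_trans/hr/bnd.
  exists (t *: (h k 0 *: delta_mx k 0) + p k); split; first exact: bnd.
  by rewrite pS -addrA E addrA.
have [xi /all_and2 [xi1 xi2]] := choice step.
exists xi; split => //.
have pd : p d = h by apply/matrixP => a b; rewrite !mxE ltn_ord (ord1 b).
have p0 : p 0 = 0 by apply/matrixP => a b; rewrite !mxE.
under eq_bigr do rewrite -xi2.
have -> : \sum_(k < d) (f (p k.+1 + x) - f (p k + x)) =
   \sum_(0 <= k < d) (f (p k.+1 + x) - f (p k + x)) by rewrite big_mkord.
by rewrite telescope_sumr// pd p0 add0r.
Qed.

(** The coefficient of [h k 0] is a partial derivative at an intermediate point of the coordinate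
    path, hence tends to its value at [x]. This expansion plays the role of Frechet
    differentiability in the chain rule. *)
Lemma hadamard_pderiv {d} (f : 'cV[R]_d -> R) (x : 'cV[R]_d) :
  (forall k, \forall y \near x, derivable f y (delta_mx k 0)) ->
  (forall k, {for x, continuous (pderiv k f)}) ->
  exists c : 'cV[R]_d -> 'I_d -> R,
    (forall k, c h k @[h --> (0 : 'cV[R]_d)] --> pderiv k f x) /\
    \forall h \near (0 : 'cV[R]_d), f (h + x) - f x = \sum_k h k 0 * c h k.
Proof.
move=> df cf.
have /filter_forall : forall k, \forall y \near (0 : 'cV[R]_d), derivable f (y + x) (delta_mx k 0).
  by move=> k; have := df k; rewrite (near_shift 0)/=; apply: filterS => y; rewrite subr0.
move=> /nbhs_ballP[r /= r0 rdf].
have br (y : 'cV[R]_d) : `|y| < r -> ball (0 : 'cV[R]_d) r y.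
  by rewrite -ball_normE /ball_/= sub0r normrN.
have H : forall h : 'cV[R]_d, exists xi : 'I_d -> 'cV[R]_d, (forall k, `|xi k| <= `|h|) /\
  (`|h| < r -> f (h + x) - f x = \sum_k h k 0 * pderiv k f (xi k + x)).
  move=> h; have [hr|hr] := ltP `|h| r; last by exists (fun=> 0); split => // k; rewrite normr0.
  have [|xi [x1 x2]] := @increment_pderiv _ f x r _ h hr; last by exists xi.
  by move=> k y /br /rdf /(_ k).
have [xi /all_and2 [x1 x2]] := choice H.
exists (fun h k => pderiv k f (xi h k + x)); split; last first.
  near=> h; apply: x2; near: h.
  apply/nbhs_ballP; exists r => // y; rewrite -ball_normE /ball_/= sub0r normrN//.
move=> k; have H0 : xi h k + x @[h --> (0 : 'cV[R]_d)] --> x.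
  apply: (@cvg_shift0 _ (nbhs (0 : 'cV[R]_d)) _ _ (fun h => xi h k)) => e e0.
  have : \forall h \near (0 : 'cV[R]_d), `|h| <= e by exact: (@nbhs0_le R 'cV[R]_d).
  by apply: filterS => h; exact: le_trans (x1 h k).
exact: cvg_comp H0 (cf k).
Unshelve. all: by end_near. Qed.

(** The Hadamard expansion of [f] at [g x] is applied to the increment of [g] along [v] and divided
    by the step. *)
Lemma chain_pderiv {d} {V : normedModType R} (f : 'cV[R]_d -> R)
    (g : V -> 'cV[R]_d) (x v : V) :
  (forall k, \forall y \near g x, derivable f y (delta_mx k 0)) ->
  (forall k, {for g x, continuous (pderiv k f)}) ->
  derivable g x v ->
  is_derive x v (f \o g) (\sum_k 'D_v (fun y => g y k 0) x * pderiv k f (g x)).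
Proof.
move=> df cf dg; have [c [c1 c2]] := hadamard_pderiv df cf.
have dgk k : h^-1 *: (g (h *: v + x) k 0 - g x k 0) @[h --> 0^'] --> 'D_v (fun y => g y k 0) x.
  by have /derivable_mxP/(_ k 0) := dg.
have g0 : g (h *: v + x) - g x @[h --> (0 : R)^'] --> (0 : 'cV[R]_d).
  have /cvg_mxP H := dg; apply/cvg_mxP => i j.
  have H1 : (h * (h^-1 *: (g (h *: v + x) - g x)) i j) @[h --> (0 : R)^'] -->
    0 * (lim (h^-1 *: (g (h *: v + x) - g x) @[h --> 0^']) i j).
    by apply: cvgM; [exact: nbhs_dnbhs|exact: H].
  rewrite mul0r in H1; rewrite [X in _ --> X]mxE.
  apply: cvg_trans H1; apply: near_eq_cvg; near=> h.
  by rewrite !mxE mulrA divff ?mul1r//; near: h; exact: nbhs_dnbhs_neq.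
have H : h^-1 *: (f (g (h *: v + x)) - f (g x)) @[h --> 0^'] -->
    \sum_k 'D_v (fun y => g y k 0) x * pderiv k f (g x).
  have : \sum_k (h^-1 *: (g (h *: v + x) k 0 - g x k 0)) * c (g (h *: v + x) - g x) k @[h --> 0^'] -->
    \sum_k 'D_v (fun y => g y k 0) x * pderiv k f (g x).
    apply: cvg_big => [|k _]; first exact: add_continuous.
    apply: cvgM; first exact: dgk.
    by apply: cvg_comp (c1 k); exact: g0.
  apply: cvg_trans; apply: near_eq_cvg.
  have := g0 _ c2; rewrite /nbhs/=; apply: filterS => h /=; rewrite subrK => ->.
  rewrite scaler_sumr; apply: eq_bigr => k _.
  by rewrite !mxE -scalerAl.
by apply: DeriveDef; [apply/cvg_ex; eexists; exact: H | exact/cvg_lim].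
Unshelve. all: by end_near. Qed.

(** The mean value theorem is used twice: in direction [a] for the difference of [f] over a step in
    direction [b], then in direction [b] for [pderiv a f]. The intermediate point is a sum of two
    vectors of norm at most [|h|], whence [2 * |h|]. *)
Lemma schwarz_increment {d} (f : 'cV[R]_d -> R) (a b : 'I_d) (x : 'cV[R]_d) (r : R) :
  (forall y, `|y| < r -> derivable f (y + x) (delta_mx a 0)) ->
  (forall y, `|y| < r -> derivable (pderiv a f) (y + x) (delta_mx b 0)) ->
  forall h, `|h| < r / 2 -> exists2 y : 'cV[R]_d, `|y| <= 2 * `|h| &
    f (h *: delta_mx a 0 + (h *: delta_mx b 0 + x)) - f (h *: delta_mx b 0 + x) -
      (f (h *: delta_mx a 0 + x) - f x) = h * (h * pderiv b (pderiv a f) (y + x)).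
Proof.
move=> df ddf h hr.
have n1 (k : 'I_d) t : 0 <= t <= 1 -> `|t *: (h *: (delta_mx k 0 : 'cV[R]_d))| <= `|h|.
  move=> /andP[t0 t1]; apply: mx_norm_le => // i j; rewrite !mxE mulrA normrM.
  apply: (@le_trans _ _ (`|t * h| * 1)).
    by rewrite ler_wpM2l//; case: (_ && _); rewrite ?normr1 ?normr0 ?lexx ?ler01.
  by rewrite mulr1 normrM ger0_norm// ler_piMl.
have n1' (k : 'I_d) : `|h *: (delta_mx k 0 : 'cV[R]_d)| <= `|h|.
  by have := n1 k 1; rewrite scale1r; apply; rewrite ler01 lexx.
pose g y := f (h *: delta_mx b 0 + y) - f y.
have hr2 : `|h| + `|h| < r by rewrite [ltRHS](splitr r) ltrD.
have hr1 : `|h| < r by rewrite (le_lt_trans _ hr2)// lerDl.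
have dfa t : 0 <= t <= 1 -> derivable f (t *: (h *: delta_mx a 0) + x) (delta_mx a 0).
  by move=> t01; apply: df; rewrite (le_lt_trans (n1 _ _ _)).
have dfb t : 0 <= t <= 1 -> derivable (fun y => f (h *: delta_mx b 0 + y))
    (t *: (h *: delta_mx a 0) + x) (delta_mx a 0) /\
    'D_(delta_mx a 0) (fun y => f (h *: delta_mx b 0 + y)) (t *: (h *: delta_mx a 0) + x) =
    pderiv a f (h *: delta_mx b 0 + (t *: (h *: delta_mx a 0) + x)).
  move=> t01.
  have H : derivable f (h *: delta_mx b 0 + (t *: (h *: delta_mx a 0) + x)) (delta_mx a 0).
    rewrite addrA; apply: df; apply: le_lt_trans hr2.
    by rewrite (le_trans (ler_normD _ _))// lerD// n1.
  have E : (fun k : R => k^-1 *: (f (h *: delta_mx b 0 + (k *: delta_mx a 0 + (t *: (h *: delta_mx a 0) + x))) -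
      f (h *: delta_mx b 0 + (t *: (h *: delta_mx a 0) + x)))) =
    (fun k : R => k^-1 *: (f (k *: delta_mx a 0 + (h *: delta_mx b 0 + (t *: (h *: delta_mx a 0) + x))) -
      f (h *: delta_mx b 0 + (t *: (h *: delta_mx a 0) + x)))).
    by apply/funext => k; rewrite (addrCA (h *: delta_mx b 0)).
  by split; [rewrite /derivable E|rewrite /pderiv /derive E].
have [t t01|t t01] := @MVT_coord _ g a x h.
  by apply: derivableB; [case: (dfb t t01)|exact: dfa].
move=> E0.
have -> : f (h *: delta_mx a 0 + (h *: delta_mx b 0 + x)) - f (h *: delta_mx b 0 + x) -
    (f (h *: delta_mx a 0 + x) - f x) = g (h *: delta_mx a 0 + x) - g x.
  by rewrite /g (addrCA (h *: delta_mx b 0)) !opprB; ring.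
rewrite E0 /g /pderiv deriveB; [|by case: (dfb t t01)|exact: dfa].
rewrite (dfb t t01).2 -/(pderiv a f _).
have [u u01|u u01 ->] := @MVT_coord _ (pderiv a f) b (t *: (h *: delta_mx a 0) + x) h.
  rewrite addrA; apply: ddf; apply: le_lt_trans hr2.
  by rewrite (le_trans (ler_normD _ _))// lerD// n1.
exists (u *: (h *: delta_mx b 0) + t *: (h *: delta_mx a 0)); last by rewrite addrA.
by rewrite (le_trans (ler_normD _ _))// mulr_natl mulr2n lerD// n1.
Qed.

(** The second difference of [f] is symmetric in the two directions; divided by [h ^ 2], it tends to
    each of the two mixed derivatives. *)
Lemma pderiv_schwarz {d} (f : 'cV[R]_d -> R) (a b : 'I_d) (x : 'cV[R]_d) :
  (forall k, \forall y \near x, derivable f y (delta_mx k 0)) ->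
  (forall k l, \forall y \near x, derivable (pderiv k f) y (delta_mx l 0)) ->
  (forall k l, {for x, continuous (pderiv k (pderiv l f))}) ->
  pderiv a (pderiv b f) x = pderiv b (pderiv a f) x.
Proof.
move=> df ddf cf.
have sh (Q : 'cV[R]_d -> Prop) : (\forall y \near x, Q y) -> exists2 r : R, 0 < r &
    forall y, `|y| < r -> Q (y + x).
  rewrite (near_shift 0)/= => /nbhs_ballP[r /= r0 rdf]; exists r => // y yr.
  have := rdf y; rewrite /= subr0; apply.
  by rewrite -ball_normE /ball_/= sub0r normrN.
have key (k l : 'I_d) : exists2 y : R -> 'cV[R]_d,
    y h + x @[h --> (0 : R)^'] --> x & \forall h \near (0:R)^',
    f (h *: delta_mx k 0 + (h *: delta_mx l 0 + x)) - f (h *: delta_mx l 0 + x) -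
      (f (h *: delta_mx k 0 + x) - f x) = h * (h * pderiv l (pderiv k f) (y h + x)).
  have [r1 r10 H1] := sh _ (df k); have [r2 r20 H2] := sh _ (ddf k l).
  pose r := Num.min r1 r2.
  have r0 : 0 < r by rewrite lt_min r10.
  have H : forall h : R, exists y : 'cV[R]_d, `|y| <= 2 * `|h| /\ (`|h| < r / 2 ->
    f (h *: delta_mx k 0 + (h *: delta_mx l 0 + x)) - f (h *: delta_mx l 0 + x) -
      (f (h *: delta_mx k 0 + x) - f x) = h * (h * pderiv l (pderiv k f) (y + x))).
    move=> h; have [hr|hr] := ltP `|h| (r / 2); last by exists 0; rewrite normr0; split => //; rewrite mulr_ge0.
    have [y|y|y y1 y2] := @schwarz_increment _ f k l x r _ _ h hr.
    - by rewrite lt_min => /andP[/H1].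
    - by rewrite lt_min => /andP[_ /H2].
    - by exists y.
  have [y /all_and2[y1 y2]] := choice H.
  exists y; last by near=> h; apply: y2; near: h; apply: dnbhs0_lt; rewrite divr_gt0.
  apply: cvg_shift0 => e e0; near=> h; apply: le_trans (y1 h) _.
  by rewrite mulrC -ler_pdivlMr//; near: h; apply: dnbhs0_le; rewrite divr_gt0.
have [y y1 y2] := key a b; have [z z1 z2] := key b a.
have c1 : pderiv b (pderiv a f) (y h + x) @[h --> (0 : R)^'] --> pderiv b (pderiv a f) x.
  exact: cvg_comp y1 (cf b a).
have c2 : pderiv a (pderiv b f) (z h + x) @[h --> (0 : R)^'] --> pderiv a (pderiv b f) x.
  exact: cvg_comp z1 (cf a b).
suff c1' : pderiv a (pderiv b f) (z h + x) @[h --> (0 : R)^'] --> pderiv b (pderiv a f) x.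
  exact: cvg_unique c2 c1'.
apply: cvg_trans c1; apply: near_eq_cvg.
apply: filterS3 y2 z2 (nbhs_dnbhs_neq (0 : R)) => h E1 E2 h0.
suff : h * (h * pderiv b (pderiv a f) (y h + x)) = h * (h * pderiv a (pderiv b f) (z h + x)).
  by move=> /(mulfI h0)/(mulfI h0).
refine (etrans (esym E1) (etrans _ E2)).
by rewrite (addrCA (h *: delta_mx a 0)); ring.
Unshelve. all: by end_near. Qed.

End PartialDerivatives.

(** * Smoothness graded by order, and its closure properties *)

Section SmoothFunctions.
Context {R : realType}.

Lemma continuous_mxP {T : topologicalType} {p q} (F : T -> 'M[R]_(p, q)) (x : T) :
  {for x, continuous F} <-> forall i j, {for x, continuous (fun y => F y i j)}.
Proof. exact: (@cvg_mxP R T (nbhs x) _ p q F (F x)). Qed.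

Definition C0_derivable {d} {W : normedModType R} (U : set 'cV[R]_d)
    (f : 'cV[R]_d -> W) : Prop :=
  forall x, U x -> {for x, continuous f} /\ forall k : 'I_d, derivable f x (delta_mx k 0).

(** While [smooth_on] speaks of words of derivatives, the order is here peeled off from the first
    derivative taken. This allows induction through Leibniz-type formulas, where a derivative is
    built from functions of one order less. *)
Fixpoint Ck_on {d} {W : normedModType R} (m : nat) (U : set 'cV[R]_d)
    (f : 'cV[R]_d -> W) : Prop :=
  C0_derivable U f /\
  (if m is m'.+1 then forall k : 'I_d, Ck_on m' U (pderiv k f) else True).

Lemma Ck_on0 {d} {W : normedModType R} m (U : set 'cV[R]_d) (f : 'cV[R]_d -> W) :
  Ck_on m U f -> C0_derivable U f.
Proof. by case: m => [|m] []. Qed.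

Lemma Ck_onW {d} {W : normedModType R} m (U : set 'cV[R]_d) (f : 'cV[R]_d -> W) :
  Ck_on m.+1 U f -> Ck_on m U f.
Proof.
elim: m f => [|m IH] f [H1 H2]; first by split.
by split=> // k; apply: IH; exact: H2.
Qed.

Lemma smooth_on_pderiv {d} {W : normedModType R} (U : set 'cV[R]_d)
    (f : 'cV[R]_d -> W) k : smooth_on U f -> smooth_on U (pderiv k f).
Proof. by move=> sf s x Ux; have := sf (rcons s k) x Ux; rewrite foldr_rcons. Qed.

Lemma smooth_onP {d} {W : normedModType R} (U : set 'cV[R]_d) (f : 'cV[R]_d -> W) :
  smooth_on U f <-> forall m, Ck_on m U f.
Proof.
split=> [+ m|cf s x Ux].
  elim: m f => [|m IH] f sf.
    by split=> // x Ux; exact: (sf [::] x Ux).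
  split=> [x Ux|k]; first exact: (sf [::] x Ux).
  exact/IH/smooth_on_pderiv.
elim/last_ind: s f {cf}(cf (size s)) => [|s k IH] f; first by case=> + _; exact.
by rewrite size_rcons foldr_rcons => -[_ H]; exact/IH/H.
Qed.

Lemma smooth_on_continuous {d} {W : normedModType R} {U : set 'cV[R]_d}
    {f : 'cV[R]_d -> W} {x} : smooth_on U f -> U x -> {for x, continuous f}.
Proof. by move=> sf Ux; exact: (sf [::] x Ux).1. Qed.

Lemma smooth_on_derivable {d} {W : normedModType R} {U : set 'cV[R]_d}
    {f : 'cV[R]_d -> W} {x} k :
  smooth_on U f -> U x -> derivable f x (delta_mx k 0).
Proof. by move=> sf Ux; exact: (sf [::] x Ux).2. Qed.

Lemma smooth_on_sub {d} {W : normedModType R} (U V : set 'cV[R]_d)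
    (f : 'cV[R]_d -> W) : V `<=` U -> smooth_on U f -> smooth_on V f.
Proof. by move=> VU sf s x /VU; exact: sf. Qed.

Lemma near_open {T : topologicalType} (U : set T) (x : T) :
  open U -> U x -> \forall y \near x, U y.
Proof. by move=> oU Ux; apply: open_nbhs_nbhs; split. Qed.

Lemma pderiv_eq_on {d} {W : normedModType R} (U : set 'cV[R]_d)
    (f g : 'cV[R]_d -> W) k x : open U -> (forall y, U y -> f y = g y) -> U x ->
  pderiv k f x = pderiv k g x.
Proof.
move=> oU fg Ux; apply: near_eq_derive.
by apply: filterS (near_open oU Ux) => y; exact: fg.
Qed.

Lemma near_continuous_at {T : topologicalType} {W : topologicalType} (f g : T -> W) (x : T) :
  (\forall y \near x, f y = g y) -> {for x, continuous f} -> {for x, continuous g}.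
Proof.
move=> fg cf; rewrite /prop_for /continuous_at -(nbhs_singleton fg).
by apply: cvg_trans cf; exact: near_eq_cvg.
Qed.

Lemma C0_derivable_eq {d} {W : normedModType R} (U : set 'cV[R]_d)
    (f g : 'cV[R]_d -> W) : open U -> (forall y, U y -> f y = g y) ->
  C0_derivable U f -> C0_derivable U g.
Proof.
move=> oU fg H x Ux; have [cf df] := H x Ux.
have nfg : \forall y \near x, f y = g y by apply: filterS (near_open oU Ux) => y; exact: fg.
by split=> [|k]; [exact: near_continuous_at nfg cf|exact: near_eq_derivable nfg (df k)].
Qed.

Lemma Ck_on_eq {d} {W : normedModType R} m (U : set 'cV[R]_d)
    (f g : 'cV[R]_d -> W) : open U -> (forall y, U y -> f y = g y) ->
  Ck_on m U f -> Ck_on m U g.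
Proof.
move=> oU; elim: m f g => [|m IH] f g fg [H1 H2]; split => //; try exact: C0_derivable_eq fg H1.
by move=> k; apply: IH (H2 k) => y Uy; exact: pderiv_eq_on fg Uy.
Qed.

Lemma smooth_on_eq {d} {W : normedModType R} (U : set 'cV[R]_d)
    (f g : 'cV[R]_d -> W) : open U -> (forall y, U y -> f y = g y) ->
  smooth_on U f -> smooth_on U g.
Proof. by move=> oU fg /smooth_onP sf; apply/smooth_onP => m; exact: Ck_on_eq fg (sf m). Qed.

Lemma Ck_on_cst {d} {W : normedModType R} m (U : set 'cV[R]_d) (a : W) :
  Ck_on m U (fun=> a).
Proof.
elim: m a => [|m IH] a; split => //; try by move=> x _; split=> [|k];
  [exact: cst_continuous|exact: derivable_cst].
move=> k; have -> : pderiv k (fun=> a) = (fun=> 0) :> ('cV[R]_d -> W).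
  by apply/funext => x; exact: derive_cst.
exact: IH.
Qed.

Lemma smooth_on_cst {d} {W : normedModType R} (U : set 'cV[R]_d) (a : W) :
  smooth_on U (fun=> a).
Proof. by apply/smooth_onP => m; exact: Ck_on_cst. Qed.

Variables (d : nat) (U : set 'cV[R]_d).
Hypothesis oU : open U.
Implicit Types f g : 'cV[R]_d -> R.

Lemma C0_derivable_add f g : C0_derivable U f -> C0_derivable U g ->
  C0_derivable U (fun x => f x + g x).
Proof.
move=> cf cg x Ux; have [cf1 df] := cf x Ux; have [cg1 dg] := cg x Ux.
by split=> [|k]; [exact: continuousD|exact: derivableD].
Qed.

Lemma C0_derivable_mul f g : C0_derivable U f -> C0_derivable U g ->
  C0_derivable U (fun x => f x * g x).
Proof.
move=> cf cg x Ux; have [cf1 df] := cf x Ux; have [cg1 dg] := cg x Ux.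
by split=> [|k]; [exact: continuousM|exact: derivableM].
Qed.

Lemma C0_derivable_inv f : (forall x, U x -> f x != 0) -> C0_derivable U f ->
  C0_derivable U (fun x => (f x)^-1).
Proof.
move=> f0 cf x Ux; have [cf1 df] := cf x Ux.
by split=> [|k]; [exact: continuousV (f0 _ Ux) cf1|exact: derivableV (f0 _ Ux) (df k)].
Qed.

Lemma Ck_on_add m f g : Ck_on m U f -> Ck_on m U g -> Ck_on m U (fun x => f x + g x).
Proof.
elim: m f g => [|m IH] f g cf cg; (split; first exact: C0_derivable_add (Ck_on0 cf) (Ck_on0 cg)) => //.
move=> k; apply: (@Ck_on_eq _ _ _ _ (fun x => pderiv k f x + pderiv k g x)) => //.
  move=> x Ux; have [_ df] := Ck_on0 cf Ux; have [_ dg] := Ck_on0 cg Ux.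
  by rewrite [RHS]deriveD.
by apply: IH; [exact: cf.2|exact: cg.2].
Qed.

Lemma Ck_on_mul m f g : Ck_on m U f -> Ck_on m U g -> Ck_on m U (fun x => f x * g x).
Proof.
elim: m f g => [|m IH] f g cf cg; (split; first exact: C0_derivable_mul (Ck_on0 cf) (Ck_on0 cg)) => //.
move=> k; apply: (@Ck_on_eq _ _ _ _ (fun x => f x * pderiv k g x + g x * pderiv k f x)) => //.
  move=> x Ux; have [_ df] := Ck_on0 cf Ux; have [_ dg] := Ck_on0 cg Ux.
  by rewrite [RHS]deriveM.
by apply: Ck_on_add; apply: IH; [exact: Ck_onW|exact: cg.2|exact: Ck_onW|exact: cf.2].
Qed.

(** The derivative of [1 / f] contains [1 / f] again, but at one order less, so the induction
    closes. The square root below behaves in the same way. *)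
Lemma Ck_on_inv m f : (forall x, U x -> f x != 0) -> Ck_on m U f ->
  Ck_on m U (fun x => (f x)^-1).
Proof.
move=> f0; elim: m f f0 => [|m IH] f f0 cf;
  (split; first exact: C0_derivable_inv f0 (Ck_on0 cf)) => //.
move=> k.
apply: (@Ck_on_eq _ _ _ _ (fun x => -1 * ((f x)^-1 * (f x)^-1) * pderiv k f x)) => //.
  move=> x Ux; have [_ df] := Ck_on0 cf Ux.
  by rewrite [RHS]deriveV ?f0// /GRing.scale/= mulN1r -invfM expr2.
have cV : Ck_on m U (fun x => (f x)^-1) by apply: IH => //; exact: Ck_onW.
by apply: Ck_on_mul; [apply: Ck_on_mul; [exact: Ck_on_cst|exact: Ck_on_mul]|exact: cf.2].
Qed.

Lemma is_derive_sqrt_comp f x v : 0 < f x -> derivable f x v ->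
  is_derive x v (fun y => Num.sqrt (f y)) ((2 * Num.sqrt (f x))^-1 * 'D_v f x).
Proof.
move=> f0 df.
have E : is_derive (0 : R) 1 (fun h => Num.sqrt (f (h *: v + x)))
    ((2 * Num.sqrt (f x))^-1 * 'D_v f x).
  have d1 : is_derive (0 : R) 1 (fun h => f (h *: v + x)) ('D_v f x).
    by have := @is_derive_line _ _ f x v 0; rewrite scale0r add0r; apply.
  have d2 : is_derive (f (0 *: v + x)) 1 Num.sqrt (2 * Num.sqrt (f x))^-1.
    by rewrite scale0r add0r; exact: is_derive1_sqrt.
  exact: (@is_derive1_comp _ Num.sqrt (fun h => f (h *: v + x))).
have H : h^-1 *: (Num.sqrt (f (h *: v + x)) - Num.sqrt (f x)) @[h --> 0^'] -->
    (2 * Num.sqrt (f x))^-1 * 'D_v f x.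
  have [H1 <-] := E; apply: cvg_trans H1; apply: near_eq_cvg.
  by near=> h => /=; rewrite [h *: 1]mulr1 addr0 scale0r add0r.
by apply: DeriveDef; [apply/cvg_ex; eexists; exact: H | exact/cvg_lim].
Unshelve. all: by end_near. Qed.

Lemma C0_derivable_sqrt f : (forall x, U x -> 0 < f x) -> C0_derivable U f ->
  C0_derivable U (fun x => Num.sqrt (f x)).
Proof.
move=> f0 cf x Ux; have [cf1 df] := cf x Ux; split=> [|k].
  exact: (continuous_comp cf1 (@sqrt_continuous R (f x))).
by case: (is_derive_sqrt_comp (f0 _ Ux) (df k)).
Qed.

Lemma Ck_on_sqrt m f : (forall x, U x -> 0 < f x) -> Ck_on m U f ->
  Ck_on m U (fun x => Num.sqrt (f x)).
Proof.
move=> f0; elim: m f f0 => [|m IH] f f0 cf;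
  (split; first exact: C0_derivable_sqrt f0 (Ck_on0 cf)) => //.
move=> k.
apply: (@Ck_on_eq _ _ _ _ (fun x => (2 * Num.sqrt (f x))^-1 * pderiv k f x)) => //.
  move=> x Ux; have [_ df] := Ck_on0 cf Ux.
  by rewrite [RHS](@derive_val _ _ _ _ _ _ _ (is_derive_sqrt_comp (f0 _ Ux) (df k))).
apply: Ck_on_mul; last exact: cf.2.
apply: Ck_on_inv => [x Ux|]; first by rewrite mulf_neq0// gt_eqF// sqrtr_gt0 f0.
by apply: Ck_on_mul; [exact: Ck_on_cst|apply: IH => //; exact: Ck_onW].
Qed.

Lemma smooth_on_add f g : smooth_on U f -> smooth_on U g ->
  smooth_on U (fun x => f x + g x).
Proof. by move=> /smooth_onP sf /smooth_onP sg; apply/smooth_onP => m; exact: Ck_on_add. Qed.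

Lemma smooth_on_mul f g : smooth_on U f -> smooth_on U g ->
  smooth_on U (fun x => f x * g x).
Proof. by move=> /smooth_onP sf /smooth_onP sg; apply/smooth_onP => m; exact: Ck_on_mul. Qed.

Lemma smooth_on_inv f : (forall x, U x -> f x != 0) -> smooth_on U f ->
  smooth_on U (fun x => (f x)^-1).
Proof. by move=> f0 /smooth_onP sf; apply/smooth_onP => m; exact: Ck_on_inv. Qed.

Lemma smooth_on_sqrt f : (forall x, U x -> 0 < f x) -> smooth_on U f ->
  smooth_on U (fun x => Num.sqrt (f x)).
Proof. by move=> f0 /smooth_onP sf; apply/smooth_onP => m; exact: Ck_on_sqrt. Qed.

Lemma smooth_on_sum {I : Type} (r : seq I) (P : pred I) (F : I -> 'cV[R]_d -> R) :
  (forall i, P i -> smooth_on U (F i)) ->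
  smooth_on U (fun x => \sum_(i <- r | P i) F i x).
Proof.
move=> sF; elim: r => [|i r IH].
  by under eq_fun do rewrite big_nil; exact: smooth_on_cst.
under eq_fun do rewrite big_cons.
have [Pi|_] := boolP (P i); last exact: IH.
by apply: smooth_on_add; [exact: sF|exact: IH].
Qed.

Lemma smooth_on_prod {I : Type} (r : seq I) (P : pred I) (F : I -> 'cV[R]_d -> R) :
  (forall i, P i -> smooth_on U (F i)) ->
  smooth_on U (fun x => \prod_(i <- r | P i) F i x).
Proof.
move=> sF; elim: r => [|i r IH].
  by under eq_fun do rewrite big_nil; exact: smooth_on_cst.
under eq_fun do rewrite big_cons.
have [Pi|_] := boolP (P i); last exact: IH.
by apply: smooth_on_mul; [exact: sF|exact: IH].
Qed.

Lemma smooth_on_opp f : smooth_on U f -> smooth_on U (fun x => - f x).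
Proof.
move=> sf; under eq_fun do rewrite -mulN1r.
by apply: smooth_on_mul; [exact: smooth_on_cst|exact: sf].
Qed.

Lemma smooth_on_exp f e : smooth_on U f -> smooth_on U (fun x => f x ^+ e).
Proof.
move=> sf; elim: e => [|e IH].
  by under eq_fun do rewrite expr0; exact: smooth_on_cst.
by under eq_fun do rewrite exprS; exact: smooth_on_mul.
Qed.

Lemma pderiv_mx {p q} (F : 'cV[R]_d -> 'M[R]_(p, q)) k x i j :
  derivable F x (delta_mx k 0) -> pderiv k F x i j = pderiv k (fun y => F y i j) x.
Proof. by move=> dF; rewrite /pderiv derive_mx// mxE. Qed.

Lemma C0_derivable_mxP {p q} (F : 'cV[R]_d -> 'M[R]_(p, q)) :
  C0_derivable U F <-> forall i j, C0_derivable U (fun x => F x i j).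
Proof.
split=> [H i j x Ux|H x Ux].
  have [/continuous_mxP cF dF] := H x Ux.
  by split=> [|k]; [exact: cF|have /derivable_mxP := dF k; exact].
split=> [|k]; first by apply/continuous_mxP => i j; exact: (H i j x Ux).1.
by apply/derivable_mxP => i j; exact: (H i j x Ux).2.
Qed.

Lemma Ck_on_mxP {p q} m (F : 'cV[R]_d -> 'M[R]_(p, q)) :
  Ck_on m U F <-> forall i j, Ck_on m U (fun x => F x i j).
Proof.
elim: m F => [|m IH] F; split.
- by move=> [/C0_derivable_mxP H1 _] i j; split; first exact: H1.
- by move=> H; split=> //; apply/C0_derivable_mxP => i j; exact: (H i j).1.
- move=> [H1 H2] i j; split=> [|k]; first by have /C0_derivable_mxP := H1; exact.
  have /IH/(_ i j) := H2 k; apply: Ck_on_eq => // x Ux.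
  by apply: pderiv_mx; have [] := H1 x Ux.
- move=> H.
  have H1 : C0_derivable U F by apply/C0_derivable_mxP => i j; exact: (H i j).1.
  split=> // k; apply/IH => i j.
  apply: (Ck_on_eq oU _ ((H i j).2 k)) => x Ux; rewrite pderiv_mx//.
  by have [] := H1 x Ux.
Qed.

Lemma smooth_on_mxP {p q} (F : 'cV[R]_d -> 'M[R]_(p, q)) :
  smooth_on U F <-> forall i j, smooth_on U (fun x => F x i j).
Proof.
split=> [/smooth_onP sF i j|sF]; apply/smooth_onP => m.
  by have /Ck_on_mxP := sF m; exact.
by apply/Ck_on_mxP => i j; have /smooth_onP := sF i j; exact.
Qed.

Lemma smooth_on_mulmx {p q r} (A : 'cV[R]_d -> 'M[R]_(p, q)) (B : 'cV[R]_d -> 'M[R]_(q, r)) :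
  smooth_on U A -> smooth_on U B -> smooth_on U (fun x => A x *m B x).
Proof.
move=> /smooth_on_mxP sA /smooth_on_mxP sB; apply/smooth_on_mxP => i j.
under eq_fun do rewrite mxE.
by apply: smooth_on_sum => k _; apply: smooth_on_mul; [exact: sA|exact: sB].
Qed.

Lemma smooth_on_tr {p q} (A : 'cV[R]_d -> 'M[R]_(p, q)) :
  smooth_on U A -> smooth_on U (fun x => (A x)^T).
Proof.
move=> /smooth_on_mxP sA; apply/smooth_on_mxP => i j.
under eq_fun do rewrite mxE.
exact: sA.
Qed.

Lemma smooth_on_addmx {p q} (A B : 'cV[R]_d -> 'M[R]_(p, q)) :
  smooth_on U A -> smooth_on U B -> smooth_on U (fun x => A x + B x).
Proof.
move=> /smooth_on_mxP sA /smooth_on_mxP sB; apply/smooth_on_mxP => i j.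
under eq_fun do rewrite mxE.
by apply: smooth_on_add; [exact: sA|exact: sB].
Qed.

Lemma smooth_on_summx {p q} {I : Type} (r : seq I) (P : pred I)
    (F : I -> 'cV[R]_d -> 'M[R]_(p, q)) :
  (forall i, P i -> smooth_on U (F i)) ->
  smooth_on U (fun x => \sum_(i <- r | P i) F i x).
Proof.
move=> sF; apply/smooth_on_mxP => a b; under eq_fun do rewrite summxE.
by apply: smooth_on_sum => i Pi; have /smooth_on_mxP := sF i Pi; exact.
Qed.

Lemma smooth_on_scalemx {p q} f (A : 'cV[R]_d -> 'M[R]_(p, q)) :
  smooth_on U f -> smooth_on U A -> smooth_on U (fun x => f x *: A x).
Proof.
move=> sf /smooth_on_mxP sA; apply/smooth_on_mxP => i j.
under eq_fun do rewrite mxE.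
by apply: smooth_on_mul; [exact: sf|exact: sA].
Qed.

Lemma smooth_on_det {p} (A : 'cV[R]_d -> 'M[R]_p) :
  smooth_on U A -> smooth_on U (fun x => \det (A x)).
Proof.
move=> /smooth_on_mxP sA; apply: smooth_on_sum => s _.
apply: smooth_on_mul; first exact: smooth_on_cst.
by apply: smooth_on_prod => i _.
Qed.

Lemma smooth_on_invmx {p} (A : 'cV[R]_d -> 'M[R]_p) :
  (forall x, U x -> A x \in unitmx) -> smooth_on U A ->
  smooth_on U (fun x => invmx (A x)).
Proof.
move=> uA sA; apply: (@smooth_on_eq _ _ _ (fun x => (\det (A x))^-1 *: \adj (A x)) _ oU).
  by move=> x Ux; rewrite /invmx uA.
apply: smooth_on_scalemx.
  apply: smooth_on_inv => [x /uA|]; first by rewrite unitmxE unitfE.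
  exact: smooth_on_det.
apply/smooth_on_mxP => i j; under eq_fun do rewrite mxE.
apply: smooth_on_mul; first exact: smooth_on_cst.
apply: smooth_on_det; apply/smooth_on_mxP => a b; under eq_fun do rewrite !mxE.
by have /smooth_on_mxP := sA; exact.
Qed.

End SmoothFunctions.

(** * Functions of time and space: restriction to a time slice, pullback from space *)

Section Slices.
Context {R : realType} {n : nat}.
Implicit Types (t : R) (x : 'cV[R]_n) (z : 'cV[R]_(1 + n)).

Definition time_slice t x : 'cV[R]_(1 + n) := col_mx (t%:M : 'M[R]_1) x.

Lemma time_time_slice t x : time (time_slice t x) = t.
Proof. by rewrite /time /time_slice col_mxKu mxE eqxx mulr1n. Qed.

Lemma space_time_slice t x : space (time_slice t x) = x.
Proof. by rewrite /space /time_slice col_mxKd. Qed.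

Lemma time_slice_eta z : time_slice (time z) (space z) = z.
Proof.
rewrite /time_slice /time /space -[RHS]vsubmxK; congr col_mx.
by apply/matrixP => i j; rewrite !(ord1 i, ord1 j) mxE eqxx mulr1n.
Qed.

Lemma time_slice_shift t (h : R) (k : 'I_n) x :
  h *: delta_mx (rshift 1 k) 0 + time_slice t x = time_slice t (h *: delta_mx k 0 + x).
Proof.
rewrite /time_slice; apply/matrixP => i j; rewrite !mxE (ord1 j) eqxx andbT.
case: splitP => a ia; rewrite !mxE.
  suff /negPf -> : i != rshift 1 k by rewrite mulr0 add0r.
  by apply/eqP => /(congr1 val)/=; rewrite ia (ord1 a).
rewrite eqxx andbT; congr (_ * _%:R + _); congr nat_of_bool.
by rewrite -!val_eqE/= ia eqn_add2l.
Qed.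

Lemma space_shift (h : R) (k : 'I_n) z :
  space (h *: delta_mx (rshift 1 k) 0 + z) = h *: delta_mx k 0 + space z.
Proof.
rewrite -[z in LHS]time_slice_eta time_slice_shift space_time_slice; congr (_ + _).
Qed.

Lemma space_shift0 (h : R) z : space (h *: delta_mx (lshift n 0) 0 + z) = space z.
Proof.
apply/matrixP => i j; rewrite !mxE.
suff /negPf -> : rshift 1 i != lshift n 0 by rewrite /= mulr0 add0r.
by rewrite -val_eqE.
Qed.

(** An affine substitution identifies the difference quotients themselves, step by step, so no chain
    rule is involved and [f] may take values in any [W]. The case [w = 0] makes the time derivative
    of a function of space vanish. *)
Lemma derive_reparam {d e} {W : normedModType R} (f : 'cV[R]_e -> W)
    (sigma : 'cV[R]_d -> 'cV[R]_e) (v x : 'cV[R]_d) (w : 'cV[R]_e) :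
  (forall h, sigma (h *: v + x) = h *: w + sigma x) ->
  'D_v (fun y => f (sigma y)) x = 'D_w f (sigma x) /\
  (derivable f (sigma x) w -> derivable (fun y => f (sigma y)) x v).
Proof.
move=> sE.
have E : (fun h : R => h^-1 *: (f (sigma (h *: v + x)) - f (sigma x))) =
    (fun h : R => h^-1 *: (f (h *: w + sigma x) - f (sigma x))).
  by apply/funext => h; rewrite sE.
by split; [rewrite /derive [in LHS]E|rewrite /derivable [in X in _ -> X]E].
Qed.

Lemma pderiv_time_slice {W : normedModType R} (f : 'cV[R]_(1 + n) -> W) t k x :
  pderiv k (fun x => f (time_slice t x)) x = pderiv (rshift 1 k) f (time_slice t x).
Proof. by apply: (derive_reparam f _).1 => h; rewrite time_slice_shift. Qed.

Lemma derivable_time_slice {W : normedModType R} (f : 'cV[R]_(1 + n) -> W) t k x :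
  derivable f (time_slice t x) (delta_mx (rshift 1 k) 0) ->
  derivable (fun x => f (time_slice t x)) x (delta_mx k 0).
Proof. by apply: (derive_reparam f _).2 => h; rewrite time_slice_shift. Qed.

Lemma continuous_time_slice t : continuous (time_slice t).
Proof.
move=> x; apply/continuous_mxP => i j; case: (fintype.splitP i) => a ia.
  rewrite (_ : (fun y => _) = (fun=> (t%:M : 'M[R]_1) a j)); first exact: cst_continuous.
  by apply/funext => y; rewrite (_ : i = lshift n a) ?col_mxEu//; exact: val_inj.
rewrite (_ : (fun y => _) = (fun y : 'cV[R]_n => y a j)); first exact: coord_continuous.
by apply/funext => y; rewrite (_ : i = rshift 1 a) ?col_mxEd//; exact: val_inj.
Qed.

Lemma continuous_space : continuous (@space R n).
Proof.
move=> z; apply/continuous_mxP => i j.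
rewrite (_ : (fun y => _) = (fun y : 'cV[R]_(1 + n) => y (rshift 1 i) j)).
  exact: coord_continuous.
by apply/funext => y; rewrite mxE.
Qed.

Lemma continuous_time : continuous (@time R n).
Proof.
move=> z; rewrite (_ : @time R n = (fun y : 'cV[R]_(1 + n) => y (lshift n 0) 0)).
  exact: coord_continuous.
by apply/funext => y; rewrite /time mxE.
Qed.

Lemma smooth_on_time_slice {W : normedModType R} (U : set 'cV[R]_(1 + n))
    (f : 'cV[R]_(1 + n) -> W) t :
  smooth_on U f -> smooth_on (time_slice t @^-1` U) (fun x => f (time_slice t x)).
Proof.
move=> sf s x Ux.
have E : foldr pderiv (fun x => f (time_slice t x)) s =
    (fun x => foldr pderiv f [seq rshift 1 k | k <- s] (time_slice t x)).
  elim: s => [//|k s IH] /=; rewrite IH; apply/funext => y; exact: pderiv_time_slice.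
rewrite E; have [cf df] := sf [seq rshift 1 k | k <- s] _ Ux; split.
  by apply: continuous_comp; [exact: continuous_time_slice|exact: cf].
by move=> k; apply: derivable_time_slice.
Qed.

Lemma Ck_on_space {W : normedModType R} m (U : set 'cV[R]_n) (f : 'cV[R]_n -> W) :
  Ck_on m U f -> Ck_on m (space @^-1` U) (fun z => f (space z)).
Proof.
have k0P (k : 'I_(1 + n)) : k = lshift n 0 \/ exists j, k = rshift 1 j.
  case: (fintype.splitP k) => a ka; [left|right; exists a]; apply: val_inj => //=.
  by rewrite ka (ord1 a).
have C0 (g : 'cV[R]_n -> W) : C0_derivable U g ->
    C0_derivable (space @^-1` U) (fun z => g (space z)).
  move=> H z Uz; have [cg dg] := H _ Uz; split.
    by apply: continuous_comp; [exact: continuous_space|exact: cg].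
  move=> k; have [->|[j ->]] := k0P k.
    apply: (@derive_reparam _ _ _ g _ _ _ 0 _).2; last exact: derivable0.
    by move=> h; rewrite space_shift0 scaler0 add0r.
  apply: (@derive_reparam _ _ _ g _ _ _ (delta_mx j 0) _).2; last exact: dg.
  by move=> h; rewrite space_shift.
elim: m f => [|m IH] f [H1 H2]; (split; first exact: C0) => // k.
have [->|[j ->]] := k0P k.
  rewrite (_ : pderiv _ _ = (fun=> 0)); first exact: Ck_on_cst.
  apply/funext => z; rewrite /pderiv (@derive_reparam _ _ _ f _ _ _ 0 _).1 ?derive0//.
  by move=> h; rewrite space_shift0 scaler0 add0r.
rewrite (_ : pderiv _ _ = (fun z => pderiv j f (space z))); first by apply: IH; exact: H2.
apply/funext => z; apply: (@derive_reparam _ _ _ f _ _ _ (delta_mx j 0) _).1.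
by move=> h; rewrite space_shift.
Qed.

Lemma smooth_on_space {W : normedModType R} (U : set 'cV[R]_n) (f : 'cV[R]_n -> W) :
  smooth_on U f -> smooth_on (space @^-1` U) (fun z => f (space z)).
Proof. by move=> /smooth_onP sf; apply/smooth_onP => m; exact: Ck_on_space. Qed.

Lemma smooth_on_coord {d} (U : set 'cV[R]_d) (i : 'I_d) :
  smooth_on U (fun y : 'cV[R]_d => y i 0).
Proof.
apply/smooth_onP => m.
have H k (x : 'cV[R]_d) : is_derive x (delta_mx k 0) (fun z : 'cV[R]_d => z i 0) ((i == k)%:R : R).
  have E : (fun h : R => h^-1 *: ((h *: delta_mx k 0 + x) i 0 - x i 0)) @ 0^' --> ((i == k)%:R : R).
    apply: cvg_near_cst; near=> h.
    have h0 : h != 0 by near: h; exact: nbhs_dnbhs_neq.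
    by rewrite !mxE addrK eqxx andbT [_ *: _]mulrA mulVf// mul1r.
  by apply: DeriveDef; [apply/cvg_ex; eexists; exact: E | exact/cvg_lim].
have E k : pderiv k (fun z : 'cV[R]_d => z i 0) = (fun=> (i == k)%:R).
  by apply/funext => x; exact: derive_val.
have C0 : C0_derivable U (fun z : 'cV[R]_d => z i 0).
  by move=> x _; split=> [|k]; [exact: coord_continuous|case: (H k x)].
by case: m => [|m]; split => // k; rewrite E; exact: Ck_on_cst.
Unshelve. all: by end_near. Qed.

Lemma smooth_on_time (U : set 'cV[R]_(1 + n)) : smooth_on U (@time R n).
Proof.
rewrite (_ : @time R n = (fun z => z (lshift n 0) 0)); first exact: smooth_on_coord.
by apply/funext => z; rewrite /time mxE.
Qed.

End Slices.

(** * Integration without measurability and finiteness of the volume *)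

Section UpperIntegral.
Context {R : realType}.
Local Open Scope ereal_scope.
Local Notation mu := (@lebesgue_measure R).

(** The integral of a nonnegative function is a supremum over the simple functions below it, which
    is monotone without any measurability. *)
Lemma le_integral_nonmeasurable d (T : measurableType d) (m : {measure set T -> \bar R})
    (f g : T -> \bar R) : (forall x, 0 <= f x) -> (forall x, f x <= g x) ->
  \int[m]_x f x <= \int[m]_x g x.
Proof.
move=> f0 fg; have g0 x : 0 <= g x by exact: le_trans (f0 x) (fg x).
rewrite !ge0_integralTE//; apply: ereal_sup_le => _ [h hf <-]; exists h => // x.
exact: le_trans (hf x) (fg x).
Qed.

(* Being countably subadditive on all functions, the upper integral spares any
   measurability argument for densities in charts. *)
Definition upper_integral (f : R -> \bar R) : \bar R :=
  ereal_inf [set \int[mu]_x g x | g in [set g : R -> \bar R |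
    measurable_fun [set: R] g /\ forall x, f x <= g x]].

Lemma upper_integral_ge0 f : (forall x, 0 <= f x) -> 0 <= upper_integral f.
Proof.
move=> f0; apply: le_ereal_inf_tmp => _ [g [_ fg] <-].
by apply: integral_ge0 => x _; exact: le_trans (f0 x) (fg x).
Qed.

Lemma le_upper_integral f g : (forall x, f x <= g x) ->
  upper_integral f <= upper_integral g.
Proof.
move=> fg; apply: ereal_inf_le_tmp => _ [h [mh gh] <-]; exists h => //.
by split=> // x; exact: le_trans (fg x) (gh x).
Qed.

Lemma integral_le_upper_integral f : (forall x, 0 <= f x) ->
  \int[mu]_x f x <= upper_integral f.
Proof.
move=> f0; apply: le_ereal_inf_tmp => _ [g [_ fg] <-].
exact: le_integral_nonmeasurable.
Qed.

Lemma upper_integral_le f g : measurable_fun [set: R] g -> (forall x, f x <= g x) ->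
  upper_integral f <= \int[mu]_x g x.
Proof. by move=> mg fg; apply: ereal_inf_lbound; exists g. Qed.

Lemma upper_integral_adherent f (e : R) : (forall x, 0 <= f x) ->
  upper_integral f != +oo -> (0 < e)%R -> exists g, [/\ measurable_fun [set: R] g,
    forall x, f x <= g x & \int[mu]_x g x <= upper_integral f + e%:E].
Proof.
move=> f0 foo e0.
have fin : upper_integral f \is a fin_num by rewrite ge0_fin_numE ?upper_integral_ge0// ltey.
have [_ [g [mg fg] <-] gle] := lb_ereal_inf_adherent e0 fin.
by exists g; split => //; exact: ltW.
Qed.

(** Each term has a measurable majorant whose integral exceeds the upper integral by at most
    [e / 2 ^ k.+1], and measurable majorants can be summed under the integral. If some term is
    infinite, the bound is trivial. *)
Lemma upper_integral_nneseries (f : nat -> R -> \bar R) :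
  (forall k x, 0 <= f k x) ->
  upper_integral (fun x => \sum_(k <oo) f k x) <= \sum_(k <oo) upper_integral (f k).
Proof.
move=> f0; have u0 k : 0 <= upper_integral (f k) by exact: upper_integral_ge0.
have [[k koo]|noo] := pselect (exists k, upper_integral (f k) = +oo).
  by rewrite (eseries_pinfty _ _ koo) ?leey// => j _; rewrite -ltNye (lt_le_trans _ (u0 j)).
apply/lee_addgt0Pr => e e0.
rewrite (le_trans _ (epsilon_trick _ u0 (ltW e0)))//.
have G k : exists g, [/\ measurable_fun [set: R] g, forall x, f k x <= g x &
    \int[mu]_x g x <= upper_integral (f k) + (e / (2 ^ k.+1)%:R)%:E].
  apply: upper_integral_adherent => //.
    by apply/eqP => koo; apply: noo; exists k.
  by rewrite divr_gt0// ltr0n expn_gt0.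
have [g gP] := choice G.
have g0 k x : 0 <= g k x by have [_ fg _] := gP k; exact: le_trans (f0 k x) (fg x).
apply: (@le_trans _ _ (\int[mu]_x \sum_(k <oo) g k x)).
  apply: upper_integral_le => [|x]; last by apply: lee_nneseries => // k _; have [] := gP k.
  apply: (ge0_emeasurable_sum) => // k _; have [] := gP k => //.
rewrite integral_nneseries//; last by move=> k; have [] := gP k.
by apply: lee_nneseries => [k *|k *]; [apply: integral_ge0 => x _; exact: g0|have [] := gP k].
Qed.

(** Iterated exactly as [integral_Rn]. Monotonicity, countable subadditivity and the ellipsoid bound
    pass through the iteration one variable at a time, so Tonelli's theorem never enters. *)
Fixpoint upper_integral_Rn (n : nat) : ('cV[R]_n -> \bar R) -> \bar R :=
  match n with
  | 0 => fun f => f 0%R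
  | m.+1 => fun f => upper_integral (fun t =>
      upper_integral_Rn (fun x : 'cV[R]_m => f (col_mx (t%:M : 'M[R]_1) x)))
  end.

Lemma upper_integral_Rn_ge0 n (f : 'cV[R]_n -> \bar R) :
  (forall x, 0 <= f x) -> 0 <= upper_integral_Rn f.
Proof.
elim: n f => [|n IH] f f0 //=; apply: upper_integral_ge0 => t.
by apply: IH => x; exact: f0.
Qed.

Lemma le_upper_integral_Rn n (f g : 'cV[R]_n -> \bar R) :
  (forall x, f x <= g x) -> upper_integral_Rn f <= upper_integral_Rn g.
Proof.
elim: n f g => [|n IH] f g fg //=; apply: le_upper_integral => t.
by apply: IH => x; exact: fg.
Qed.

Lemma integral_Rn_ge0 n (f : 'cV[R]_n -> \bar R) :
  (forall x, 0 <= f x) -> 0 <= integral_Rn f.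
Proof.
elim: n f => [|n IH] f f0 //=; apply: integral_ge0 => t _.
by apply: IH => x; exact: f0.
Qed.

Lemma le_integral_Rn n (f g : 'cV[R]_n -> \bar R) :
  (forall x, 0 <= f x) -> (forall x, f x <= g x) -> integral_Rn f <= integral_Rn g.
Proof.
elim: n f g => [|n IH] f g f0 fg //=; apply: le_integral_nonmeasurable => t.
  by apply: integral_Rn_ge0 => x; exact: f0.
by apply: IH => x; [exact: f0|exact: fg].
Qed.

Lemma integral_Rn_le_upper n (f : 'cV[R]_n -> \bar R) :
  (forall x, 0 <= f x) -> integral_Rn f <= upper_integral_Rn f.
Proof.
elim: n f => [|n IH] f f0 //=.
have I0 t : 0 <= integral_Rn (fun x : 'cV[R]_n => f (col_mx t%:M x)) by exact: integral_Rn_ge0.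
apply: le_trans (integral_le_upper_integral I0) _.
by apply: le_upper_integral => t; apply: IH => x; exact: f0.
Qed.

Lemma upper_integral_Rn_nneseries n (f : nat -> 'cV[R]_n -> \bar R) :
  (forall k x, 0 <= f k x) ->
  upper_integral_Rn (fun x => \sum_(k <oo) f k x) <= \sum_(k <oo) upper_integral_Rn (f k).
Proof.
elim: n f => [|n IH] f f0 //=.
apply: le_trans; last by apply: upper_integral_nneseries => k t; exact: upper_integral_Rn_ge0.
by apply: le_upper_integral => t; apply: IH.
Qed.

End UpperIntegral.

(** * An outer measure built from dyadic cells *)

Section DyadicMeasure.
Context {R : realType} {n : nat} (b : 'cV[R]_n).
Local Notation X := 'cV[R]_n.

(** The grid of mesh [2 ^- q] is anchored at [b] so that a suitable choice of [b] puts a given small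
    ball inside a single unit cell. *)
Definition dyadic_code (q : nat) (x : X) : 'I_n -> int :=
  fun a => Num.floor (2 ^+ q * (x a 0 - b a 0)).

Definition dyadic_cell q x : set X := [set y | dyadic_code q y = dyadic_code q x].

(** For an integer [j], the condition [j <= z / k] means [j * k <= z], which depends on the floor of
    [z] only. With [k] a power of 2, this makes the dyadic cells nested. *)
Lemma floor_divn (z w : R) (k : nat) : (0 < k)%N -> Num.floor z = Num.floor w ->
  Num.floor (z / k%:R) = Num.floor (w / k%:R).
Proof.
move=> k0 zw; have k0R : 0 < k%:R :> R by rewrite ltr0n.
set j := Num.floor (z / k%:R).
suff /floor_def -> : j%:~R <= w / k%:R < (j + 1)%:~R by [].
have kE : k%:R = (k%:Z)%:~R :> R by [].
rewrite ler_pdivlMr// ltr_pdivrMr// kE -!rmorphM/= -floor_ge_int_tmp -floor_lt_int -zw.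
rewrite floor_ge_int_tmp floor_lt_int !rmorphM/= -kE -ler_pdivlMr// -ltr_pdivrMr//.
exact: floor_itv.
Qed.

Lemma dyadic_cell_refl q x : dyadic_cell q x x. Proof. by []. Qed.

Lemma dyadic_cell_mono p q x : (p <= q)%N -> dyadic_cell q x `<=` dyadic_cell p x.
Proof.
move=> pq y qxy; apply/funext => a.
have E (u : X) : 2 ^+ p * (u a 0 - b a 0) = 2 ^+ q * (u a 0 - b a 0) / ((2 ^ (q - p))%N%:R : R).
  have -> : 2 ^+ q = 2 ^+ p * 2 ^+ (q - p) :> R by rewrite -exprD subnKC.
  have : 2 ^+ (q - p) != 0 :> R by rewrite expf_neq0// pnatr_eq0.
  by rewrite natrX => ?; field.
rewrite /dyadic_code !E; apply: floor_divn; first by rewrite expn_gt0.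
exact: (congr1 (@^~ a) qxy).
Qed.

Lemma dyadic_cell_eq q x y : dyadic_cell q x y -> dyadic_cell q x = dyadic_cell q y.
Proof. by rewrite /dyadic_cell /= => ->. Qed.

Lemma dyadic_cell_diam q x y z : dyadic_cell q x y -> dyadic_cell q x z ->
  `|y - z| <= (2 ^+ q)^-1.
Proof.
move=> xy xz; apply: mx_norm_le => [|i j]; first by rewrite invr_ge0 exprn_ge0.
rewrite !mxE (ord1 j).
have E : Num.floor (2 ^+ q * (y i 0 - b i 0)) = Num.floor (2 ^+ q * (z i 0 - b i 0)).
  by have := congr1 (@^~ i) (etrans xy (esym xz)).
have q0 : 0 < 2 ^+ q :> R by rewrite exprn_gt0.
rewrite -(ler_pM2l q0) divff ?gt_eqF// -{1}(gtr0_norm q0) -normrM.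
have -> : 2 ^+ q * (y i 0 - z i 0) = 2 ^+ q * (y i 0 - b i 0) - 2 ^+ q * (z i 0 - b i 0) by ring.
set u := 2 ^+ q * (y i 0 - b i 0) in E *; set v := 2 ^+ q * (z i 0 - b i 0) in E *.
have [u1 u2] := andP (floor_itv u); have [v1 v2] := andP (floor_itv v).
rewrite -E in v1 v2; move: u2 v2; rewrite !intrD1 => u2 v2.
by rewrite ler_norml; apply/andP; split; lra.
Qed.

Definition all_measurable_type : Type := X.
HB.instance Definition _ := Pointed.on all_measurable_type.
HB.instance Definition _ := @isMeasurable.Build default_measure_display
  all_measurable_type discrete_measurable discrete_measurable0
  discrete_measurableC discrete_measurableU.

Local Open Scope ereal_scope.

(** The infimum of the volumes [2 ^- (q n)] of cells of level [q >= p] containing [S], equal to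
    [+oo] if there is none. The empty set is set apart: for [n = 0] its infimum would be 1. *)
Definition dyadic_gauge (p : nat) (S : set X) : \bar R :=
  if `[< S = set0 >] then 0 else
  ereal_inf [set (((2 ^+ q) ^+ n)^-1)%:E | q in
    [set q | (p <= q)%N /\ exists x, S `<=` dyadic_cell q x]].

Lemma dyadic_gauge0 p : dyadic_gauge p set0 = 0.
Proof. by rewrite /dyadic_gauge; case: asboolP. Qed.

Lemma dyadic_gauge_ge0 p S : 0 <= dyadic_gauge p S.
Proof.
rewrite /dyadic_gauge; case: asboolP => // _; apply: le_ereal_inf_tmp => _ [q _ <-].
by rewrite lee_fin invr_ge0 !exprn_ge0.
Qed.

Lemma dyadic_gauge_le p q S x : (p <= q)%N -> S `<=` dyadic_cell q x ->
  dyadic_gauge p S <= (((2 ^+ q) ^+ n)^-1)%:E.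
Proof.
move=> pq Sx; rewrite /dyadic_gauge; case: asboolP => _.
  by rewrite lee_fin invr_ge0 !exprn_ge0.
by apply: ereal_inf_lbound; exists q => //; split => //; exists x.
Qed.

Lemma dyadic_gauge_homo p q S : (p <= q)%N -> dyadic_gauge p S <= dyadic_gauge q S.
Proof.
move=> pq; rewrite /dyadic_gauge; case: asboolP => // _.
apply: ereal_inf_le_tmp => _ [r [qr [x Sx]] <-]; exists r => //; split; last by exists x.
exact: leq_trans qr.
Qed.

Definition dyadic_outer p (S : set X) : \bar R :=
  mu_ext (dyadic_gauge p : set all_measurable_type -> \bar R) S.

Lemma dyadic_outer_ge0 p S : 0 <= dyadic_outer p S.
Proof. exact/mu_ext_ge0/dyadic_gauge_ge0. Qed.

Lemma dyadic_outer_le p S (A : nat -> set X) : S `<=` \bigcup_k A k ->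
  dyadic_outer p S <= \sum_(k <oo) dyadic_gauge p (A k).
Proof. by move=> SA; apply: ereal_inf_lbound; exists A. Qed.

Lemma le_dyadic_outer p S T : S `<=` T -> dyadic_outer p S <= dyadic_outer p T.
Proof. by move=> ST; exact: (@le_mu_ext _ all_measurable_type _ _ _ _ ST). Qed.

Lemma dyadic_outer_homo S : {homo dyadic_outer ^~ S : p q / (p <= q)%N >-> p <= q}.
Proof.
move=> p q pq; apply: le_ereal_inf_tmp => _ [A [_ SA] <-].
apply: le_trans (dyadic_outer_le p SA) _; apply: lee_nneseries => k *.
  exact: dyadic_gauge_ge0.
exact: dyadic_gauge_homo.
Qed.

(** This is Munroe's second method, the limit of small mesh. At a fixed level [p] the splitting
    property is available for unions of cells of level at most [p]; the limit extends it to all open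
    sets. *)
Definition dyadic_measure (S : set X) : \bar R := ereal_sup (range (dyadic_outer ^~ S)).

Lemma dyadic_outer_le_measure p S : dyadic_outer p S <= dyadic_measure S.
Proof. by apply: ereal_sup_ubound; exists p. Qed.

Lemma dyadic_measure0 : dyadic_measure set0 = 0.
Proof.
apply/eqP; rewrite eq_le; apply/andP; split; last first.
  exact: le_trans (dyadic_outer_ge0 0 _) (dyadic_outer_le_measure _ _).
apply: ge_ereal_sup => _ [p _ <-].
by rewrite /dyadic_outer mu_ext0//; [exact: dyadic_gauge0|exact: dyadic_gauge_ge0].
Qed.

Lemma dyadic_measure_ge0 S : 0 <= dyadic_measure S.
Proof. exact: le_trans (dyadic_outer_ge0 0 _) (dyadic_outer_le_measure _ _). Qed.

Lemma le_dyadic_measure : {homo dyadic_measure : S T / S `<=` T >-> S <= T}.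
Proof.
move=> S T ST; apply: ge_ereal_sup => _ [p _ <-].
exact: le_trans (le_dyadic_outer p ST) (dyadic_outer_le_measure _ _).
Qed.

Lemma dyadic_measure_sigma_subadditive : sigma_subadditive dyadic_measure.
Proof.
move=> A; apply: ge_ereal_sup => _ [p _ <-].
apply: le_trans (@mu_ext_sigma_subadditive _ all_measurable_type _ _ (dyadic_gauge_ge0 p) A) _.
apply: lee_nneseries => k *; first exact/mu_ext_ge0/dyadic_gauge_ge0.
exact: dyadic_outer_le_measure.
Qed.

HB.instance Definition _ := isOuterMeasure.Build R X dyadic_measure
  dyadic_measure0 dyadic_measure_ge0 le_dyadic_measure dyadic_measure_sigma_subadditive.

Definition dyadic_saturated q (S : set X) := forall x, S x -> dyadic_cell q x `<=` S.

(** A cell of level at least [q] is either inside [S] or disjoint from it. So one of the two parts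
    of [T] is empty, unless no such cell contains [T], in which case the right-hand side is
    infinite. *)
Lemma dyadic_gauge_split p q S T : (q <= p)%N -> dyadic_saturated q S ->
  dyadic_gauge p (T `&` S) + dyadic_gauge p (T `&` ~` S) <= dyadic_gauge p T.
Proof.
move=> qp sS; rewrite [leRHS]/dyadic_gauge; case: asboolP => [->|T0].
  by rewrite !set0I dyadic_gauge0 adde0.
apply: le_ereal_inf_tmp => _ [r [pr [x Tx]] <-].
have Tq : T `<=` dyadic_cell q x.
  by apply: subset_trans Tx _; apply: dyadic_cell_mono; exact: leq_trans pr.
have [Sx|nSx] := pselect (S x).
  have -> : T `&` S = T by apply/setIidl; exact: subset_trans Tq (sS _ Sx).
  have -> : T `&` ~` S = set0.
    by apply/disjoints_subset; rewrite setCK; exact: subset_trans Tq (sS _ Sx).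
  by rewrite dyadic_gauge0 adde0; exact: dyadic_gauge_le Tx.
have TS : T `&` S = set0.
  apply/disjoints_subset => y /Tq xy Sy; apply: nSx; apply: (sS _ Sy).
  by rewrite -(dyadic_cell_eq xy).
rewrite TS dyadic_gauge0 add0e; apply: (dyadic_gauge_le pr (x := x)).
by move=> y [/Tx].
Qed.

Lemma dyadic_outer_split p q S T : (q <= p)%N -> dyadic_saturated q S ->
  dyadic_outer p (T `&` S) + dyadic_outer p (T `&` ~` S) <= dyadic_outer p T.
Proof.
move=> qp sS; apply: le_ereal_inf_tmp => _ [A [_ TA] <-].
apply: (@le_trans _ _ (\sum_(k <oo) (dyadic_gauge p (A k `&` S) + dyadic_gauge p (A k `&` ~` S)))).
  rewrite nneseriesD; [|by move=> *; exact: dyadic_gauge_ge0..].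
  apply: leeD; apply: dyadic_outer_le => x [/TA[k _ Akx] Sx]; by exists k.
apply: lee_nneseries => k *; last exact: (@dyadic_gauge_split p q S (A k)).
by apply: adde_ge0; exact: dyadic_gauge_ge0.
Qed.

(** The splitting inequality holds at each level [p >= q] and survives the increasing limit in
    [p]. *)
Lemma dyadic_saturated_caratheodory q S : dyadic_saturated q S ->
  dyadic_measure.-caratheodory S.
Proof.
move=> sS; apply: le_caratheodory_measurable => T /=.
have cv (Y : set X) : dyadic_outer p Y @[p --> \oo] --> dyadic_measure Y.
  by apply: ereal_nondecreasing_cvgn => p r pr; exact: dyadic_outer_homo.
have cvD : dyadic_outer p (T `&` S) + dyadic_outer p (T `&` ~` S) @[p --> \oo] -->
    dyadic_measure (T `&` S) + dyadic_measure (T `&` ~` S).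
  by apply: cvgeD => //; apply: ge0_adde_def; rewrite inE dyadic_measure_ge0.
rewrite -(cvg_lim _ cvD)//; apply: lime_le; first by apply/cvg_ex; eexists; exact: cvD.
exists q => // p /= qp.
exact: le_trans (dyadic_outer_split T qp sS) (dyadic_outer_le_measure _ _).
Qed.

Lemma dyadic_cell_small (x : X) (d : R) : (0 < d)%R ->
  exists q, forall y, dyadic_cell q x y -> (`|x - y| < d)%R.
Proof.
move=> d0; have [q qd] : exists q, ((2 ^+ q)^-1 < d :> R)%R.
  exists (Num.truncn d^-1).+1; rewrite -[ltRHS]invrK ltf_pV2 ?posrE ?invr_gt0 ?exprn_gt0//.
  apply: (@lt_le_trans _ _ (Num.truncn d^-1).+1%:R); first exact: truncnS_gt.
  by rewrite -natrX ler_nat ltnW// ltn_expl.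
exists q => y qxy; apply: le_lt_trans qd; exact: (dyadic_cell_diam (dyadic_cell_refl q x)).
Qed.

(** An open set is the union over [q] of the sets of points whose cell of level [q] stays inside it,
    and each of these is a union of cells. *)
Lemma open_caratheodory S : open S -> dyadic_measure.-caratheodory S.
Proof.
move=> oS; pose Sq q := [set x | dyadic_cell q x `<=` S].
have -> : S = \bigcup_q Sq q.
  apply/seteqP; split=> [x Sx|x [q _ qS]]; last exact: qS.
  have : \forall y \near x, S y by apply: open_nbhs_nbhs.
  move=> /nbhs_ballP[d /= d0 dS]; have [q qd] := dyadic_cell_small x d0.
  by exists q => // y /qd xy; apply: dS; rewrite -ball_normE.
apply: caratheodory_measurable_bigcup => q.
apply: (@dyadic_saturated_caratheodory q) => x xS y xy z.
by rewrite /= -(dyadic_cell_eq xy); exact: xS.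
Qed.

Lemma nneseries_finite (f : nat -> \bar R) N : (forall k, 0 <= f k) ->
  (forall k, (N <= k)%N -> f k = 0) -> \sum_(k <oo) f k = \sum_(k < N) f k.
Proof.
move=> f0 fN; rewrite (nneseries_split 0 N)// add0n eseries0 ?adde0 ?big_mkord//.
by move=> i Ni _; exact: fN.
Qed.

(** At each level [p] the unit cell is covered by [2 ^ (p n)] cells of volume [2 ^- (p n)]. *)
Lemma dyadic_measure_unit_cell x : dyadic_measure (dyadic_cell 0 x) <= 1.
Proof.
apply: ge_ereal_sup => _ [p _ <-].
pose T := {ffun 'I_n -> 'I_(2 ^ p)}.
(* The label [f] records, in each coordinate, the offset of the code of level [p] from the first
   subcell of the unit cell. *)
pose B (f : T) := [set y | dyadic_cell 0 x y /\
  dyadic_code p y = fun a => (2 ^+ p * dyadic_code 0 x a + (f a)%:Z)%R].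
pose A k : set X := if insub k is Some i then B (enum_val (i : 'I_#|T|)) else set0.
have cA : dyadic_cell 0 x `<=` \bigcup_k A k.
  move=> y xy.
  have F a : exists j : 'I_(2 ^ p), dyadic_code p y a = (2 ^+ p * dyadic_code 0 x a + j%:Z)%R.
    have E : dyadic_code 0 x a = dyadic_code 0 y a by rewrite (congr1 (@^~ a) xy).
    rewrite E; have [] := andP (floor_itv (2 ^+ 0 * (y a 0 - b a 0))%R).
    rewrite -/(dyadic_code 0 y a) expr0 mul1r; set m := dyadic_code 0 y a => m1 m2.
    have p0 : (0 < 2 ^+ p :> R)%R by rewrite exprn_gt0.
    have c1 : (2 ^+ p * m <= dyadic_code p y a)%R.
      by rewrite floor_ge_int_tmp rmorphM rmorphXn/= ler_pM2l.
    have c2 : (dyadic_code p y a < 2 ^+ p * (m + 1))%R.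
      by rewrite floor_lt_int rmorphM rmorphXn/= ltr_pM2l.
    move: c1 c2; rewrite mulrDr mulr1 -subr_ge0 -ltrBlDl.
    case: (dyadic_code p y a - 2 ^+ p * m)%R (subrK (2 ^+ p * m)%R (dyadic_code p y a)) => // j jE _ jp.
    have jp' : (j < 2 ^ p)%N by move: jp; rewrite -natrX natz ltz_nat.
    by exists (Ordinal jp'); rewrite -jE addrC.
  have [f fE] := choice F.
  pose g : T := [ffun a => f a].
  exists (enum_rank g) => //; rewrite /A valK enum_rankK; split => //.
  by apply/funext => a; rewrite fE ffunE.
apply: le_trans (dyadic_outer_le p cA) _.
rewrite (@nneseries_finite _ #|T|); last 2 first.
- by move=> k; exact: dyadic_gauge_ge0.
- by move=> k Tk; rewrite /A insubF ?dyadic_gauge0// ltnNge Tk.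
apply: (@le_trans _ _ (\sum_(k < #|T|) (((2 ^+ p) ^+ n)^-1)%:E)).
  apply: lee_sum => k _; rewrite /A valK.
  have [->|/set0P[y By]] := eqVneq (B (enum_val k)) set0.
    by rewrite dyadic_gauge0 lee_fin invr_ge0 !exprn_ge0.
  apply: (@dyadic_gauge_le _ p _ y) => // z Bz.
  by rewrite /dyadic_cell/= Bz.2 By.2.
rewrite sumEFin lee_fin sumr_const cardT -cardE card_ffun !card_ord.
rewrite -[X in (X <= _)%R]mulr_natl !natrX mulfV// !expf_neq0// pnatr_eq0.
Qed.

Variable (nu : set X -> \bar R).
Hypotheses (nu0 : nu set0 = 0) (nu_ge0 : forall S, 0 <= nu S)
  (nu_sub : forall A : nat -> set X, nu (\bigcup_k A k) <= \sum_(k <oo) nu (A k)).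

(* A countably subadditive set function which is locally bounded by the n-th
   power of the diameter is dominated by the dyadic measure: [G p] collects the
   points whose cell of level [p] only contains well-behaved subsets. *)
Lemma le_dyadic_measure_local (D : set X) :
  (forall x, D x -> exists2 d : R, (0 < d)%R & forall S e, S `<=` D ->
     S `<=` ball x d -> (0 <= e)%R -> (forall y z, S y -> S z -> (`|y - z| <= e)%R) ->
     nu S <= (e ^+ n)%:E) ->
  forall S, S `<=` D -> nu S <= dyadic_measure S.
Proof.
move=> locD S SD.
pose G p := [set x | forall S e, S `<=` D -> S `<=` dyadic_cell p x -> (0 <= e)%R ->
  (forall y z, S y -> S z -> (`|y - z| <= e)%R) -> nu S <= (e ^+ n)%:E].
have satG p : dyadic_saturated p (G p).
  by move=> x Gx y xy T e; rewrite -(dyadic_cell_eq xy); exact: Gx.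
have DG : D `<=` \bigcup_p G p.
  move=> x /locD[d d0 dP]; have [q qd] := dyadic_cell_small x d0.
  exists q => // T e TD Tq; apply: dP => // y /Tq /qd xy.
  by rewrite -ball_normE.
(* A covering set [A k] inside a cell of level [q >= p] meets [T] in a set of diameter at most
   [2 ^- q], to which the definition of [G p] applies; its [nu] is thus at most the gauge of
   [A k]. *)
have nuG p T : T `<=` D -> T `<=` G p -> nu T <= dyadic_outer p T.
  move=> TD TG; apply: le_ereal_inf_tmp => _ [A [_ TA] <-].
  have -> : T = \bigcup_k (T `&` A k) by rewrite -setI_bigcupr; apply/esym/setIidl.
  apply: le_trans (nu_sub _) _; apply: lee_nneseries => k * //.
  rewrite /dyadic_gauge; case: asboolP => [->|_]; first by rewrite setI0 nu0.
  apply: le_ereal_inf_tmp => _ [q [pq [x Akx]] <-].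
  have [->|/set0P[y [Ty Aky]]] := eqVneq (T `&` A k) set0.
    by rewrite nu0 lee_fin invr_ge0 !exprn_ge0.
  rewrite -exprVn; apply: (TG _ Ty).
  - by move=> z [/TD].
  - have pxy := dyadic_cell_mono pq (Akx _ Aky).
    by rewrite -(dyadic_cell_eq pxy) => z [_ /Akx]; exact: dyadic_cell_mono.
  - by rewrite invr_ge0 exprn_ge0.
  - by move=> z w [_ /Akx zx] [_ /Akx wx]; exact: dyadic_cell_diam zx wx.
have monoG : {homo G : p q / (p <= q)%N >-> p `<=` q}.
  move=> p q pq x Gx T e TD Tq; apply: Gx => //.
  by apply: subset_trans Tq _; exact: dyadic_cell_mono.
(* The successive differences of the increasing sets [G p] are disjoint and Caratheodory measurable,
   so the dyadic measures of the parts of [S] add up to at most that of [S]. *)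
pose H := seqD G.
have HE : \bigcup_p H p = \bigcup_p G p by rewrite /H eq_bigcup_seqD.
have tH : trivIset setT H by apply: trivIset_seqD => p q pq; apply/subsetPset; exact: monoG.
have mH p : dyadic_measure.-caratheodory (H p).
  case: p => [|p]; first exact: dyadic_saturated_caratheodory (satG 0%N).
  by apply: caratheodory_measurable_setD; exact: dyadic_saturated_caratheodory.
have HG p : H p `<=` G p by case: p => [|p] // x [].
have SE : S = \bigcup_p (S `&` H p).
  by rewrite -setI_bigcupr HE; apply/esym/setIidl; exact: subset_trans DG.
rewrite [in leLHS]SE; apply: le_trans (nu_sub _) _.
apply: (@le_trans _ _ (\sum_(p <oo) dyadic_measure (S `&` H p))).
  apply: lee_nneseries => p * //.
  apply: le_trans (dyadic_outer_le_measure p _); apply: nuG => x [Sx Hx]; first exact: SD.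
  exact: HG.
apply: le_trans (caratheodory_lime_le mH tH S).
by rewrite leeDl// dyadic_measure_ge0.
Qed.

End DyadicMeasure.

(** * Schur complements of positive definite matrices *)

Section PositiveDefinite.
Context {R : realType}.

Lemma dotC {n} (u v : 'cV[R]_n) : dot u v = dot v u.
Proof. by apply: eq_bigr => k _; rewrite mulrC. Qed.

Lemma dotE {n} (u v : 'cV[R]_n) : dot u v = (u^T *m v) 0 0.
Proof. by rewrite mxE; apply: eq_bigr => k _; rewrite mxE. Qed.

Lemma dotDl {n} (u v w : 'cV[R]_n) : dot (u + v) w = dot u w + dot v w.
Proof. by rewrite -big_split; apply: eq_bigr => k _; rewrite mxE mulrDl. Qed.

Lemma dotZl {n} a (u w : 'cV[R]_n) : dot (a *: u) w = a * dot u w.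
Proof. by rewrite mulr_sumr; apply: eq_bigr => k _; rewrite mxE mulrA. Qed.

Lemma dotDr {n} (u v w : 'cV[R]_n) : dot w (u + v) = dot w u + dot w v.
Proof. by rewrite dotC dotDl !(dotC w). Qed.

Lemma dotZr {n} a (u w : 'cV[R]_n) : dot w (a *: u) = a * dot w u.
Proof. by rewrite dotC dotZl (dotC w). Qed.

Lemma dotBl {n} (u v w : 'cV[R]_n) : dot (u - v) w = dot u w - dot v w.
Proof. by rewrite dotDl -scaleN1r dotZl mulN1r. Qed.

Lemma dotBr {n} (u v w : 'cV[R]_n) : dot w (u - v) = dot w u - dot w v.
Proof. by rewrite dotC dotBl !(dotC w). Qed.

Lemma dot_mulmx {n m} (u : 'cV[R]_n) (A : 'M[R]_(n, m)) (v : 'cV[R]_m) :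
  dot u (A *m v) = dot (A^T *m u) v.
Proof. by rewrite !dotE trmx_mul trmxK mulmxA. Qed.

Lemma dot_col_mx {n m} (a c : 'cV[R]_n) (b d : 'cV[R]_m) :
  dot (col_mx a b) (col_mx c d) = dot a c + dot b d.
Proof.
rewrite /dot big_split_ord; congr (_ + _); apply: eq_bigr => k _.
  by rewrite !col_mxEu.
by rewrite !col_mxEd.
Qed.

Definition posdef {n} (g : 'M[R]_n) : Prop :=
  g^T = g /\ forall u : 'cV[R]_n, u != 0 -> 0 < dot u (g *m u).

Lemma posdef_ge0 {n} (g : 'M[R]_n) u : posdef g -> 0 <= dot u (g *m u).
Proof.
move=> [_ g0]; have [->|/g0/ltW//] := eqVneq u 0.
by rewrite mulmx0 dotE mulmx0 mxE.
Qed.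

(** For [g] with corner [a], column [b] and remaining block [D], this is [D^-1 b], and
    [schur_scalar] is the Schur complement [a - b^T D^-1 b]: the shift and the coefficient that
    appear on completing the square. *)
Definition schur_vec {m} (g : 'M[R]_(1 + m)) : 'cV[R]_m :=
  invmx (drsubmx g) *m dlsubmx g.

Definition schur_scalar {m} (g : 'M[R]_(1 + m)) : R :=
  g 0 0 - dot (dlsubmx g : 'cV[R]_m) (schur_vec g).

Lemma posdef_drsubmx {m} (g : 'M[R]_(1 + m)) : posdef g -> posdef (drsubmx g).
Proof.
move=> [gT g0]; split=> [|u u0]; first by rewrite trmx_drsub gT.
have /g0 : col_mx (0 : 'cV[R]_1) u != 0.
  by apply: contra_neq u0 => E; rewrite -(col_mxKd (0 : 'cV[R]_1) u) E linear0.
rewrite -{1}(submxK g) mul_block_col !mulmx0 !add0r dot_col_mx.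
by rewrite dotE trmx0 mul0mx mxE add0r.
Qed.

Lemma block_schur {m} (g : 'M[R]_(1 + m)) : g^T = g -> drsubmx g \in unitmx ->
  g = block_mx 1%:M (schur_vec g)^T 0 1%:M *m
      block_mx (schur_scalar g)%:M 0 (dlsubmx g) (drsubmx g).
Proof.
move=> gT ug; rewrite mulmx_block !mul1mx !mul0mx !add0r.
have dT : (drsubmx g)^T = drsubmx g by rewrite trmx_drsub gT.
have bT : (dlsubmx g)^T = ursubmx g by rewrite trmx_dlsub gT.
have E : (schur_vec g)^T *m drsubmx g = ursubmx g.
  by rewrite /schur_vec trmx_mul trmx_inv dT bT mulmxKV.
rewrite E -[LHS]submxK; congr block_mx.
apply/matrixP => i j; rewrite !(ord1 i, ord1 j) !mxE eqxx mulr1n /schur_scalar.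
rewrite dotC dotE mxE (_ : lshift _ 0 = 0) ?subrK//; exact: val_inj.
Qed.

(** Completion of the square in the last [m] variables, read off from [block_schur]. It puts each
    slice of an ellipsoid inside an ellipsoid for [drsubmx g] with a shifted centre, which drives
    the induction for the volume. *)
Lemma schur_quad {m} (g : 'M[R]_(1 + m)) (t : R) (y : 'cV[R]_m) :
  g^T = g -> drsubmx g \in unitmx ->
  dot (col_mx t%:M y) (g *m col_mx t%:M y) = schur_scalar g * t ^+ 2 +
    dot (y + t *: schur_vec g) (drsubmx g *m (y + t *: schur_vec g)).
Proof.
move=> gT ug; have E := block_schur gT ug.
have dT : (drsubmx g)^T = drsubmx g by rewrite trmx_drsub gT.
have dv : drsubmx g *m schur_vec g = dlsubmx g by rewrite /schur_vec mulmxA mulmxV// mul1mx.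
rewrite {1}E -mulmxA dot_mulmx tr_block_mx mul_block_col mul_block_col !trmx1 !trmx0 trmxK.
rewrite !mul1mx !mul0mx !addr0 dot_col_mx; congr (_ + _).
  rewrite -scalar_mxM dotE tr_scalar_mx -scalar_mxM mxE eqxx mulr1n; ring.
have tv : schur_vec g *m (t%:M : 'M[R]_1) = t *: schur_vec g by rewrite mul_mx_scalar.
rewrite tv; congr (dot _ _); first by rewrite addrC.
by rewrite mulmxDr -scalemxAr dv -mul_mx_scalar addrC.
Qed.

Lemma schur_det {m} (g : 'M[R]_(1 + m)) : g^T = g -> drsubmx g \in unitmx ->
  \det g = schur_scalar g * \det (drsubmx g).
Proof.
move=> gT ug; rewrite {1}(block_schur gT ug) det_mulmx det_ublock det_lblock !det1.
by rewrite !mul1r det_scalar1.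
Qed.

(** The Schur complement is the value of the quadratic form at [(1, - schur_vec g)], where the
    completed square vanishes. *)
Lemma schur_scalar_gt0 {m} (g : 'M[R]_(1 + m)) : posdef g -> drsubmx g \in unitmx ->
  0 < schur_scalar g.
Proof.
move=> pg ud; have /pg.2 : col_mx (1%:M : 'M[R]_1) (- schur_vec g) != 0.
  apply/eqP => /(congr1 usubmx); rewrite col_mxKu linear0 => /matrixP/(_ 0 0).
  by rewrite !mxE => /eqP; rewrite oner_eq0.
by rewrite (schur_quad 1 _ pg.1 ud) scale1r addNr expr1n mulr1 mulmx0 dotE mulmx0 mxE addr0.
Qed.

Lemma posdef_det {n} (g : 'M[R]_n) : posdef g -> 0 < \det g.
Proof.
elim: n g => [g _|n IH g pg]; first by rewrite det_mx00.
have pd := posdef_drsubmx (pg : posdef (g : 'M[R]_(1 + n))).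
have d0 := IH _ pd; have ud : drsubmx (g : 'M[R]_(1 + n)) \in unitmx.
  by rewrite unitmxE unitfE gt_eqF.
by rewrite (schur_det pg.1 ud) mulr_gt0// schur_scalar_gt0.
Qed.

Lemma posdef_unit {n} (g : 'M[R]_n) : posdef g -> g \in unitmx.
Proof. by move=> /posdef_det g0; rewrite unitmxE unitfE gt_eqF. Qed.

End PositiveDefinite.

Section EllipsoidVolume.
Context {R : realType}.
Local Open Scope ereal_scope.

Lemma upper_integral_segment (v r K : R) : (0 <= r)%R -> (0 <= K)%R ->
  upper_integral (fun t => if (`|t - v| <= r)%R then K%:E else 0) <= (K * (2 * r))%:E.
Proof.
move=> r0 K0; pose I := `[(v - r)%R, (v + r)%R]%classic : set R.
have mI : measurable I by exact: measurable_itv.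
have mf : measurable_fun [set: R] (fun t => (K * \1_I t)%:E).
  by apply/measurable_EFinP; exact: measurable_funM.
apply: le_trans (upper_integral_le mf _) _.
  move=> t /=; case: ifPn => [tr|_]; last by rewrite lee_fin mulr_ge0.
  by rewrite indicE mem_set ?mulr1// /I /= in_itv/= -ler_distlC distrC.
under eq_integral do rewrite EFinM.
rewrite ge0_integralZl_EFin//; last exact/measurable_EFinP.
have muI := lebesgue_measure_itv (`[(v - r)%R, (v + r)%R]).
rewrite integral_indic// setIT [X in _ * X](muI : lebesgue_measure I = _) /= lte_fin.
case: ifP => [_|_]; last by rewrite mule0 lee_fin !mulr_ge0.
by rewrite -EFinB -EFinM lee_fin ler_wpM2l//; lra.
Qed.

(** Slicing along the first coordinate: a slice is nonempty only if [|t - v0| <= r / sqrt s], it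
    then lies in an ellipsoid of the same [r] for the remaining block [d], and [det g = s * det d].
    Keeping [r] instead of the smaller radius of the slice gives the crude constant [(2 r) ^ n]. *)
Lemma upper_integral_ellipsoid n (g : 'M[R]_n) (v : 'cV[R]_n) (r c : R) :
  posdef g -> (0 <= r)%R -> (0 <= c)%R ->
  upper_integral_Rn (fun x => if (dot (x - v) (g *m (x - v)) <= r ^+ 2)%R then c%:E else 0)
    <= (c * (2 * r) ^+ n / Num.sqrt (\det g))%:E.
Proof.
elim: n g v c => [|n IH] g v c pg r0 c0.
  rewrite /= det_mx00 sqrtr1 divr1 expr0 mulr1; case: ifP => // _.
have pd := posdef_drsubmx (pg : posdef (g : 'M[R]_(1 + n))).
have ud := posdef_unit pd; have d0 := posdef_det pd.
have s0 := schur_scalar_gt0 (pg : posdef (g : 'M[R]_(1 + n))) ud.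
set d := drsubmx (g : 'M[R]_(1 + n)) in pd ud d0.
set s := schur_scalar (g : 'M[R]_(1 + n)) in s0.
pose v0 := (v : 'cV[R]_(1 + n)) 0%R 0%R.
pose v1 := dsubmx (v : 'cV[R]_(1 + n)).
have vE : (v : 'cV[R]_(1 + n)) = col_mx (v0%:M : 'M[R]_1) v1.
  apply: etrans (esym (vsubmxK (v : 'cV[R]_(1 + n)))) _; congr col_mx; apply/matrixP => i j.
  by rewrite !(ord1 i, ord1 j) !mxE eqxx mulr1n /v0; congr (v _ _); exact: val_inj.
(* The height [c], cut to 0 off the segment, lets a single use of the induction hypothesis cover
   both cases. *)
pose ct t := if (`|t - v0| <= r / Num.sqrt s)%R then c else 0%R.
have ct0 t : (0 <= ct t)%R by rewrite /ct; case: ifP.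
pose w := schur_vec (g : 'M[R]_(1 + n)).
pose K := (c * (2 * r) ^+ n / Num.sqrt (\det d))%R.
have K0 : (0 <= K)%R by rewrite /K divr_ge0// mulr_ge0// exprn_ge0// mulr_ge0.
have ss0 : (0 < Num.sqrt s)%R by rewrite sqrtr_gt0.
have slice t : upper_integral_Rn (fun y : 'cV[R]_n =>
    if (dot (col_mx (t%:M : 'M[R]_1) y - v) ((g : 'M[R]_(1 + n)) *m (col_mx (t%:M : 'M[R]_1) y - v)) <= r ^+ 2)%R
    then c%:E else 0) <= if (`|t - v0| <= r / Num.sqrt s)%R then K%:E else 0.
  have -> : (if (`|t - v0| <= r / Num.sqrt s)%R then K%:E else 0) =
      (ct t * (2 * r) ^+ n / Num.sqrt (\det d))%:E.
    by rewrite /ct; case: ifP => // _; rewrite !mul0r.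
  apply: le_trans (IH d (v1 - (t - v0) *: w)%R _ pd r0 (ct0 t)).
  apply: le_upper_integral_Rn => y.
  have -> : (col_mx (t%:M : 'M[R]_1) y - v)%R = col_mx ((t - v0)%:M : 'M[R]_1) (y - v1)%R.
    rewrite vE; apply/matrixP => i j; rewrite !mxE.
    by case: splitP => a _; rewrite !(mxE, ord1) ?eqxx ?mulr1n.
  rewrite (schur_quad _ _ pg.1 ud) -/s -/w -/d.
  rewrite (_ : y - v1 + _ = y - (v1 - (t - v0) *: w))%R; last by rewrite opprB addrA addrAC.
  set z := (y - _)%R; have dz := posdef_ge0 z pd.
  case: ifPn => [le_r|_]; last by case: ifP => // _; rewrite lee_fin.
  have st : (0 <= s * (t - v0) ^+ 2)%R by rewrite mulr_ge0 ?sqr_ge0// ltW.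
  rewrite ifT; last by apply: le_trans le_r; rewrite lerDr.
  rewrite /ct ifT// ler_pdivlMr//.
  rewrite -(@ler_pXn2r _ 2)// ?nnegrE ?mulr_ge0// ?(ltW ss0)//.
  rewrite exprMn sqr_sqrtr ?(ltW s0)// real_normK ?num_real// mulrC.
  by apply: le_trans le_r; rewrite lerDl.
rewrite [leLHS]/=; apply: le_trans (le_upper_integral slice) _.
apply: le_trans (upper_integral_segment _ _ K0) _.
  by rewrite divr_ge0// ltW.
rewrite lee_fin (schur_det (pg.1 : (g : 'M[R]_(1 + n))^T = g) ud) -/s -/d.
rewrite sqrtrM ?(ltW s0)// /K exprS.
have sd : (0 < Num.sqrt (\det d))%R by rewrite sqrtr_gt0.
rewrite le_eqVlt; apply/orP; left; apply/eqP; field.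
by rewrite !gt_eqF.
Qed.

End EllipsoidVolume.

(** * Volume of the image of a small set under a coordinate change *)

Section LocalVolume.
Context {R : realType} {n : nat}.
Local Notation X := 'cV[R]_n.

Lemma near_ball (x : X) (P : set X) : (\forall y \near x, P y) ->
  exists2 d : R, 0 < d & ball x d `<=` P.
Proof. by move=> /nbhs_ballP[d /= d0 dP]; exists d. Qed.

Lemma smooth_derive {d} (D : set 'cV[R]_d) (f : 'cV[R]_d -> R) x v :
  open D -> smooth_on D f -> D x -> is_derive x v f (\sum_k v k 0 * pderiv k f x).
Proof.
move=> oD sf Dx.
have E k : 'D_v (fun y : 'cV[R]_d => y k 0) x = v k 0.
  have H : h^-1 *: ((h *: v + x) k 0 - x k 0) @[h --> (0:R)^'] --> v k 0.
    apply: cvg_near_cst; near=> h.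
    have h0 : h != 0 by near: h; exact: nbhs_dnbhs_neq.
    by rewrite !mxE addrK [_ *: _]mulrA mulVf// mul1r.
  exact: cvg_lim H.
have := @chain_pderiv R d _ f id x v.
under eq_bigr do rewrite E.
apply => [k|k|].
- by apply: filterS (near_open oD Dx) => y Dy; exact: smooth_on_derivable sf Dy.
- exact: smooth_on_continuous (smooth_on_pderiv k sf) Dx.
- exact: derivable_id.
Unshelve. all: by end_near. Qed.

Lemma smooth_dot_derive {d m} (D : set 'cV[R]_d) (phi : 'cV[R]_d -> 'cV[R]_m) (w : 'cV[R]_m) x v :
  open D -> smooth_on D phi -> D x ->
  is_derive x v (fun y => dot w (phi y)) (dot w (jacobian_mx phi x *m v)).
Proof.
move=> oD sp Dx.
have sp' := (smooth_on_mxP oD phi).1 sp.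
have sf : smooth_on D (fun y => dot w (phi y)).
  apply: (smooth_on_sum oD) => a _; apply: (smooth_on_mul oD); last exact: sp'.
  exact: smooth_on_cst.
have -> : dot w (jacobian_mx phi x *m v) = \sum_k v k 0 * pderiv k (fun y => dot w (phi y)) x.
  rewrite /dot; under eq_bigr do rewrite mxE mulr_sumr.
  rewrite exchange_big; apply: eq_bigr => k _ /=.
  have H : is_derive x (delta_mx k 0) (fun y => dot w (phi y))
      (\sum_a w a 0 * pderiv k (fun y => phi y a 0) x).
    rewrite /dot; have -> : (fun y => \sum_a w a 0 * phi y a 0) =
        \sum_a (w a 0 \*: (fun y => phi y a 0)).
      by apply/funext => y; rewrite fct_sumE.
    apply: is_derive_sum => a; apply: is_deriveZ.
    by apply: derivableP; exact: smooth_on_derivable (sp' a 0) Dx.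
  rewrite [X in _ = _ * X](@derive_val _ _ _ _ _ _ _ H) mulr_sumr; apply: eq_bigr => a _.
  rewrite mxE (pderiv_mx _ _ (smooth_on_derivable sp Dx)).
  by ring.
exact: smooth_derive sf Dx.
Qed.

Lemma dot_norm_le {d} (A : 'M[R]_d) (v : 'cV[R]_d) (e : R) :
  (forall i j, `|A i j| <= e) -> dot v (A *m v) <= d%:R ^+ 2 * e * `|v| ^+ 2.
Proof.
move=> Ae; rewrite /dot.
apply: (@le_trans _ _ (\sum_(k < d) \sum_(j < d) `|v| * (e * `|v|))).
  apply: ler_sum => k _; rewrite mxE mulr_sumr; apply: ler_sum => j _.
  apply: le_trans (ler_norm _) _; rewrite !normrM.
  apply: ler_pM; rewrite ?mulr_ge0 ?mx_norm_coord//.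
  by apply: ler_pM; rewrite ?mx_norm_coord.
rewrite !sumr_const card_ord -[X in X *+ _]mulr_natl -[leLHS]mulr_natl.
by rewrite le_eqVlt; apply/orP; left; apply/eqP; ring.
Qed.

(* With [w = phi x - phi y] and [u] the image of [x - y] under the differential
   at an intermediate point, the mean value theorem gives [g(w, w) = g(w, u)],
   hence [g(w, w) <= g(u, u)]. *)
Lemma metric_mean_value {d m} (D : set 'cV[R]_d) (phi : 'cV[R]_d -> 'cV[R]_m)
    (g : 'M[R]_m) (x y : 'cV[R]_d) :
  open D -> smooth_on D phi -> posdef g ->
  (forall t, 0 <= t <= 1 -> D (t *: (x - y) + y)) ->
  exists2 t, 0 <= t <= 1 & let J := jacobian_mx phi (t *: (x - y) + y) in
    dot (phi x - phi y) (g *m (phi x - phi y)) <=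
    dot (x - y) ((J^T *m g *m J) *m (x - y)).
Proof.
move=> oD sp pg seg; pose w := phi x - phi y; pose f z := dot (g *m w) (phi z).
have df t : 0 <= t <= 1 -> is_derive (t *: (x - y) + y) (x - y) f
    (dot (g *m w) (jacobian_mx phi (t *: (x - y) + y) *m (x - y))).
  by move=> t01; apply: smooth_dot_derive sp _ => //; exact: seg.
have [t t01|t t01 E] := @MVT_direction R _ f y (x - y).
  by case: (df t t01).
exists t => //= ; set J := jacobian_mx _ _; pose u := J *m (x - y).
have q1 : dot w (g *m w) = dot (g *m w) u.
  move: E; rewrite (@derive_val _ _ _ _ _ _ _ (df t t01)) subrK -/J -/u => <-.
  by rewrite dotC /f -dotBr.
have q2 : dot u (g *m w) = dot w (g *m w) by rewrite q1 dotC.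
have q3 : dot w (g *m u) = dot w (g *m w) by rewrite dot_mulmx pg.1 q1.
have := posdef_ge0 (w - u) pg.
rewrite mulmxBr (dotBl w u) (dotBr (g *m w) (g *m u) w) (dotBr _ _ u) q2 q3.
have -> : dot u (g *m u) = dot (x - y) (J^T *m g *m J *m (x - y)).
  by rewrite /u -!mulmxA [RHS]dot_mulmx trmxK.
by rewrite -/w; lra.
Qed.


Local Open Scope ereal_scope.

Lemma smooth_jacobian {d m} (D : set 'cV[R]_d) (phi : 'cV[R]_d -> 'cV[R]_m) :
  open D -> smooth_on D phi -> smooth_on D (jacobian_mx phi).
Proof.
move=> oD sp; apply/(smooth_on_mxP oD) => a b.
under eq_fun do rewrite mxE.
by have /(smooth_on_mxP oD) := smooth_on_pderiv b sp; apply.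
Qed.

(** The outer factor 2 absorbs the variation of the density near a point, and the 1 in [K + 1] that
    of the pulled back metric; [(2 sqrt (K + 1)) ^ n] is the ellipsoid constant for radius
    [sqrt (K + 1) * e], divided by [e ^ n]. *)
Definition volume_constant (K : R) : R := 2 * (2 * Num.sqrt (K + 1)) ^+ n.

Lemma volume_constant_gt0 K : (0 <= K)%R -> (0 < volume_constant K)%R.
Proof. by move=> K0; rewrite mulr_gt0// exprn_gt0// mulr_gt0// sqrtr_gt0 ltr_wpDl. Qed.

(* The bound depends on the metric of the source only: the image of a set of
   diameter [e] lies in an ellipsoid for the metric of the target whose volume
   is at most a constant times [e ^+ n]. *)
Lemma upper_integral_image (D V : set X) (phi : X -> X) (g : X -> 'M[R]_n) (K : R) (x0 : X) :
  open D -> smooth_on D phi -> open V -> smooth_on V g ->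
  (forall x, D x -> V (phi x)) -> (forall x, V x -> posdef (g x)) ->
  (0 <= K)%R -> D x0 ->
  (forall v, dot v (((jacobian_mx phi x0)^T *m g (phi x0) *m jacobian_mx phi x0) *m v)
     <= K * `|v| ^+ 2)%R ->
  exists2 d : R, (0 < d)%R & forall (S : set X) e, S `<=` ball x0 d -> (0 <= e)%R ->
    (forall y z, S y -> S z -> (`|y - z| <= e)%R) ->
    upper_integral_Rn (fun x => (\1_(phi @` S) x *
      ((volume_constant K)^-1 * Num.sqrt (\det (g x))))%:E) <= (e ^+ n)%:E.
Proof.
move=> oD sp oV sg DV pg K0 Dx0 gK.
have C0 := volume_constant_gt0 K0.
pose g0 := g (phi x0); have pg0 : posdef g0 by exact/pg/DV.
have d0 : (0 < Num.sqrt (\det g0))%R by rewrite sqrtr_gt0 posdef_det.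
pose M x := ((jacobian_mx phi x)^T *m g0 *m jacobian_mx phi x)%R.
have sM : smooth_on D M.
  apply: (smooth_on_mulmx oD); last exact: smooth_jacobian.
  apply: (smooth_on_mulmx oD); last exact: smooth_on_cst.
  by apply: (smooth_on_tr oD); exact: smooth_jacobian.
(* Entries varying by at most [eps] change the quadratic form at [v] by at most
   [n ^ 2 * eps * |v| ^ 2], and [n ^ 2 * eps <= 1]: this is the passage from [K] to [K + 1]. *)
pose eps : R := ((n%:R ^+ 2 + 1)^-1)%R.
have eps0 : (0 < eps)%R by rewrite invr_gt0 ltr_wpDl// sqr_ge0.
have cM : \forall x \near x0, (`|M x0 - M x| <= eps)%R.
  by have /cvgrPdist_le/(_ _ eps0) := smooth_on_continuous sM Dx0.
have cdet : {for x0, continuous (fun x => \det (g (phi x)))}.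
  apply: (@continuous_comp _ _ _ phi (fun y => \det (g y))).
    exact: smooth_on_continuous sp Dx0.
  exact: smooth_on_continuous (smooth_on_det oV sg) (DV _ Dx0).
have cdens : \forall x \near x0, (Num.sqrt (\det (g (phi x))) <= 2 * Num.sqrt (\det g0))%R.
  have cs : {for x0, continuous (fun x => Num.sqrt (\det (g (phi x))))}.
    exact: (@continuous_comp _ _ _ (fun x => \det (g (phi x))) Num.sqrt _ cdet (@sqrt_continuous R _)).
  have /cvgrPdist_le/(_ _ d0) := cs; apply: filterS => x.
  by rewrite -/g0 ler_distlC => /andP[_]; rewrite mulr_natl mulr2n.
have nD : \forall x \near x0, D x by exact: near_open.
have [d dgt0 dP'] := near_ball (filterI (filterI cM cdens) nD).
have dP x : ball x0 d x -> ((`|M x0 - M x| <= eps)%R /\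
    (Num.sqrt (\det (g (phi x))) <= 2 * Num.sqrt (\det g0))%R) /\ D x by exact: dP'.
exists d => // S e Sd e0 Se.
have bE (x y : X) : ball x d y = (`|x - y| < d)%R :> Prop by rewrite -ball_normE.
have [->|/set0P[y0 Sy0]] := eqVneq S set0.
  apply: le_trans (_ : _ <= 0) _; last by rewrite lee_fin exprn_ge0.
  have := @upper_integral_ellipsoid R n g0 0 0 0 pg0 (lexx _) (lexx _).
  rewrite !mul0r; apply: le_trans; apply: le_upper_integral_Rn => x.
  by rewrite image_set0 indic0 mul0r; case: ifP.
pose r := (Num.sqrt (K + 1) * e)%R.
have r0 : (0 <= r)%R by rewrite mulr_ge0.
pose c := ((volume_constant K)^-1 * (2 * Num.sqrt (\det g0)))%R.
have c0 : (0 <= c)%R by rewrite mulr_ge0 ?invr_ge0 ?(ltW C0)// mulr_ge0// ltW.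
apply: (@le_trans _ _ (c * (2 * r) ^+ n / Num.sqrt (\det g0))%:E).
  apply: le_trans (upper_integral_ellipsoid (phi y0) pg0 r0 c0).
  apply: le_upper_integral_Rn => x.
  have [/set_mem[y Sy <-]|] := boolP (x \in phi @` S); last first.
    by rewrite indicE => /negPf ->; rewrite mul0r; case: ifP => // _; rewrite lee_fin.
  rewrite indicE mem_set ?mul1r; last by exists y.
  have seg t : (0 <= t <= 1)%R -> ball x0 d (t *: (y - y0) + y0)%R.
    move=> /andP[t0 t1]; move: (Sd _ Sy) (Sd _ Sy0); rewrite !bE => by_ by0.
    have -> : (x0 - (t *: (y - y0) + y0) = t *: (x0 - y) + (1 - t) *: (x0 - y0))%R.
      by rewrite scalerBl scale1r !scalerBr opprD !opprB; apply/matrixP => i j; rewrite !mxE; ring.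
    apply: le_lt_trans (ler_normD _ _) _; rewrite !normrZ (ger0_norm t0) ger0_norm ?subr_ge0//.
    have [->|tn0] := eqVneq t 0%R; first by rewrite mul0r add0r subr0 mul1r.
    have tp : (0 < t)%R by rewrite lt_neqAle eq_sym tn0.
    have -> : d = (t * d + (1 - t) * d)%R by ring.
    by apply: ltr_leD; [rewrite ltr_pM2l|apply: ler_wpM2l; [rewrite subr_ge0|exact: ltW]].
  have [t t01 tle] := metric_mean_value oD sp pg0 (fun t t01 => (dP _ (seg t t01)).2).
  rewrite ifT.
    rewrite lee_fin ler_wpM2l// ?invr_ge0 ?(ltW C0)//.
    by have [[_ ?] _] := dP _ (Sd _ Sy).
  apply: le_trans tle _; set z := (t *: _ + _)%R; rewrite -/(M z).
  have -> : M z = (M x0 + (M z - M x0))%R by rewrite addrC subrK.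
  rewrite mulmxDl dotDr.
  have h1 := gK (y - y0)%R; rewrite -/g0 -/(M x0) in h1.
  have h2 : (dot (y - y0) ((M z - M x0) *m (y - y0)) <= n%:R ^+ 2 * eps * `|y - y0| ^+ 2)%R.
    apply: dot_norm_le => i j; apply: le_trans (mx_norm_coord _ i j) _.
    by rewrite distrC; have [[? _] _] := dP _ (seg t t01).
  have h3 : (n%:R ^+ 2 * eps <= 1)%R.
    by rewrite /eps ler_pdivrMr ?mul1r ?lerDl// ltr_wpDl// sqr_ge0.
  have h4 : (`|y - y0| ^+ 2 <= e ^+ 2)%R by rewrite lerXn2r ?nnegrE// Se.
  rewrite /r exprMn sqr_sqrtr ?addr_ge0//.
  apply: le_trans (lerD h1 h2) _; rewrite -mulrDl.
  apply: ler_pM => //; first by rewrite addr_ge0// mulr_ge0// ?sqr_ge0// ltW.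
  by rewrite lerD2l.
rewrite lee_fin /c /r /volume_constant le_eqVlt; apply/orP; left; apply/eqP.
have s0 : Num.sqrt (K + 1) != 0%R by rewrite gt_eqF// sqrtr_gt0 ltr_wpDl.
rewrite !exprMn; field.
by rewrite !expf_neq0 ?s0 ?pnatr_eq0// gt_eqF.
Qed.

End LocalVolume.

Section CompactInduction.

(** The sets with [Q] are directed under inclusion. Along the filter of their eventual enlargements
    each point of [K] is covered together with a neighbourhood, so compactness yields a single set
    with [Q] that contains [K]. *)
Lemma compact_induction {T : topologicalType} (K : set T) (Q : set T -> Prop) :
  compact K -> Q set0 -> (forall U V, Q U -> Q V -> Q (U `|` V)) ->
  (forall U V, U `<=` V -> Q V -> Q U) ->
  (forall x, K x -> exists U, [/\ open U, U x & Q U]) -> Q K.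
Proof.
move=> cK Q0 QU Qsub loc.
pose F : set_system (set T) :=
  [set P | exists2 U0, Q U0 & forall U, U0 `<=` U -> Q U -> P U].
have FF : Filter F.
  split; first by exists set0.
  - move=> P P' [U QU0 PU] [U' QU' PU']; exists (U `|` U'); first exact: QU.
    by move=> W UW QW; split; [apply: PU|apply: PU'] => // x ?; apply: UW; [left|right].
  - by move=> P P' PP' [U QU0 PU]; exists U => // W UW QW; apply/PP'/PU.
have [] := (compact_near_coveringP K).1 cK _ F (fun U x => U x) FF.
  move=> x Kx; have [U [oU Ux QU0]] := loc x Kx.
  exists (U, [set W | U `<=` W]) => /=.
    split; first exact: near_open.
    by exists U => // W UW _.
  by move=> [y W] /= [Uy UW]; exact: UW.
by move=> U0 QU0 H; apply: Qsub (H U0 _ QU0) QU0.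
Qed.

Lemma within_continuous_open {T U : topologicalType} (A : set T) (f : T -> U) (B : set U) :
  open A -> {within A, continuous f} -> open B -> open (A `&` f @^-1` B).
Proof.
move=> oA; rewrite continuous_open_subspace// => cf oB.
rewrite openE => x [Ax Bfx]; apply: filterI; first exact: near_open.
by apply: (cf x); [exact: mem_set|exact: near_open].
Qed.

End CompactInduction.

Section UpperIntegralScaling.
Context {R : realType}.
Local Open Scope ereal_scope.

Lemma upper_integralZ (k : R) (f : R -> \bar R) : (0 < k)%R -> (forall x, 0 <= f x) ->
  upper_integral (fun x => k%:E * f x) <= k%:E * upper_integral f.
Proof.
move=> k0 f0; rewrite -lee_pdivrMl//; apply: le_ereal_inf_tmp => _ [g [mg fg] <-].
have g0 x : 0 <= g x by exact: le_trans (f0 x) (fg x).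
rewrite lee_pdivrMl// -ge0_integralZl_EFin//; last exact: ltW.
by apply: upper_integral_le => [|x]; [exact: measurable_funeM|rewrite lee_wpmul2l// lee_fin ltW].
Qed.

Lemma upper_integral_RnZ n (k : R) (f : 'cV[R]_n -> \bar R) : (0 < k)%R ->
  (forall x, 0 <= f x) ->
  upper_integral_Rn (fun x => k%:E * f x) <= k%:E * upper_integral_Rn f.
Proof.
move=> k0; elim: n f => [|n IH] f f0 //=.
apply: le_trans; last by apply: upper_integralZ => // t; exact: upper_integral_Rn_ge0.
by apply: le_upper_integral => t; exact: IH.
Qed.

Lemma upper_integral_Rn0 (n : nat) : upper_integral_Rn ((fun=> 0) : 'cV[R]_n -> \bar R) = 0.
Proof.
elim: n => [//|n IH] /=; rewrite IH; apply/eqP; rewrite eq_le.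
rewrite upper_integral_ge0// andbT.
apply: le_trans (upper_integral_le (g := fun=> 0) _ (fun=> lexx _)) _.
  exact: measurable_cst.
by rewrite integral0.
Qed.

End UpperIntegralScaling.

Section UpperDensity.
Context {R : realType} {n : nat} (f : 'cV[R]_n -> R).
Hypothesis f0 : forall x, 0 <= f x.
Local Open Scope ereal_scope.
Implicit Types S T : set 'cV[R]_n.

Definition upper_density S : \bar R := upper_integral_Rn (fun x => (\1_S x * f x)%:E).

Lemma indicM_ge0 S x : 0 <= (\1_S x * f x)%:E.
Proof. by rewrite lee_fin mulr_ge0. Qed.

Lemma upper_density_ge0 S : 0 <= upper_density S.
Proof. by apply: upper_integral_Rn_ge0 => x; exact: indicM_ge0. Qed.

Lemma le_upper_density S T : S `<=` T -> upper_density S <= upper_density T.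
Proof.
move=> ST; apply: le_upper_integral_Rn => x; rewrite lee_fin ler_wpM2r// !indicE ler_nat.
have [xS|//] := boolP (x \in S); rewrite mem_set//.
by apply: ST; exact: set_mem.
Qed.

Lemma upper_density0 : upper_density set0 = 0.
Proof.
rewrite /upper_density -[RHS](@upper_integral_Rn0 R n); congr upper_integral_Rn.
by apply/funext => x; rewrite indic0 mul0r.
Qed.

Lemma le_nneseries_term (u : nat -> \bar R) k : (forall j, 0 <= u j) ->
  u k <= \sum_(j <oo) u j.
Proof.
move=> u0; rewrite (nneseries_split 0 k.+1)// add0n big_nat_recr//= -addeA addeCA.
by rewrite leeDl// adde_ge0 ?sume_ge0 ?nneseries_ge0.
Qed.

Lemma upper_density_bigcup (A : nat -> set 'cV[R]_n) :
  upper_density (\bigcup_k A k) <= \sum_(k <oo) upper_density (A k).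
Proof.
apply: le_trans (upper_integral_Rn_nneseries _); last by move=> k x; exact: indicM_ge0.
apply: le_upper_integral_Rn => x.
have [/set_mem[k _ Akx]|xA] := boolP (x \in \bigcup_k A k); last first.
  by rewrite indicE (negPf xA) mul0r; apply: nneseries_ge0 => k *; exact: indicM_ge0.
apply: le_trans (@le_nneseries_term (fun k => (\1_(A k) x * f x)%:E) k _).
  by rewrite !indicE !mem_set//; exists k.
by move=> j; exact: indicM_ge0.
Qed.

Lemma upper_densityU S T : upper_density (S `|` T) <= upper_density S + upper_density T.
Proof.
rewrite -bigcup2E; apply: le_trans (upper_density_bigcup _) _.
rewrite (@nneseries_finite _ _ 2).
- by rewrite big_ord_recl big_ord_recl big_ord0 adde0.
- by move=> k; exact: upper_density_ge0.
- by move=> [|[|k]]// _; exact: upper_density0.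
Qed.

End UpperDensity.

(** * Finiteness of the Riemannian volume, uniformly in the charts *)

Section ChartVolume.
Context {R : realType} {n : nat} (M : oriented_manifold R n)
  (gm : om_idx M -> 'cV[R]_n -> 'M[R]_n).
Local Notation X := 'cV[R]_n.
Hypothesis gm_smooth : forall i, smooth_on (om_cod i) (gm i).
Hypothesis gm_posdef : forall i x, om_cod i x -> posdef (gm i x).
Hypothesis gm_trans : forall i j x, om_cod i x -> om_dom j (om_inv i x) ->
  gm i x = (trans_jac i j x)^T *m gm j (om_chart j (om_inv i x)) *m trans_jac i j x.

Definition chart_image (i : om_idx M) (A : set M) : set X :=
  [set x | om_cod i x /\ A (om_inv i x)].

Lemma open_chart_image i (A : set M) : open A -> open (chart_image i A).
Proof. by apply: within_continuous_open; [exact: om_cod_open|exact: om_inv_cont]. Qed.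

Local Open Scope ereal_scope.

Definition chart_volume (i : om_idx M) (A : set M) : \bar R :=
  upper_density (fun x => Num.sqrt (\det (gm i x))) (chart_image i A).

Lemma quad_bound_near i x0 : om_cod i x0 -> exists K : R, (0 <= K)%R /\
  \forall x \near x0, forall v, (dot v (gm i x *m v) <= K * `|v| ^+ 2)%R.
Proof.
move=> ix0; exists (n%:R ^+ 2 * (`|gm i x0| + 1))%R; split.
  by rewrite mulr_ge0 ?sqr_ge0// addr_ge0.
have /cvgrPdist_le/(_ _ ltr01) := smooth_on_continuous (gm_smooth (i := i)) ix0.
apply: filterS => x xx v; apply: dot_norm_le => a b.
apply: le_trans (mx_norm_coord _ a b) _.
by rewrite -lerBlDl; apply: le_trans xx; rewrite distrC lerB_dist.
Qed.

(** The upper volume in chart [i], seen as a function of sets in chart [j], is countably subadditive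
    and locally at most a constant times the [n]-th power of the diameter. As the metric of chart
    [i] pulls back to that of chart [j], the constant depends only on a bound for the latter on [B],
    and not on [i]. *)
Lemma chart_volume_le_dyadic (b : X) i j (B : set X) (K : R) :
  open B -> B `<=` om_cod j -> (0 <= K)%R ->
  (forall x, B x -> forall v, (dot v (gm j x *m v) <= K * `|v| ^+ 2)%R) ->
  forall A : set M, A `<=` om_dom i ->
  chart_volume i (A `&` [set y | exists2 x, B x & om_inv j x = y]) <=
  (@volume_constant R n K)%:E * dyadic_measure b [set x | B x /\ A (om_inv j x)].
Proof.
move=> oB Bj K0 BK A Ai; have C0 := @volume_constant_gt0 R n K K0.
set C := volume_constant K in C0 *.
pose D := [set x | B x /\ om_dom i (om_inv j x)].
have oD : open D.
  rewrite (_ : D = B `&` chart_image j (om_dom i)).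
    by apply: openI => //; apply: open_chart_image; exact: om_dom_open.
  by apply/seteqP; split=> x [Bx]; [move=> ?; split=> //; split => //; exact: Bj|case].
pose phi x := om_chart i (om_inv j x).
have sphi : smooth_on D phi.
  apply: smooth_on_sub (@om_trans_smooth _ _ M j i) => x [Bx ix]; split => //; exact: Bj.
have phiV x : D x -> om_cod i (phi x) by move=> [_ ix]; exact: om_chart_cod.
pose f x := (C^-1 * Num.sqrt (\det (gm i x)))%R.
have f0 x : (0 <= f x)%R by rewrite mulr_ge0// invr_ge0 ltW.
pose nu S := upper_density f (phi @` S).
have nuD : forall S, S `<=` D -> nu S <= dyadic_measure b S.
  apply: le_dyadic_measure_local.
  - by rewrite /nu image_set0 upper_density0.
  - by move=> S; exact: upper_density_ge0.
  - by move=> F; rewrite /nu image_bigcup; exact: upper_density_bigcup.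
  - move=> x Dx.
    have [v|d d0 H] := upper_integral_image oD sphi (om_cod_open (i := i)) (gm_smooth (i := i))
      phiV (gm_posdef (i := i)) K0 Dx _.
      have [Bx ix] := Dx; have jx := Bj _ Bx.
      by have <- := gm_trans jx ix; exact: BK.
    by exists d => // S e _; exact: H.
pose S := [set x | B x /\ A (om_inv j x)].
have SD : S `<=` D by move=> x [Bx Ax]; split => //; exact: Ai.
apply: (@le_trans _ _ (C%:E * nu S)); last by rewrite lee_wpmul2l ?lee_fin ?(ltW C0)//; exact: nuD.
apply: le_trans (upper_integral_RnZ C0 _); last by move=> x; exact: indicM_ge0.
apply: le_upper_integral_Rn => x; rewrite -EFinM mulrCA /f mulVKf ?gt_eqF//.
rewrite lee_fin ler_wpM2r// !indicE ler_nat.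
case: (boolP (x \in chart_image i _)) => // /set_mem[ix [Ax [z Bz zx]]].
rewrite mem_set//; exists z; first by split => //; rewrite zx.
by rewrite /phi zx om_invK.
Qed.

(** The sets with measurable trace in [B] form a sigma-algebra containing the open sets. *)
Lemma borel_caratheodory (b : X) j (B : set X) (A : set M) : open B -> B `<=` om_cod j ->
  <<s [set U : set M | open U] >> A ->
  (dyadic_measure b).-caratheodory [set x | B x /\ A (om_inv j x)].
Proof.
move=> oB Bj; pose G := [set A : set M | (dyadic_measure b).-caratheodory
  [set x | B x /\ A (om_inv j x)]].
suff : <<s [set U : set M | open U] >> `<=` G by exact.
apply: smallest_sub; [split|] => [|F GF|F GF|F oF].
- rewrite /G/= (_ : [set x | _] = set0); first exact: caratheodory_measurable_set0.
  by apply/seteqP; split=> x // [].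
- rewrite /G/= (_ : [set x | _] = B `\` [set x | B x /\ F (om_inv j x)]).
    by apply: caratheodory_measurable_setD => //; exact: open_caratheodory.
  apply/seteqP; split=> x; first by move=> [Bx [_ nF]]; split => // -[_]; exact: nF.
  by move=> [Bx nF]; split => //; split => // Fx; exact: nF.
- rewrite /G/= (_ : [set x | _] = \bigcup_k [set x | B x /\ F k (om_inv j x)]).
    exact: caratheodory_measurable_bigcup.
  by apply/seteqP; split=> x; [move=> [Bx [k _ Fk]]; exists k|move=> [k _ [Bx Fk]]; split => //; exists k].
- rewrite /G/= (_ : [set x | _] = B `&` chart_image j F).
    by apply: open_caratheodory; apply: openI => //; exact: open_chart_image.
  by apply/seteqP; split=> x; [move=> [Bx Fx]; split => //; split => //; exact: Bj|move=> [Bx []]].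
Qed.

(** One constant for all the families that enter [integral_vol], whatever their length and charts.
    The property passes to subsets and finite unions, as [compact_induction] requires. *)
Definition bounded_volume (W : set M) := exists C : R, forall m (i : 'I_m -> om_idx M)
    (A : 'I_m -> set M),
  (forall k, <<s [set U : set M | open U] >> (A k)) -> (forall k, A k `<=` om_dom (i k)) ->
  trivIset [set: 'I_m] A -> \sum_(k < m) chart_volume (i k) (A k `&` W) <= C%:E.

(** A ball of radius at most [1/2] in one chart fits in a unit cell. The traces of the disjoint
    Borel sets [A k] in it are disjoint and Caratheodory measurable, so their dyadic measures add up
    to at most 1. *)
Lemma bounded_volume_local y0 : exists W, [/\ open W, W y0 & bounded_volume W].
Proof.
have [j jy0] := om_cover y0; pose x0 := om_chart j y0.
have jx0 : om_cod j x0 by exact: om_chart_cod.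
have [K [K0 nK]] := quad_bound_near jx0.
have [d d0 dB] := near_ball (filterI nK (near_open (om_cod_open (i := j)) jx0)).
pose e := Num.min d (2^-1)%R; have e0 : (0 < e)%R by rewrite lt_min d0 invr_gt0 ltr0n.
pose B : set X := ball x0 e.
have Bd : B `<=` ball x0 d by apply: le_ball; rewrite ge_min lexx.
have oB : open B by exact: ball_open.
have Bj : B `<=` om_cod j by move=> x /Bd/dB[].
(* This anchor makes [x0] the centre of its unit cell. *)
pose b : X := (x0 - const_mx 2^-1)%R.
have Bcell : B `<=` dyadic_cell b 0 x0.
  move=> x; rewrite /B -ball_normE /= => xe; apply/funext => a.
  have half y : ball x0 (2^-1)%R y -> dyadic_code b 0 y a = 0%R.
    rewrite -ball_normE /= => ye; apply/floor_def.
    have := le_lt_trans (mx_norm_coord (x0 - y)%R a 0%R) ye.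
    rewrite /b expr0 mul1r !mxE ltr_norml intrD => /andP[h1 h2].
    by apply/andP; split; rewrite ?add0r; lra.
  rewrite !half//; first exact: ballxx.
  by rewrite -ball_normE /=; apply: lt_le_trans xe _; rewrite ge_min lexx orbT.
exists (om_dom j `&` om_chart j @^-1` B); split.
- by apply: within_continuous_open => //; [exact: om_dom_open|exact: om_chart_cont].
- by split => //; exact: ballxx.
have C0 := @volume_constant_gt0 R n K K0.
exists (volume_constant (n := n) K) => m i A mA Ai tA.
pose S k := [set x | B x /\ A k (om_inv j x)].
apply: (@le_trans _ _ (\sum_(k < m) (volume_constant (n := n) K)%:E * dyadic_measure b (S k))).
  apply: lee_sum => k _.
  apply: le_trans (@chart_volume_le_dyadic b (i k) j B K oB Bj K0 _ (A k) (Ai k)).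
    apply: le_upper_density => // x [ix [Ax [jx Bx]]]; split => //; split => //.
    by exists (om_chart j (om_inv (i k) x)) => //; exact: om_chartK.
  by move=> x /Bd/dB[].
rewrite -ge0_sume_distrr; last by move=> k _; exact: dyadic_measure_ge0.
rewrite -[leRHS]mule1 lee_wpmul2l ?lee_fin ?(ltW C0)//.
pose S' k : set X := if insub k is Some i then S i else set0.
have cS' k : (dyadic_measure b).-caratheodory (S' k).
  rewrite /S'; case: insubP => [l _ _|_]; first exact: borel_caratheodory.
  exact: caratheodory_measurable_set0.
have tS' : trivIset setT S'.
  move=> p q _ _; rewrite /S'; case: insubP => [u _ <-|_ [x []]//].
  case: insubP => [v _ <-|_ [x []]//] [x [[_ ux] [_ vx]]]; congr val.
  by apply: tA => //; exists (om_inv j x).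
have <- : dyadic_measure b (\big[setU/set0]_(k < m) S' k) = \sum_(k < m) dyadic_measure b (S k).
  have := caratheodory_additive cS' tS' m setT; rewrite setTI => ->.
  by apply: eq_bigr => k _; rewrite setTI /S' valK.
apply: le_trans (dyadic_measure_unit_cell b x0); apply: le_dyadic_measure.
rewrite -bigcup_mkord => x [k /= km]; rewrite /S'; case: insubP => // l _ _ [Bx _].
exact: Bcell.
Qed.

Lemma bounded_volume_compact : compact [set: M] -> bounded_volume [set: M].
Proof.
move=> cM; apply: compact_induction => //.
- exists 0%R => m i A _ _ _; rewrite big1// => k _.
  rewrite /chart_volume (_ : chart_image _ _ = set0) ?upper_density0//.
  by apply/seteqP; split=> x // [_ []].
- move=> U V [C HC] [C' HC']; exists (C + C')%R => m i A mA Ai tA.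
  apply: (@le_trans _ _ (\sum_(k < m) (chart_volume (i k) (A k `&` U) +
     chart_volume (i k) (A k `&` V)))).
    apply: lee_sum => k _; apply: le_trans (upper_densityU _ _ _) => //.
    apply: le_upper_density => // x [ix [Ax [Ux|Vx]]]; [left|right]; by split.
  by rewrite big_split EFinD/=; apply: leeD; [exact: HC|exact: HC'].
- move=> U V UV [C HC]; exists C => m i A mA Ai tA.
  apply: le_trans (HC m i A mA Ai tA); apply: lee_sum => k _.
  by apply: le_upper_density => // x [ix [Ax Ux]]; split => //; split => //; exact: UV.
- by move=> y _; exact: bounded_volume_local.
Qed.

End ChartVolume.

(** * Independence of the local expressions of frames and charts *)

Section CliffordWords.
Context {R : realType} {n N : nat} (c : {linear 'cV[R]_n -> 'M[R]_N}).
Hypothesis csq : forall x, c x *m c x = (- dot x x)%:M.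
Hypothesis cskew : forall x, (c x)^T = - c x.

Definition gam (j : 'I_n) : 'M[R]_N := c (delta_mx j 0).

Lemma clifford_anticomm x y : c x *m c y + c y *m c x = (- (2 * dot x y))%:M.
Proof.
have := csq (x + y); rewrite linearD mulmxDl !mulmxDr !csq dotDl !dotDr (dotC y x).
move=> /(congr1 (fun A => A + (dot x x)%:M + (dot y y)%:M)) E.
have -> : (- (2 * dot x y))%:M = (- (dot x x + dot x y + (dot x y + dot y y)))%:M
   + (dot x x)%:M + (dot y y)%:M :> 'M[R]_N.
  by rewrite -!raddfD/=; congr (_%:M); ring.
rewrite -E !raddfN/= [_ + _ + (_ - _)]addrACA [in RHS]addrAC.
rewrite -[in RHS](addrA _ _ (dot x x)%:M).
by apply/matrixP => i j; rewrite !mxE; ring.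
Qed.

Lemma dot_delta (x : 'cV[R]_n) j : dot x (delta_mx j 0) = x j 0.
Proof.
rewrite /dot (bigD1 j)//= mxE !eqxx mulr1 big1 ?addr0// => k kj.
by rewrite mxE (negPf kj) mulr0.
Qed.

Lemma gam_sq j : gam j *m gam j = - 1%:M.
Proof. by rewrite csq dot_delta mxE !eqxx raddfN. Qed.

Lemma gam_anticomm j k : j != k -> gam j *m gam k = - (gam k *m gam j).
Proof.
move=> jk; apply/eqP; rewrite -addr_eq0 clifford_anticomm dot_delta mxE.
by rewrite [k == j]eq_sym (negPf jk) mulr0 oppr0 raddf0.
Qed.

Lemma clifford_coord u : c u = \sum_j u j 0 *: gam j.
Proof.
rewrite {1}[u]matrix_sum_delta linear_sum; apply: eq_bigr => j _.
by rewrite big_ord1 linearZ.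
Qed.

Definition word (s : seq 'I_n) : 'M[R]_N := \big[mulmx/1%:M]_(j <- s) gam j.

Lemma word_cons j s : word (j :: s) = gam j *m word s.
Proof. by rewrite /word big_cons. Qed.

Lemma word_cat s t : word (s ++ t) = word s *m word t.
Proof. by elim: s => [|j s IH]; rewrite ?mul1mx//= ?word_cons ?IH ?mulmxA// /word big_nil mul1mx. Qed.

(** Moving [gam j] across a letter costs a sign exactly when the letter is not [j], and
    [size s + count_mem j s] has the parity of the number of such letters. *)
Lemma gam_word j s :
  gam j *m word s = (-1) ^+ (size s + count_mem j s) *: (word s *m gam j).
Proof.
elim: s => [|k s IH]; first by rewrite /word big_nil mulmx1 mul1mx scale1r.
rewrite word_cons; have [<-|jk] := eqVneq j k.
  rewrite {1}IH -scalemxAr mulmxA /= eqxx addnA addn1 addSn.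
  by rewrite !exprS mulrA mulrNN !mul1r.
rewrite mulmxA gam_anticomm// mulNmx -[_ *m gam j *m word s]mulmxA IH -scalemxAr mulmxA /=.
by rewrite eq_sym (negPf jk) add0n addSn exprS mulN1r scaleNr.
Qed.

Lemma half_double (X : 'M[R]_N) : 2^-1 *: (X + X) = X.
Proof. by apply/matrixP => i j; rewrite !mxE; field. Qed.

(** As [gam j] has inverse [- gam j], this is the mean of [X] and its conjugate by [gam j], the
    projection onto the matrices commuting with [gam j]. *)
Definition avg j (X : 'M[R]_N) : 'M[R]_N := 2^-1 *: (X - gam j *m X *m gam j).

Lemma avgD j X Y : avg j (X + Y) = avg j X + avg j Y.
Proof. by rewrite /avg mulmxDr mulmxDl opprD addrACA scalerDr. Qed.

Lemma avgZ j a X : avg j (a *: X) = a *: avg j X.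
Proof. by rewrite /avg -scalemxAr -scalemxAl -scalerBr !scalerA mulrC. Qed.

Lemma avg0 j : avg j 0 = 0.
Proof. by rewrite /avg mulmx0 mul0mx subrr scaler0. Qed.

Lemma avg_word j s : ~~ odd (size s) ->
  avg j (word s) = if odd (count_mem j s) then 0 else word s.
Proof.
move=> es; rewrite /avg gam_word -scalemxAl -mulmxA gam_sq mulmxN mulmx1 scalerN opprK.
rewrite exprD -(signr_odd _ (size s)) (negPf es) expr0 mul1r -signr_odd.
case: odd; first by rewrite expr1 scaleN1r subrr scaler0.
by rewrite expr0 scale1r half_double.
Qed.

Definition avgs (l : seq 'I_n) (X : 'M[R]_N) : 'M[R]_N := foldr avg X l.

Lemma avgsD l X Y : avgs l (X + Y) = avgs l X + avgs l Y.
Proof. by elim: l => //= j l ->; exact: avgD. Qed.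

Lemma avgsZ l a X : avgs l (a *: X) = a *: avgs l X.
Proof. by elim: l => //= j l ->; exact: avgZ. Qed.

Lemma avgs_word l s : ~~ odd (size s) ->
  avgs l (word s) = if all (fun j => ~~ odd (count_mem j s)) l then word s else 0.
Proof.
move=> es; elim: l => //= j l ->; case: ifP => _; last by rewrite andbF avg0.
by rewrite andbT avg_word//; case: odd.
Qed.

(** The first letter occurs again later. Moved next to each other the two copies cancel up to sign,
    and the multiplicities in the shorter word remain even. *)
Lemma word_even_scalar s : (forall j, ~~ odd (count_mem j s)) ->
  exists a : R, word s = a%:M.
Proof.
have [m] := ubnP (size s); elim: m s => // m IH [|j s] /=.
  by move=> _ _; exists 1; rewrite /word big_nil.
rewrite ltnS => sm es.
have js : j \in s.
  have := es j; rewrite eqxx oddD/= negbK => o; rewrite -has_pred1 has_count.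
  by case: count o.
case/splitPr: js sm es => s1 s2 sm es.
have [||a aE] := IH (s1 ++ s2).
- by apply: leq_trans sm; rewrite !size_cat/= addnS ltnS.
- move=> k; have := es k; rewrite !count_cat/= !oddD.
  by move: (odd (count_mem k s1)) (odd (count_mem k s2)) (odd (j == k)) => [] [] [].
exists (- (-1) ^+ (size s1 + count_mem j s1) * a).
rewrite word_cons word_cat word_cons !mulmxA gam_word -2!scalemxAl -2!mulmxA.
rewrite [gam j *m (gam j *m _)]mulmxA gam_sq mulNmx mul1mx mulmxN -word_cat aE.
by rewrite scalerN -scaleNr scale_scalar_mx.
Qed.

(** Multilinearity: expanding every vector in the canonical basis reduces a product to words of the
    same length. *)
Lemma even_product_ind (Q : 'M[R]_N -> Prop) (s : seq 'cV[R]_n) :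
  (forall X Y, Q X -> Q Y -> Q (X + Y)) -> (forall a X, Q X -> Q (a *: X)) -> Q 0 ->
  (forall w, size w = size s -> Q (word w)) -> Q (\big[mulmx/1%:M]_(u <- s) c u).
Proof.
elim: s Q => [|u s IH] Q QD QZ Q0 Qw.
  by rewrite big_nil; have := Qw [::] erefl; rewrite /word big_nil.
rewrite big_cons; apply: (IH (fun X => Q (c u *m X))).
- by move=> X Y QX QY; rewrite mulmxDr; exact: QD.
- by move=> a X QX; rewrite -scalemxAr; exact: QZ.
- by rewrite mulmx0.
- move=> w ws; rewrite clifford_coord mulmx_suml.
  apply: (big_ind Q) => // j _; rewrite -scalemxAl -word_cons.
  by apply: QZ; apply: Qw; rewrite /= ws.
Qed.

(** The averages keep a word in which all multiplicities are even, which is a scalar, and kill every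
    other word of even length. In particular they send Spin(n) to scalars. *)
Lemma avgs_even_product (s : seq 'cV[R]_n) : ~~ odd (size s) ->
  exists a : R, avgs (enum 'I_n) (\big[mulmx/1%:M]_(u <- s) c u) = a%:M.
Proof.
move=> es; apply: (@even_product_ind (fun X => exists a : R, avgs (enum 'I_n) X = a%:M)) => [X Y [a aE] [b bE]|a X [b bE]||w ws].
- by exists (a + b); rewrite avgsD aE bE raddfD.
- by exists (a * b); rewrite avgsZ bE scale_scalar_mx.
- by exists 0; rewrite -(scale0r 0) avgsZ scale0r raddf0.
- rewrite avgs_word ?ws//; case: allP => [aw|_]; last by exists 0; rewrite raddf0.
  by apply: word_even_scalar => j; apply: aw; rewrite mem_enum.
Qed.

(** Built from the identity [X - avg j X = gam j (X gam j - gam j X) / 2]: the part of [X] removed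
    by averaging, written linearly in the commutators of [X] with the generators. *)
Fixpoint comm_defect (l : seq 'I_n) (X : 'M[R]_N) : 'M[R]_N :=
  if l is j :: l' then
    2^-1 *: (gam j *m (X *m gam j - gam j *m X)) + avg j (comm_defect l' X)
  else 0.

Lemma avgs_comm_defect l X : X = avgs l X + comm_defect l X.
Proof.
elim: l => [|j l IH] /=; first by rewrite addr0.
rewrite addrCA -avgD -IH /avg mulmxBr !mulmxA gam_sq mulNmx mul1mx opprK -scalerDr.
set Y := gam j *m X *m gam j.
by rewrite (_ : Y + X + (X - Y) = X + X) ?half_double// addrC addrA subrK.
Qed.

Lemma cvg_mulmx {T : Type} {F : set_system T} {FF : Filter F} {p q r}
    (f : T -> 'M[R]_(p, q)) (g : T -> 'M[R]_(q, r)) (A : 'M[R]_(p, q)) (B : 'M[R]_(q, r)) :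
  f x @[x --> F] --> A -> g x @[x --> F] --> B -> f x *m g x @[x --> F] --> A *m B.
Proof.
move=> /cvg_mxP fA /cvg_mxP gB; apply/cvg_mxP => i j; rewrite mxE.
under eq_cvg do rewrite mxE.
apply: cvg_big => [|k _]; first exact: add_continuous.
by apply: cvgM.
Qed.

Lemma comm_defect_cvg {T : Type} {F : set_system T} {FF : Filter F} (k : T -> 'M[R]_N) D :
  (forall j, k h *m gam j - gam j *m k h @[h --> F] --> D *m gam j - gam j *m D) ->
  forall l, comm_defect l (k h) @[h --> F] --> comm_defect l D.
Proof.
move=> kD; elim=> [|j l IH] /=; first exact: cvg_cst.
apply: cvgD; first by apply: cvgZl_tmp; apply: cvg_mulmx; [exact: cvg_cst|exact: kD].
apply: cvgZl_tmp; apply: cvgB => //; apply: cvg_mulmx; last exact: cvg_cst.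
by apply: cvg_mulmx; [exact: cvg_cst|].
Qed.

End CliffordWords.

(** * The derivative of a lifted family of rotations acting on spinors *)

Section SpinDerivative.
Context {R : realType} {n N : nat} (c : {linear 'cV[R]_n -> 'M[R]_N}).
Hypothesis csq : forall x, c x *m c x = (- dot x x)%:M.
Hypothesis cskew : forall x, (c x)^T = - c x.
Local Notation gam := (gam c).

Lemma cvg_dot {T : Type} {F : set_system T} {FF : Filter F} {m}
    (f g : T -> 'cV[R]_m) (u v : 'cV[R]_m) :
  f x @[x --> F] --> u -> g x @[x --> F] --> v -> dot (f x) (g x) @[x --> F] --> dot u v.
Proof.
move=> /cvg_mxP fu /cvg_mxP gv; apply: cvg_big => [|k _]; first exact: add_continuous.
by apply: cvgM.
Qed.

Lemma cvg_clifford {T : Type} {F : set_system T} {FF : Filter F}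
    (f : T -> 'cV[R]_n) (u : 'cV[R]_n) :
  f x @[x --> F] --> u -> c (f x) @[x --> F] --> c u.
Proof.
move=> /cvg_mxP fu; rewrite (clifford_coord c u).
under eq_cvg do rewrite clifford_coord.
apply: cvg_big => [|k _]; first exact: add_continuous.
by apply: cvgZr_tmp.
Qed.

Lemma cvg_difference_quotient {V : normedModType R} (f : R -> V) (f0 L : V) :
  h^-1 *: (f h - f0) @[h --> (0 : R)^'] --> L -> f h @[h --> (0 : R)^'] --> f0.
Proof.
move=> fL; have H : h *: (h^-1 *: (f h - f0)) + f0 @[h --> (0 : R)^'] --> 0 *: L + f0.
  by apply: cvgD; [apply: cvgZ => //; exact: nbhs_dnbhs|exact: cvg_cst].
rewrite scale0r add0r in H; apply: cvg_trans H; apply: near_eq_cvg; near=> h.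
have h0 : h != 0 by near: h; exact: nbhs_dnbhs_neq.
by rewrite scalerA divff// scale1r subrK.
Unshelve. all: by end_near. Qed.

(** The product of [v h - v0] and [v h + v0] vanishes near 0, both vectors being of length 1;
    divided by [h], it tends to twice the product of [dv] and [v0]. *)
Lemma unit_derivative_orthogonal {m} (v : R -> 'cV[R]_m) (v0 dv : 'cV[R]_m) :
  (\forall h \near (0 : R)^', dot (v h) (v h) = 1) -> dot v0 v0 = 1 ->
  h^-1 *: (v h - v0) @[h --> (0 : R)^'] --> dv -> dot v0 dv = 0.
Proof.
move=> v1 v01 vdv; have vv0 := cvg_difference_quotient vdv.
have H : dot (h^-1 *: (v h - v0)) (v h + v0) @[h --> (0 : R)^'] --> dot dv (v0 + v0).
  by apply: cvg_dot => //; apply: cvgD => //; exact: cvg_cst.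
have H0 : dot (h^-1 *: (v h - v0)) (v h + v0) @[h --> (0 : R)^'] --> (0 : R).
  apply: cvg_near_cst; apply: filterS v1 => h vh.
  by rewrite dotZl dotBl !dotDr vh v01 (dotC v0 (v h)); ring.
have : dot dv (v0 + v0) = 0 by apply: cvg_unique H H0.
by rewrite dotDr -mulr2n dotC => /eqP; rewrite mulrn_eq0 /= => /eqP.
Qed.

Lemma skew_derivative {m} (A : R -> 'M[R]_m) (dA : 'M[R]_m) :
  (\forall h \near (0 : R)^', (A h)^T *m A h = 1%:M) ->
  h^-1 *: (A h - 1%:M) @[h --> (0 : R)^'] --> dA -> dA^T = - dA.
Proof.
move=> AA AdA; have A1 := cvg_difference_quotient AdA.
have tr (f : R -> 'M[R]_m) (L : 'M[R]_m) : f h @[h --> (0 : R)^'] --> L -> (f h)^T @[h --> (0 : R)^'] --> L^T.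
  move=> /cvg_mxP fL; apply/cvg_mxP => i j; rewrite mxE.
  by under eq_cvg do rewrite mxE; exact: fL.
have H : (h^-1 *: (A h - 1%:M))^T *m A h + h^-1 *: (A h - 1%:M) @[h --> (0 : R)^'] --> dA^T *m 1%:M + dA.
  by apply: cvgD => //; apply: cvg_mulmx => //; exact: tr.
have H0 : (h^-1 *: (A h - 1%:M))^T *m A h + h^-1 *: (A h - 1%:M) @[h --> (0 : R)^'] --> (0 : 'M[R]_m).
  apply: cvg_near_cst; apply: filterS AA => h Ah.
  rewrite linearZ/= -scalemxAl -scalerDr linearB/= trmx1 mulmxBl Ah mul1mx.
  by rewrite -opprB addNr scaler0.
have : dA^T *m 1%:M + dA = 0 by apply: cvg_unique H H0.
by rewrite mulmx1 => /eqP; rewrite addr_eq0 => /eqP.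
Qed.

(** On skew matrices, the inverse of the differential of the covering of SO(n) by Spin(n), as
    [spin_lift_comm] shows. The correction term in [spin_nabla] is the lift of the connection
    form. *)
Definition spin_lift (B : 'M[R]_n) : 'M[R]_N :=
  4^-1 *: \sum_k \sum_l B l k *: (gam k *m gam l).

Lemma gam_comm2 j k l : gam k *m gam l *m gam j - gam j *m (gam k *m gam l) =
  (2 * (k == j)%:R) *: gam l - (2 * (l == j)%:R) *: gam k.
Proof.
have E a b : gam a *m gam b = - (gam b *m gam a) - (2 * (a == b)%:R)%:M.
  apply/eqP; rewrite -subr_eq0 opprB opprK; apply/eqP.
  have E : gam a *m gam b + gam b *m gam a = (- (2 * (a == b)%:R))%:M.
    by rewrite (clifford_anticomm csq) dot_delta mxE eqxx andbT [b == a]eq_sym.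
  by rewrite addrCA E raddfN subrr.
rewrite -mulmxA (E l j) mulmxBr mulmxN [gam k *m (gam j *m gam l)]mulmxA (E k j) mulmxBl mulNmx opprB opprK.
rewrite mul_scalar_mx mul_mx_scalar mulmxA.
by apply/matrixP => a b; rewrite !mxE; ring.
Qed.

Lemma spin_lift_comm (B : 'M[R]_n) j : B^T = - B ->
  spin_lift B *m gam j - gam j *m spin_lift B = c (B *m delta_mx j 0).
Proof.
move=> Bskew; rewrite /spin_lift -scalemxAl -scalemxAr -scalerBr.
rewrite mulmx_suml mulmx_sumr -sumrB.
under eq_bigr => k _ do rewrite mulmx_suml mulmx_sumr -sumrB.
under eq_bigr => k _ do under eq_bigr => l _ do
  rewrite -scalemxAl -scalemxAr -scalerBr gam_comm2 scalerBr !scalerA.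
under eq_bigr => k _ do rewrite sumrB.
rewrite sumrB.
have -> : \sum_k \sum_l (B l k * (2 * (k == j)%:R)) *: gam l = \sum_l (2 * B l j) *: gam l.
  rewrite exchange_big; apply: eq_bigr => l _ /=; rewrite (bigD1 j)//= eqxx mulr1 mulrC.
  by rewrite big1 ?addr0// => k /negPf ->; rewrite mulr0 mulr0 scale0r.
have -> : \sum_k \sum_l (B l k * (2 * (l == j)%:R)) *: gam k = \sum_k (2 * B j k) *: gam k.
  apply: eq_bigr => k _; rewrite (bigD1 j)//= eqxx mulr1 mulrC.
  by rewrite big1 ?addr0// => l /negPf ->; rewrite mulr0 mulr0 scale0r.
rewrite -sumrB scaler_sumr clifford_coord; apply: eq_bigr => l _.
have Bjl : B j l = - B l j by have := congr1 (fun A : 'M[R]_n => A l j) Bskew; rewrite !mxE.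
rewrite Bjl -scalerBl scalerA; congr (_ *: _).
have -> : (B *m delta_mx j 0 : 'cV[R]_n) l 0 = B l j by rewrite -colE mxE.
by field.
Qed.

Lemma spin_lift_skew (B : 'M[R]_n) : B^T = - B -> (spin_lift B)^T = - spin_lift B.
Proof.
move=> Bskew; rewrite /spin_lift linearZ/= -scalerN; congr (_ *: _).
rewrite linear_sum/=; under eq_bigr do rewrite linear_sum/=.
rewrite exchange_big -sumrN; apply: eq_bigr => k _; rewrite -sumrN; apply: eq_bigr => l _ /=.
have Bkl : B k l = - B l k by have := congr1 (fun A : 'M[R]_n => A l k) Bskew; rewrite !mxE.
by rewrite linearZ/= trmx_mul !cskew mulNmx mulmxN opprK Bkl scaleNr.
Qed.

Lemma avgsE_spin_lift (B : 'M[R]_n) : exists a : R, avgs c (enum 'I_n) (spin_lift B) = a%:M.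
Proof.
pose Q X := exists a : R, avgs c (enum 'I_n) X = a%:M.
have QD X Y : Q X -> Q Y -> Q (X + Y).
  by move=> [a aE] [b bE]; exists (a + b); rewrite avgsD aE bE raddfD.
have QZ a X : Q X -> Q (a *: X).
  by move=> [b bE]; exists (a * b); rewrite avgsZ bE scale_scalar_mx.
have Q0 : Q 0 by exists 0; rewrite -(scale0r 0) avgsZ scale0r raddf0.
apply: (QZ); apply: (big_ind Q) => // k _; apply: (big_ind Q) => // l _; apply: (QZ).
have := avgs_even_product csq (s := [:: delta_mx k 0; delta_mx l 0]) isT.
by rewrite !big_cons big_nil mulmx1.
Qed.

Lemma comm_defectZ l a X : comm_defect c l (a *: X) = a *: comm_defect c l X.
Proof.
elim: l => [|j l IH] /=; first by rewrite scaler0.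
rewrite IH avgZ scalerDr; congr (_ + _).
by rewrite -scalemxAl -scalemxAr -scalerBr -scalemxAr !scalerA mulrC.
Qed.

(* [K] is recovered up to a scalar from its commutators with the generators, and
   the scalar is then fixed by the lengths of [v] and [v']. *)
Lemma spin_derivative (A : R -> 'M[R]_n) (K : R -> 'M[R]_N) (v v' : R -> 'cV[R]_N)
    (dA : 'M[R]_n) (dv dv' v0 : 'cV[R]_N) :
  (\forall h \near (0 : R)^', spin_set c (K h)) ->
  (\forall h \near (0 : R)^', forall x, K h *m c x = c (A h *m x) *m K h) ->
  (\forall h \near (0 : R)^', (A h)^T *m A h = 1%:M) ->
  (\forall h \near (0 : R)^', v h = K h *m v' h) ->
  (\forall h \near (0 : R)^', dot (v h) (v h) = 1) ->
  (\forall h \near (0 : R)^', dot (v' h) (v' h) = 1) -> dot v0 v0 = 1 ->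
  K h @[h --> (0 : R)^'] --> (1%:M : 'M[R]_N) ->
  h^-1 *: (A h - 1%:M) @[h --> (0 : R)^'] --> dA ->
  h^-1 *: (v h - v0) @[h --> (0 : R)^'] --> dv ->
  h^-1 *: (v' h - v0) @[h --> (0 : R)^'] --> dv' ->
  dv = dv' + spin_lift dA *m v0.
Proof.
move=> Kspin Kc AA vK v1 v1' v01 K1 AdA vdv vdv'.
pose L := enum 'I_n; pose D := spin_lift dA.
have dAskew := skew_derivative AA AdA.
have [b bE] := avgsE_spin_lift dA.
(* As the averages of [K h] are scalar, [K h] is a scalar plus [E h], and [E h] only involves
   commutators, which [A h] determines through [Kc]. *)
pose E h := comm_defect c L (K h).
have cE : h^-1 *: E h @[h --> (0 : R)^'] --> D - b%:M.
  have -> : D - b%:M = comm_defect c L D.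
    by rewrite {1}(avgs_comm_defect csq L D) /D bE addrAC subrr add0r.
  under eq_cvg do rewrite -comm_defectZ.
  apply: comm_defect_cvg => j; rewrite spin_lift_comm//.
  have H : c ((h^-1 *: (A h - 1%:M)) *m delta_mx j 0) *m K h @[h --> (0 : R)^'] -->
      c (dA *m delta_mx j 0) *m 1%:M.
    by apply: cvg_mulmx => //; apply: cvg_clifford; apply: cvg_mulmx => //; exact: cvg_cst.
  rewrite mulmx1 in H; apply: cvg_trans H; apply: near_eq_cvg.
  apply: filterS Kc => h Kh.
  rewrite -scalemxAl linearZ/= mulmxBl mul1mx linearB/= -scalemxAl mulmxBl -Kh.
  by rewrite -!scalemxAl -!scalemxAr scalerBr.
(* The scalar part of [K h], extracted by pairing with the unit vector [v' h]. *)
pose al h := dot (v' h) (v h) - dot (v' h) (E h *m v' h).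
have vE : \forall h \near (0 : R)^', v h = al h *: v' h + E h *m v' h.
  apply: filterS3 Kspin vK v1' => h [s [es us Ks]] vh v1h.
  have [a aE] := avgs_even_product csq es; rewrite -Ks in aE.
  have KE : K h = a%:M + E h by rewrite {1}(avgs_comm_defect csq L (K h)) aE.
  have vaE : v h = a *: v' h + E h *m v' h by rewrite vh {1}KE mulmxDl mul_scalar_mx.
  by rewrite /al {2}vaE dotDr dotZr v1h mulr1 addrK.
have v'0 := cvg_difference_quotient vdv'.
have cdiff : h^-1 *: (v h - v' h) @[h --> (0 : R)^'] --> dv - dv'.
  have H : h^-1 *: (v h - v0) - h^-1 *: (v' h - v0) @[h --> (0 : R)^'] --> dv - dv' by exact: cvgB.
  apply: cvg_trans H; apply: near_eq_cvg; apply: nearW => h.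
  by rewrite -scalerBr opprB addrA subrK.
(* Unit length makes [dv] and [dv'] orthogonal to [v0], and the lift [D] is skew, so that pairing
   with [v0] leaves only [b]. *)
have cal : h^-1 * (al h - 1) @[h --> (0 : R)^'] --> b.
  have H : dot (v' h) (h^-1 *: (v h - v' h)) - dot (v' h) ((h^-1 *: E h) *m v' h) @[h --> (0 : R)^']
      --> dot v0 (dv - dv') - dot v0 ((D - b%:M) *m v0).
    by apply: cvgB; apply: cvg_dot => //; apply: cvg_mulmx.
  have bE' : b = dot v0 (dv - dv') - dot v0 ((D - b%:M) *m v0).
    rewrite dotBr (unit_derivative_orthogonal v1 v01 vdv) (unit_derivative_orthogonal v1' v01 vdv').
    rewrite mulmxBl mul_scalar_mx dotBr dotZr v01.
    have : dot v0 (D *m v0) = - dot v0 (D *m v0).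
      rewrite {1}dot_mulmx spin_lift_skew// mulNmx dotC.
      by rewrite -scaleN1r dotZr mulN1r.
    by move=> E0; lra.
  rewrite -bE' in H; apply: cvg_trans H; apply: near_eq_cvg; apply: filterS v1' => h v1h.
  by rewrite -scalemxAl !dotZr dotBr v1h /al; ring.
have cR : h^-1 *: (v h - v' h) @[h --> (0 : R)^'] --> b *: v0 + (D - b%:M) *m v0.
  have H : (h^-1 * (al h - 1)) *: v' h + (h^-1 *: E h) *m v' h @[h --> (0 : R)^'] -->
      b *: v0 + (D - b%:M) *m v0.
    by apply: cvgD; [exact: cvgZ|exact: cvg_mulmx].
  apply: cvg_trans H; apply: near_eq_cvg; apply: filterS vE => h ->.
  by rewrite -scalemxAl -scalerA -scalerDr scalerBl scale1r addrAC.
have : dv - dv' = b *: v0 + (D - b%:M) *m v0 by apply: cvg_unique cdiff cR.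
by rewrite mulmxBl mul_scalar_mx addrCA subrr addr0 => /eqP; rewrite subr_eq addrC => /eqP.
Qed.

End SpinDerivative.

Section SmoothComposition.
Context {R : realType}.

Lemma is_derive_mxP {V : normedModType R} {p q} (F : V -> 'M[R]_(p, q)) x v (L : 'M[R]_(p, q)) :
  (forall i j, is_derive x v (fun y => F y i j) (L i j)) -> is_derive x v F L.
Proof.
move=> H; have dF : derivable F x v by apply/derivable_mxP => i j; case: (H i j).
apply: DeriveDef => //; rewrite derive_mx//; apply/matrixP => i j; rewrite mxE.
by case: (H i j).
Qed.

Lemma is_derive_mx_coord {V : normedModType R} {p q} (F : V -> 'M[R]_(p, q)) x v i j :
  derivable F x v -> is_derive x v (fun y => F y i j) ('D_v F x i j).
Proof.
move=> dF; rewrite derive_mx// mxE; apply: derivableP.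
by have /derivable_mxP := dF; exact.
Qed.

Lemma is_derive_mulmx {V : normedModType R} {p q r} (F : V -> 'M[R]_(p, q))
    (G : V -> 'M[R]_(q, r)) x v : derivable F x v -> derivable G x v ->
  is_derive x v (fun y => F y *m G y) ('D_v F x *m G x + F x *m 'D_v G x).
Proof.
move=> dF dG; apply: is_derive_mxP => i j; rewrite !mxE.
have -> : (fun y => (F y *m G y) i j) = \sum_k ((fun y => F y i k) * (fun y => G y k j)).
  by apply/funext => y; rewrite mxE fct_sumE.
rewrite -big_split; apply: is_derive_sum => k.
have hF := is_derive_mx_coord i k dF; have hG := is_derive_mx_coord k j dG.
by apply: is_derive_eq; rewrite /GRing.scale/= addrC; congr (_ + _); rewrite mulrC.
Qed.

Lemma pderiv_mulmx {d p q r} (F : 'cV[R]_d -> 'M[R]_(p, q)) (G : 'cV[R]_d -> 'M[R]_(q, r)) k x :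
  derivable F x (delta_mx k 0) -> derivable G x (delta_mx k 0) ->
  pderiv k (fun y => F y *m G y) x = pderiv k F x *m G x + F x *m pderiv k G x.
Proof. by move=> dF dG; exact: (@derive_val _ _ _ _ _ _ _ (is_derive_mulmx dF dG)). Qed.

Lemma is_derive_trmx {V : normedModType R} {p q} (F : V -> 'M[R]_(p, q)) x v :
  derivable F x v -> is_derive x v (fun y => (F y)^T) ('D_v F x)^T.
Proof.
move=> dF; apply: is_derive_mxP => i j; rewrite mxE.
have -> : (fun y => (F y)^T i j) = (fun y => F y j i) by apply/funext => y; rewrite mxE.
exact: is_derive_mx_coord.
Qed.

Context {d e : nat} (D : set 'cV[R]_d) (U : set 'cV[R]_e) (phi : 'cV[R]_d -> 'cV[R]_e).
Hypotheses (oD : open D) (oU : open U) (sphi : smooth_on D phi)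
  (DU : forall x, D x -> U (phi x)).

Lemma is_derive_comp_smooth (f : 'cV[R]_e -> R) k x : C0_derivable U f ->
  (forall l, {for phi x, continuous (pderiv l f)}) -> D x ->
  is_derive x (delta_mx k 0) (f \o phi) (\sum_l jacobian_mx phi x l k * pderiv l f (phi x)).
Proof.
move=> f0 f1 Dx; have dphi := smooth_on_derivable (k := k) sphi Dx.
have -> : \sum_l jacobian_mx phi x l k * pderiv l f (phi x) =
    \sum_l 'D_(delta_mx k 0) (fun y => phi y l 0) x * pderiv l f (phi x).
  by apply: eq_bigr => l _; rewrite mxE (pderiv_mx _ _ dphi).
apply: chain_pderiv => // l.
by apply: filterS (near_open oU (DU Dx)) => y Uy; have [_] := f0 y Uy; exact.
Qed.

Lemma pderiv_comp_smooth (f : 'cV[R]_e -> R) k x : smooth_on U f -> D x ->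
  pderiv k (fun y => f (phi y)) x = \sum_l jacobian_mx phi x l k * pderiv l f (phi x).
Proof.
move=> sf Dx; apply: (@derive_val _ _ _ _ _ _ _ (is_derive_comp_smooth _ _ _ Dx)).
- by move=> y Uy; split => [|l]; [exact: smooth_on_continuous sf Uy|exact: smooth_on_derivable sf Uy].
- by move=> l; exact: smooth_on_continuous (smooth_on_pderiv l sf) (DU Dx).
Qed.

Lemma C0_derivable_comp (f : 'cV[R]_e -> R) : smooth_on U f ->
  C0_derivable D (fun x => f (phi x)).
Proof.
move=> sf x Dx; split=> [|k].
  by apply: continuous_comp; [exact: smooth_on_continuous sphi Dx|exact: smooth_on_continuous sf (DU Dx)].
apply: (@ex_derive _ _ _ _ _ _ _ (is_derive_comp_smooth _ _ _ Dx)).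
  by move=> y Uy; split => [|l]; [exact: smooth_on_continuous sf Uy|exact: smooth_on_derivable sf Uy].
by move=> l; exact: smooth_on_continuous (smooth_on_pderiv l sf) (DU Dx).
Qed.

Lemma Ck_on_sum m {I : Type} (r : seq I) (F : I -> 'cV[R]_d -> R) :
  (forall i, Ck_on m D (F i)) -> Ck_on m D (fun x => \sum_(i <- r) F i x).
Proof.
move=> cF; elim: r => [|i r IH].
  by under eq_fun do rewrite big_nil; exact: Ck_on_cst.
under eq_fun do rewrite big_cons.
by apply: Ck_on_add; [exact: oD|exact: cF|exact: IH].
Qed.

Lemma Ck_on_comp m (f : 'cV[R]_e -> R) : smooth_on U f -> Ck_on m D (fun x => f (phi x)).
Proof.
elim: m f => [|m IH] f sf; (split; first exact: C0_derivable_comp) => // k.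
apply: (@Ck_on_eq _ _ _ _ _ (fun x => \sum_l jacobian_mx phi x l k * pderiv l f (phi x)) _ oD).
  by move=> x Dx; rewrite pderiv_comp_smooth.
apply: Ck_on_sum => l; apply: Ck_on_mul; first exact: oD.
  by have := smooth_jacobian oD sphi => /(smooth_on_mxP oD)/(_ l k)/smooth_onP; exact.
by apply: IH; exact: smooth_on_pderiv.
Qed.

Lemma smooth_on_comp {p q} (F : 'cV[R]_e -> 'M[R]_(p, q)) : smooth_on U F ->
  smooth_on D (fun x => F (phi x)).
Proof.
move=> /(smooth_on_mxP oU) sF; apply/(smooth_on_mxP oD) => i j.
apply/smooth_onP => m; exact: (Ck_on_comp (f := fun y => F y i j) m (sF i j)).
Qed.

Lemma pderiv_comp_mx {p q} (F : 'cV[R]_e -> 'M[R]_(p, q)) k x : smooth_on U F -> D x ->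
  pderiv k (fun y => F (phi y)) x = \sum_l jacobian_mx phi x l k *: pderiv l F (phi x).
Proof.
move=> sF Dx; apply/matrixP => i j; rewrite summxE.
have sFij : smooth_on U (fun y => F y i j) by have /(smooth_on_mxP oU) := sF; exact.
apply: etrans (pderiv_mx i j (smooth_on_derivable (k := k) (smooth_on_comp sF) Dx)) _.
apply: etrans (pderiv_comp_smooth (f := fun y => F y i j) k sFij Dx) _.
apply: eq_bigr => l _; rewrite [RHS]mxE; congr (_ * _).
exact: esym (pderiv_mx i j (smooth_on_derivable (k := l) sF (DU Dx))).
Qed.

End SmoothComposition.

(** * Christoffel symbols under a coordinate change *)

Section ChristoffelTransformation.
Context {R : realType} {n : nat}.
Local Notation X := 'cV[R]_n.

(** The Christoffel symbols of the first kind. Without the inverse metric, their transformation law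
    is polynomial in the Jacobian and its derivatives. *)
Definition koszul (g : X -> 'M[R]_n) (a : 'I_n) (x : X) : 'M[R]_n :=
  \matrix_(l, k) (2^-1 * (pderiv a g x l k + pderiv k g x l a - pderiv l g x a k)).

Lemma mulmx_coord_eq (A B C : 'M[R]_n) l k m :
  (forall q, B q k = C q m) -> (A *m B) l k = (A *m C) l m.
Proof. by move=> BC; rewrite !mxE; apply: eq_bigr => q _; rewrite BC. Qed.

Lemma tr_mulmx3E (A B C : 'M[R]_n) l m :
  (A^T *m B *m C) l m = \sum_p \sum_q A p l * B p q * C q m.
Proof.
rewrite mxE exchange_big; apply: eq_bigr => q _ /=; rewrite mxE mulr_suml.
by apply: eq_bigr => p _; rewrite !mxE.
Qed.

Lemma tr_mulmx3C (A B C : 'M[R]_n) l m : B^T = B ->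
  (A^T *m B *m C) l m = (C^T *m B *m A) m l.
Proof.
move=> BT; have := congr1 (fun Y : 'M[R]_n => Y m l) (trmx_mul (A^T *m B) C).
by rewrite (trmx_mul A^T B) trmxK BT (mulmxA C^T) => <-; rewrite [RHS]mxE.
Qed.

Lemma koszul_coord (A B C Y : 'M[R]_n) l m : B^T = B ->
  (C^T *m B *m A + Y + A^T *m B *m C) l m =
  (A^T *m B *m C) m l + (A^T *m B *m C) l m + Y l m.
Proof. by move=> BT; rewrite -(tr_mulmx3C C A l m BT) !mxE; ring. Qed.

Lemma tr_mulmx3_sumE (J : 'M[R]_n) (d : 'I_n -> 'M[R]_n) k l m :
  (J^T *m (\sum_b J b k *: d b) *m J) l m =
  \sum_b \sum_p \sum_q J b k * J p l * J q m * d b p q.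
Proof.
rewrite tr_mulmx3E exchange_big /=.
under eq_bigr do under eq_bigr do rewrite summxE mulr_sumr mulr_suml.
under eq_bigr do rewrite exchange_big /=.
rewrite exchange_big; apply: eq_bigr => b _ /=; rewrite exchange_big.
by apply: eq_bigr => p _; apply: eq_bigr => q _; rewrite mxE; ring.
Qed.

(** The tensorial part of the transformation law: once expanded, the three terms agree up to a
    renaming of the summation indices. *)
Lemma tr_mulmx3_koszul (J : 'M[R]_n) (d : 'I_n -> 'M[R]_n) a l m :
  let T k l m := (J^T *m (\sum_b J b k *: d b) *m J) l m in
  (J^T *m (\sum_b J b a *: \matrix_(p, q) (2^-1 * (d b p q + d q p b - d p b q))) *m J) l m =
  2^-1 * (T a l m + T m l a - T l a m).
Proof.
rewrite /= !tr_mulmx3_sumE.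
have -> : \sum_b \sum_p \sum_q J b m * J p l * J q a * d b p q =
    \sum_b \sum_p \sum_q J b a * J p l * J q m * d q p b.
  rewrite exchange_big [RHS]exchange_big; apply: eq_bigr => p _ /=.
  by rewrite exchange_big; apply: eq_bigr => q _; apply: eq_bigr => b _; ring.
have -> : \sum_b \sum_p \sum_q J b l * J p a * J q m * d b p q =
    \sum_b \sum_p \sum_q J b a * J p l * J q m * d p b q.
  rewrite exchange_big; apply: eq_bigr => b _ /=; apply: eq_bigr => p _.
  by apply: eq_bigr => q _; ring.
rewrite -big_split -sumrB mulr_sumr; apply: eq_bigr => b _ /=.
rewrite -big_split -sumrB mulr_sumr; apply: eq_bigr => p _ /=.
rewrite -big_split -sumrB mulr_sumr; apply: eq_bigr => q _ /=.
by rewrite mxE; ring.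
Qed.

(* The second derivatives of the coordinate change enter the Koszul expression
   only through the symmetric array [J^T g dJ]. *)
Lemma koszul_trans (D U : set X) (phi : X -> X) (gi gj : X -> 'M[R]_n) x a :
  open D -> open U -> smooth_on D phi -> (forall x, D x -> U (phi x)) ->
  smooth_on U gj -> (forall y, U y -> (gj y)^T = gj y) ->
  (forall x, D x -> gi x = (jacobian_mx phi x)^T *m gj (phi x) *m jacobian_mx phi x) ->
  D x ->
  let J := jacobian_mx phi in
  koszul gi a x = (J x)^T *m gj (phi x) *m pderiv a J x +
    (J x)^T *m (\sum_b J x b a *: koszul gj b (phi x)) *m J x.
Proof.
move=> oD oU sphi DU sgj gjT giE Dx J.
have sJ : smooth_on D J := smooth_jacobian oD sphi.
have sG : smooth_on D (fun y => gj (phi y)) := smooth_on_comp oD oU sphi DU sgj.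
have dJ k : derivable J x (delta_mx k 0) := smooth_on_derivable sJ Dx.
have dG k : derivable (fun y => gj (phi y)) x (delta_mx k 0) := smooth_on_derivable sG Dx.
have dJT k := is_derive_trmx (dJ k).
(* Differentiating [J^T g J] gives two terms with a derivative of [J], both of the form [S], and the
   tensorial term [T]. *)
pose S l k m := ((J x)^T *m gj (phi x) *m pderiv k J x) l m.
pose T k l m := ((J x)^T *m (\sum_b J x b k *: pderiv b gj (phi x)) *m J x) l m.
have schwarz q k m : pderiv k J x q m = pderiv m J x q k.
  have sq : smooth_on D (fun y => phi y q 0) by have /(smooth_on_mxP oD) := sphi; exact.
  have E k' m' : pderiv k' J x q m' = pderiv k' (pderiv m' (fun y => phi y q 0)) x.
    rewrite (pderiv_mx q m' (dJ k')); apply: (pderiv_eq_on _ oD) => // y Dy.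
    by rewrite /J mxE (pderiv_mx _ _ (smooth_on_derivable sphi Dy)).
  refine (etrans (E k m) (etrans _ (esym (E m k)))).
  refine (@pderiv_schwarz R n (fun y => phi y q 0) k m x _ _ _).
  - by move=> k'; apply: filterS (near_open oD Dx) => y Dy; exact: smooth_on_derivable sq Dy.
  - move=> k' l'; apply: filterS (near_open oD Dx) => y Dy.
    exact: smooth_on_derivable (smooth_on_pderiv k' sq) Dy.
  - by move=> k' l'; exact: smooth_on_continuous (smooth_on_pderiv k' (smooth_on_pderiv l' sq)) Dx.
have Ssym l k m : S l k m = S l m k.
  by apply: mulmx_coord_eq => q; exact: schwarz.
have dgi k l m : pderiv k gi x l m = S m k l + S l k m + T k l m.
  have -> : pderiv k gi x = pderiv k (fun y => (J y)^T *m (gj (phi y)) *m J y) x.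
    exact: (pderiv_eq_on _ oD giE).
  have d1 := is_derive_mulmx (ex_derive (is_derive := dJT k)) (dG k).
  rewrite (pderiv_mulmx (ex_derive (is_derive := d1)) (dJ k)).
  rewrite [pderiv k (fun y => (J y)^T *m _) x](@derive_val _ _ _ _ _ _ _ d1).
  rewrite (@derive_val _ _ _ _ _ _ _ (dJT k)) -/(pderiv k J x).
  rewrite -/(pderiv k (fun y => gj (phi y)) x) (pderiv_comp_mx oD oU sphi DU k sgj Dx).
  have gE := gjT _ (DU _ Dx).
  rewrite mulmxDl; exact: koszul_coord.
apply/matrixP => l m; rewrite [RHS]mxE -/(S l a m).
have := tr_mulmx3_koszul (J x) (fun b => pderiv b gj (phi x)) a l m.
move=> /(congr1 (fun z => S l a m + z)) /esym; apply: etrans; rewrite [LHS]mxE.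
(* Of the six terms [S] in the Koszul combination, four cancel by symmetry and the other two add up
   to [2 * S l a m]. *)
refine (etrans (f_equal3 (fun u v w => 2^-1 * (u + v - w)) (dgi a l m) (dgi m l a) (dgi l a m)) _).
rewrite /= -/(T a l m) -/(T m l a) -/(T l a m).
by rewrite (Ssym l m a) (Ssym m a l) (Ssym a m l); field.
Qed.

Lemma mulmx_christoffel {N : nat} {M : oriented_manifold R n} {G : topGroupType}
    {proj : G -> 'M[R]_n} {P : spin_structure M proj} (s : univ_section N P) i a x :
  us_metric s i x \in unitmx ->
  us_metric s i x *m christoffel s i a x = koszul (us_metric s i) a x.
Proof.
move=> ug; rewrite -[RHS]mul1mx -(mulmxV ug) -mulmxA; congr (_ *m _).
apply/matrixP => b k; rewrite !mxE mulr_sumr; apply: eq_bigr => l _.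
by rewrite !mxE mulrCA.
Qed.

End ChristoffelTransformation.

(** * The squared norm of [T_r] under rotations of the frame *)

Section TensorNorm.
Context {R : realType} {n N : nat} (c : {linear 'cV[R]_n -> 'M[R]_N}).
Hypothesis csq : forall x, c x *m c x = (- dot x x)%:M.
Hypothesis cskew : forall x, (c x)^T = - c x.

Lemma sum_ffun_recl (I : finType) r (F : {ffun 'I_r.+1 -> I} -> R) :
  \sum_K F K =
  \sum_k \sum_(g : {ffun 'I_r -> I}) F [ffun j => if unlift ord0 j is Some j' then g j' else k].
Proof.
rewrite pair_big /=.
pose h (p : I * {ffun 'I_r -> I}) : {ffun 'I_r.+1 -> I} :=
  [ffun j => if unlift ord0 j is Some j' then p.2 j' else p.1].
rewrite (reindex h)//; exists (fun K : {ffun 'I_r.+1 -> I} => (K ord0, [ffun j => K (lift ord0 j)])).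
  move=> [k g] _; rewrite /h /= ffunE unlift_none; congr pair.
  by apply/ffunP => j; rewrite !ffunE liftK.
by move=> K _; apply/ffunP => j; rewrite !ffunE; case: unliftP => [j' ->|->] //; rewrite ffunE.
Qed.

(** [D k] stands for the derivative along the [k]-th frame vector, and the columns of [A] fill the
    Clifford slots: the two kinds of slots can thus be rotated separately. *)
Definition tensor_norm r (A : 'M[R]_n) (D : 'I_n -> 'cV[R]_N) (v : 'cV[R]_N) : R :=
  \sum_k \sum_(g : {ffun 'I_r -> 'I_n})
    (dot (D k) ((\big[mulmx/1%:M]_(j < r) c (col (g j) A)) *m v)) ^+ 2.

Lemma sum_sqr_orthogonal (A : 'M[R]_n) (x : 'I_n -> R) : A *m A^T = 1%:M ->
  \sum_k (\sum_l A l k * x l) ^+ 2 = \sum_l x l ^+ 2.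
Proof.
move=> AA; pose X : 'cV[R]_n := \col_l x l.
have E (Y : 'cV[R]_n) : \sum_l Y l 0 ^+ 2 = dot Y Y by apply: eq_bigr => l _; rewrite expr2.
transitivity (dot (A^T *m X) (A^T *m X)).
  by rewrite -E; apply: eq_bigr => k _; rewrite mxE; congr (_ ^+ 2); apply: eq_bigr => l _; rewrite !mxE.
by rewrite dot_mulmx trmxK mulmxA AA mul1mx -E; apply: eq_bigr => l _; rewrite mxE.
Qed.

Lemma col1mx (l : 'I_n) : col l 1%:M = delta_mx l 0 :> 'cV[R]_n.
Proof. by apply/matrixP => a b; rewrite !mxE (ord1 b) andbT. Qed.

(** By skewness the first Clifford factor moves to the other side of the scalar product and is
    absorbed into [w]. The remaining slots are rotated by induction, the freed one by orthogonality
    of [A]. *)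
Lemma tensor_norm_frame r (A : 'M[R]_n) D v : A *m A^T = 1%:M ->
  tensor_norm r A D v = tensor_norm r 1%:M D v.
Proof.
move=> AA; apply: eq_bigr => k _; move: (D k) => w.
elim: r w => [|r IH] w; first by apply: eq_bigr => g _; rewrite !big_ord0.
have step B : \sum_(g : {ffun 'I_r.+1 -> 'I_n})
    dot w ((\big[mulmx/1%:M]_(j < r.+1) c (col (g j) B)) *m v) ^+ 2 =
  \sum_l \sum_(g : {ffun 'I_r -> 'I_n})
    dot (- (c (col l B) *m w)) ((\big[mulmx/1%:M]_(j < r) c (col (g j) B)) *m v) ^+ 2.
  rewrite sum_ffun_recl; apply: eq_bigr => l _; apply: eq_bigr => g _.
  rewrite big_ord_recl ffunE unlift_none -mulmxA; congr (_ ^+ 2).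
  rewrite -mulNmx -cskew -dot_mulmx; congr (dot _ (_ *m (_ *m v))).
  by apply: eq_bigr => j _; rewrite ffunE liftK.
rewrite !step; under eq_bigr do rewrite IH.
rewrite exchange_big [RHS]exchange_big; apply: eq_bigr => g _ /=.
pose u := (\big[mulmx/1%:M]_(j < r) c (col (g j) 1%:M)) *m v; rewrite -/u.
transitivity (\sum_l (\sum_m A m l * dot (- (gam c m *m w)) u) ^+ 2).
  apply: eq_bigr => l _; congr (_ ^+ 2).
  rewrite clifford_coord mulmx_suml -sumrN /dot.
  under [RHS]eq_bigr do rewrite mulr_sumr.
  rewrite exchange_big; apply: eq_bigr => q _ /=.
  rewrite summxE mulr_suml; apply: eq_bigr => m _.
  by rewrite -scalemxAl !mxE; ring.
rewrite (sum_sqr_orthogonal _ AA); apply: eq_bigr => l _.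
by rewrite /gam -col1mx.
Qed.


Lemma spin_set_orthogonal K : spin_set c K -> K^T *m K = 1%:M.
Proof.
move=> [s [_ s1 ->]]; elim: s s1 => [|u s IH] s1.
  by rewrite big_nil trmx1 mulmx1.
rewrite big_cons trmx_mul -mulmxA [(c u)^T *m _]mulmxA cskew mulNmx csq.
rewrite s1 ?mem_head// raddfN opprK mul1mx; apply: IH => w ws.
by apply: s1; rewrite in_cons ws orbT.
Qed.

Lemma spin_conj_prod (K : 'M[R]_N) (A : 'M[R]_n) r (u : 'I_r -> 'cV[R]_n) :
  (forall x, K *m c x = c (A *m x) *m K) ->
  K *m (\big[mulmx/1%:M]_(j < r) c (u j)) = (\big[mulmx/1%:M]_(j < r) c (A *m u j)) *m K.
Proof.
move=> Kc; elim: r u => [|r IH] u; first by rewrite !big_ord0 mulmx1 mul1mx.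
by rewrite !big_ord_recl mulmxA Kc -mulmxA IH mulmxA.
Qed.

(** Intertwining with [K] rotates all Clifford slots by [A], which [tensor_norm_frame] undoes; in
    the derivative slot [A] acts on a sum of squares. *)
Lemma tensor_norm_rotate r (K : 'M[R]_N) (A : 'M[R]_n) D D' v v' :
  K^T *m K = 1%:M -> (forall x, K *m c x = c (A *m x) *m K) -> A *m A^T = 1%:M ->
  (forall k, K *m D' k = \sum_l A l k *: D l) -> K *m v' = v ->
  tensor_norm r 1%:M D' v' = tensor_norm r 1%:M D v.
Proof.
move=> KK Kc AA KD <-; rewrite -(tensor_norm_frame r D (K *m v') AA) /tensor_norm.
rewrite exchange_big [RHS]exchange_big; apply: eq_bigr => g _ /=.
rewrite -[RHS](sum_sqr_orthogonal _ AA); apply: eq_bigr => k _; congr (_ ^+ 2).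
have dotK u w : dot (K *m u) (K *m w) = dot u w by rewrite dot_mulmx mulmxA KK mul1mx.
rewrite -dotK KD [K *m (_ *m v')]mulmxA (spin_conj_prod _ Kc) -mulmxA.
under [X in dot _ (X *m _)]eq_bigr do rewrite col1mx -colE.
rewrite /dot; under [RHS]eq_bigr do rewrite mulr_sumr.
rewrite [RHS]exchange_big; apply: eq_bigr => q _ /=.
rewrite summxE mulr_suml; apply: eq_bigr => m _; by rewrite mxE mulrA.
Qed.

Context {M : oriented_manifold R n} {G : topGroupType} {proj : G -> 'M[R]_n}
  {P : spin_structure M proj}.
Implicit Types (s : univ_section N P) (i : om_idx M) (e : M -> P).

Definition frame_nabla s i e x (k : 'I_n) : 'cV[R]_N :=
  \sum_a ss_frame i (e (om_inv i x)) a k *: spin_nabla c s i e a x.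

Lemma T_sqnormE s i e r x : ss_frame i (e (om_inv i x)) \in unitmx ->
  T_sqnorm c s i e r x =
  tensor_norm r 1%:M (frame_nabla s i e x) (us_spinor s (e (om_inv i x))).
Proof.
move=> uE; rewrite /T_sqnorm sum_ffun_recl; apply: eq_bigr => k _; apply: eq_bigr => g _.
refine (congr1 (fun z => z ^+ 2) (congr2 dot _ (congr1 (fun Y => Y *m _) _))).
  by apply: eq_bigr => a _; rewrite mxE ffunE unlift_none.
apply: eq_bigr => j _; rewrite ffunE liftK; congr (c _).
by rewrite !colE mulmxA mulVmx.
Qed.

End TensorNorm.

Lemma within_continuous_at {T U : topologicalType} (A : set T) (f : T -> U) x :
  open A -> {within A, continuous f} -> A x -> {for x, continuous f}.
Proof. by move=> oA; rewrite continuous_open_subspace// => cf Ax; apply: cf; exact: mem_set. Qed.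

Lemma continuous_at_within {T U : topologicalType} (A : set T) (f : T -> U) :
  open A -> (forall x, A x -> {for x, continuous f}) -> {within A, continuous f}.
Proof. by move=> oA cf; rewrite continuous_open_subspace// => x /set_mem; exact: cf. Qed.

Section SpinFrames.
Context {R : realType} {n N : nat} {M : oriented_manifold R n} {G : topGroupType}
  {proj : G -> 'M[R]_n} {P : spin_structure M proj}.
Implicit Types (s : univ_section N P) (i : om_idx M) (e : M -> P) (V : set M).

Lemma frame_orthonormal s i p : om_dom i (ss_base p) -> orthonormal_spin_frame s p ->
  (ss_frame i p)^T *m us_metric s i (om_chart i (ss_base p)) *m ss_frame i p = 1%:M.
Proof. by move=> ip; exact. Qed.

Lemma ss_frame_unit i (p : P) : om_dom i (ss_base p) -> ss_frame i p \in unitmx.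
Proof. by move=> ip; rewrite unitmxE unitfE gt_eqF// ss_frame_det. Qed.

Lemma local_frameE s i V e x : local_spin_frame s i V e -> om_cod i x -> V (om_inv i x) ->
  (ss_frame i (e (om_inv i x)))^T *m us_metric s i x *m ss_frame i (e (om_inv i x)) = 1%:M.
Proof.
move=> [_ _ /(_ (om_inv i x)) He _] ix Vx; have [bE oE] := He Vx.
have := @frame_orthonormal s i _ _ oE; rewrite bE om_invK// => -> //.
exact: om_inv_dom.
Qed.

Lemma local_frame_unit s i V e x : local_spin_frame s i V e -> om_cod i x -> V (om_inv i x) ->
  ss_frame i (e (om_inv i x)) \in unitmx.
Proof.
move=> [_ _ /(_ (om_inv i x)) He _] ix Vx; have [bE _] := He Vx.
by apply: ss_frame_unit; rewrite bE; exact: om_inv_dom.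
Qed.

Lemma local_spin_frameW s i V V' e : open V' -> V' `<=` V -> local_spin_frame s i V e ->
  local_spin_frame s i V' e.
Proof.
move=> oV' V'V [oV ce He sE]; split=> //.
- by apply: continuous_at_within => // y V'y; exact: (within_continuous_at oV ce (V'V _ V'y)).
- by move=> y /V'V; exact: He.
- by apply: smooth_on_sub sE => x [ix Vx]; split => //; exact: V'V.
Qed.

Hypothesis projM : forall a b, proj (a * b)%g = proj a *m proj b.
Hypothesis proj_det : forall a, 0 < \det (proj a).

Lemma proj_unit a : proj a \in unitmx.
Proof. by rewrite unitmxE unitfE gt_eqF. Qed.

Lemma proj1E : proj 1%g = 1%:M.
Proof.
have E := projM 1%g 1%g; rewrite mulg1 in E.
by rewrite -(mulmxV (proj_unit 1%g)) {2}E -mulmxA mulmxV ?proj_unit// mulmx1.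
Qed.

Lemma SOset1 : SOset (proj 1%g).
Proof. by rewrite proj1E; split; rewrite ?trmx1 ?mulmx1 ?det1. Qed.

Lemma local_spin_frame_act s i V e a : SOset (proj a) -> local_spin_frame s i V e ->
  local_spin_frame s i V (fun y => ss_act (e y) a).
Proof.
move=> [aa _] [oV ce He sE]; split; first exact: oV.
- apply: continuous_at_within => // y Vy.
  have cey := within_continuous_at oV ce Vy.
  apply: (@continuous_comp _ _ _ (fun y => (e y, a)) (fun pa : P * G => ss_act pa.1 pa.2)); last exact: ss_act_cont.
  by apply: cvg_pair => //; exact: cvg_cst.
- move=> y Vy; have [bE oE] := He y Vy; split; first by rewrite ss_base_act.
  move=> j jy; rewrite ss_base_act in jy *; rewrite ss_frame_act// trmx_mul.
  by rewrite !mulmxA -2!(mulmxA (proj a)^T) frame_orthonormal// mulmx1.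
- have oD : open [set x | om_cod i x /\ V (om_inv i x)] := open_chart_image oV.
  apply: (@smooth_on_eq _ _ _ _ (fun x => ss_frame i (e (om_inv i x)) *m proj a) _ oD).
    move=> x [ix Vx]; have [bE _] := He _ Vx.
    by rewrite ss_frame_act// bE; exact: om_inv_dom.
  exact: (smooth_on_mulmx oD sE (@smooth_on_cst _ _ _ _ (proj a))).
Qed.

Lemma local_spin_frame_chart s i j V e : local_spin_frame s j V e ->
  local_spin_frame s i (V `&` om_dom i `&` om_dom j) e.
Proof.
move=> fe; have [oV ce He sE] := fe.
have oV' : open (V `&` om_dom i `&` om_dom j) by apply: openI; [apply: openI => //|]; exact: om_dom_open.
have [_ ce' _ _] := local_spin_frameW oV' (fun y Vy => Vy.1.1) fe.
split; [exact: oV'|exact: ce'|by move=> y [[Vy _] _]; exact: He|].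
pose U : set 'cV[R]_n := [set x | om_cod j x /\ (V `&` om_dom i `&` om_dom j) (om_inv j x)].
pose D : set 'cV[R]_n := [set x | om_cod i x /\ (V `&` om_dom i `&` om_dom j) (om_inv i x)].
have oD : open D := open_chart_image oV'.
have oU : open U := open_chart_image oV'.
pose phi x := om_chart j (om_inv i x).
have sphi : smooth_on D phi.
  by apply: (smooth_on_sub _ (@om_trans_smooth _ _ M i j)) => x [ix [_ jx]].
have DU x : D x -> U (phi x).
  move=> [ix [[Vx ix'] jx]]; split; first exact: om_chart_cod.
  by rewrite /phi om_chartK.
pose E z := trans_jac j i z *m ss_frame j (e (om_inv j z)).
have sE' : smooth_on U E.
  apply: (smooth_on_mulmx oU); last by apply: (smooth_on_sub _ sE) => z [jz [[Vz _] _]].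
  apply: (smooth_jacobian oU).
  by apply: (smooth_on_sub _ (@om_trans_smooth _ _ M j i)) => z [jz [[_ iz] _]].
apply: (@smooth_on_eq _ _ _ _ (fun x => E (phi x)) _ oD).
  move=> x [ix [[Vx ix'] jx]]; have [bE _] := He _ Vx.
  rewrite /E /phi om_chartK//.
  by rewrite (ss_frame_trans (i := j) (j := i)) bE.
exact: (smooth_on_comp oD oU sphi DU sE').
Qed.

End SpinFrames.

Section SpinLiftConjugation.
Context {R : realType} {n N : nat} (c : {linear 'cV[R]_n -> 'M[R]_N}).

Lemma spin_liftE (B : 'M[R]_n) : spin_lift c B = 4^-1 *: \sum_k gam c k *m c (col k B).
Proof.
congr (_ *: _); apply: eq_bigr => k _; rewrite clifford_coord mulmx_sumr.
by apply: eq_bigr => l _; rewrite -scalemxAr mxE.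
Qed.

(** The lift is a sum over an orthonormal basis of [e_k] times [B e_k], hence takes the same value
    in the basis rotated by [A]. *)
Lemma spin_lift_conj (K : 'M[R]_N) (A B : 'M[R]_n) : A *m A^T = 1%:M ->
  (forall x, K *m c x = c (A *m x) *m K) ->
  K *m spin_lift c (A^T *m B *m A) = spin_lift c B *m K.
Proof.
move=> AA Kc; rewrite !spin_liftE -scalemxAl -scalemxAr; congr (_ *: _).
rewrite mulmx_sumr mulmx_suml.
transitivity (\sum_k (c (A *m delta_mx k 0) *m c (B *m A *m delta_mx k 0)) *m K).
  apply: eq_bigr => k _; rewrite /gam mulmxA Kc -[_ *m K *m _]mulmxA Kc mulmxA colE !mulmxA; congr (_ *m c _ *m _).
  by rewrite AA mul1mx.
rewrite -!mulmx_suml; congr (_ *m K).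
transitivity (\sum_k \sum_m A m k *: (gam c m *m c (B *m A *m delta_mx k 0))).
  apply: eq_bigr => k _; rewrite {1}clifford_coord mulmx_suml; apply: eq_bigr => m _.
  by rewrite -scalemxAl -colE mxE.
rewrite exchange_big; apply: eq_bigr => m _ /=.
transitivity (gam c m *m c (\sum_k A m k *: (B *m A *m delta_mx k 0))).
  rewrite linear_sum mulmx_sumr; apply: eq_bigr => k _.
  by rewrite linearZ -scalemxAr.
congr (_ *m c _); rewrite colE.
transitivity (B *m A *m A^T *m delta_mx m (0 : 'I_1)); last by rewrite -(mulmxA B) AA mulmx1.
rewrite -(mulmxA (B *m A)) -colE [col m _]matrix_sum_delta mulmx_sumr; apply: eq_bigr => k _.
by rewrite big_ord1 -scalemxAr !mxE.
Qed.

Lemma spin_liftD (A B : 'M[R]_n) : spin_lift c (A + B) = spin_lift c A + spin_lift c B.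
Proof.
rewrite !spin_liftE -scalerDr -big_split; congr (_ *: _); apply: eq_bigr => k _ /=.
by rewrite linearD linearD mulmxDr.
Qed.

Lemma spin_liftZ a (A : 'M[R]_n) : spin_lift c (a *: A) = a *: spin_lift c A.
Proof.
rewrite !spin_liftE scalerA [a * _]mulrC -scalerA; congr (_ *: _); rewrite scaler_sumr; apply: eq_bigr => k _ /=.
by rewrite [col k (a *: A)]linearZ/= [c (_ *: _)]linearZ -scalemxAr.
Qed.

End SpinLiftConjugation.

Lemma pderiv_mulmx_cst {R : realType} {d p q r} (F : 'cV[R]_d -> 'M[R]_(p, q)) (B : 'M[R]_(q, r)) k x :
  derivable F x (delta_mx k 0) -> pderiv k (fun y => F y *m B) x = pderiv k F x *m B.
Proof.
move=> dF; apply: etrans (pderiv_mulmx dF (derivable_cst B x (delta_mx k 0))) _.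
by rewrite [X in _ + _ *m X](derive_cst B) mulmx0 addr0.
Qed.

Lemma pderiv_cst_mulmx {R : realType} {d p q r} (A : 'M[R]_(p, q)) (F : 'cV[R]_d -> 'M[R]_(q, r)) k x :
  derivable F x (delta_mx k 0) -> pderiv k (fun y => A *m F y) x = A *m pderiv k F x.
Proof.
move=> dF; apply: etrans (pderiv_mulmx (derivable_cst A x (delta_mx k 0)) dF) _.
by rewrite [X in X *m _ + _](derive_cst A) mul0mx add0r.
Qed.

Lemma sum_scale_mulmx {R : realType} {p q r m} (f : 'I_m -> R) (A : 'M[R]_(p, q)) (K : 'I_m -> 'M[R]_(q, r)) :
  \sum_b f b *: (A *m K b) = A *m (\sum_b f b *: K b).
Proof. by rewrite mulmx_sumr; apply: eq_bigr => b _; rewrite scalemxAr. Qed.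

Lemma sum_scale_mulmx2 {R : realType} {p q r t m} (f : 'I_m -> R) (A : 'M[R]_(p, q))
    (K : 'I_m -> 'M[R]_(q, r)) (B : 'M[R]_(r, t)) :
  \sum_b f b *: (A *m K b *m B) = A *m (\sum_b f b *: K b) *m B.
Proof.
under eq_bigr do rewrite -mulmxA; rewrite sum_scale_mulmx -mulmxA mulmx_suml; congr (_ *m _).
by apply: eq_bigr => b _; rewrite scalemxAl.
Qed.

(** * Independence of the density from spin frame and chart *)

Section FrameIndependence.
Context {R : realType} {n N : nat} {M : oriented_manifold R n} {G : topGroupType}
  {proj : G -> 'M[R]_n} (c : {linear 'cV[R]_n -> 'M[R]_N}) (kappa : G -> 'M[R]_N)
  {P : spin_structure M proj}.
Local Notation H := [set a | SOset (proj a)].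
Hypothesis projM : forall a b, proj (a * b)%g = proj a *m proj b.
Hypothesis proj_det : forall a, 0 < \det (proj a).
Hypothesis csq : forall x, c x *m c x = (- dot x x)%:M.
Hypothesis cskew : forall x, (c x)^T = - c x.
Hypothesis kspin : forall a, H a -> spin_set c (kappa a).
Hypothesis kcont : {within H, continuous kappa}.
Hypothesis kM : forall a b, H a -> H b -> kappa (a * b)%g = kappa a *m kappa b.
Hypothesis kc : forall a x, H a -> kappa a *m c x = c (proj a *m x) *m kappa a.

Variables (s : univ_section N P).
Hypothesis hs : S1 kappa s.
Implicit Types (i : om_idx M) (e : M -> P) (V : set M).

Lemma metric_smooth i : smooth_on (om_cod i) (us_metric s i).
Proof.
have [_ [sm _]] := hs; have := smooth_on_time_slice (t := 0) (sm i).
rewrite (_ : (fun x => _) = us_metric s i); last first.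
  by apply/funext => x; rewrite space_time_slice.
by apply: smooth_on_sub => x ix; rewrite /= space_time_slice.
Qed.

Lemma metric_posdef i x : om_cod i x -> posdef (us_metric s i x).
Proof. by have [/(_ 0) [[sy pd _] _] _] := hs; move=> ix; split; [exact: sy|exact: pd]. Qed.

Lemma metric_trans i j x : om_cod i x -> om_dom j (om_inv i x) ->
  us_metric s i x = (trans_jac i j x)^T *m us_metric s j (om_chart j (om_inv i x)) *m trans_jac i j x.
Proof. by have [/(_ 0) [[_ _ tr] _] _] := hs; exact: tr. Qed.

(** The local frame is viewed as a time-independent test family over the product of [R] and [V],
    because the smoothness of [s] is that of a constant curve. *)
Lemma spinor_smooth i V e : local_spin_frame s i V e ->
  smooth_on (chart_image i V) (fun x => us_spinor s (e (om_inv i x))).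
Proof.
move=> [oV ce He sE]; have [_ [_ ss]] := hs.
have oW : open [set w : R * M | V w.2] by apply: open_comp => // w _; exact: cvg_snd.
have sU : smooth_on [set z : 'cV[R]_(1 + n) | om_cod i (space z) /\ V (om_inv i (space z))]
    (fun z => us_spinor s (e (om_inv i (space z)))).
  apply: (ss i [set w | V w.2] (fun=> e) oW).
  - apply: continuous_at_within => // -[t y] /= Vy.
    by apply: continuous_comp; [exact: cvg_snd|exact: (within_continuous_at oV ce Vy)].
  - by move=> t y /= Vy; exact: He.
  - apply: (smooth_on_sub _ (smooth_on_space sE)) => z [iz Vz]; exact: conj iz Vz.
have := smooth_on_time_slice (t := 0) sU.
rewrite (_ : (fun x => _) = (fun x => us_spinor s (e (om_inv i x)))); last first.
  by apply/funext => x; rewrite space_time_slice.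
by apply: smooth_on_sub => x [ix Vx]; rewrite /= space_time_slice.
Qed.

Lemma spinor_unit p : orthonormal_spin_frame s p -> dot (us_spinor s p) (us_spinor s p) = 1.
Proof. by have [/(_ 0) [_ [_ u1]] _] := hs; exact: u1. Qed.

Lemma spinor_act p a : orthonormal_spin_frame s p -> H a ->
  kappa a *m us_spinor s (ss_act p a) = us_spinor s p.
Proof. by have [/(_ 0) [_ [eq _]] _] := hs; exact: eq. Qed.

Lemma spin_nablaE i e a x : spin_nabla c s i e a x =
  pderiv a (fun x => us_spinor s (e (om_inv i x))) x +
  spin_lift c (connection_form s i e a x) *m us_spinor s (e (om_inv i x)).
Proof.
rewrite /spin_nabla /spin_lift -scalemxAl mulmx_suml; congr (_ + _ *: _).
apply: eq_bigr => k _; rewrite mulmx_suml; apply: eq_bigr => l _.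
by rewrite -scalemxAl.
Qed.

(** A constant change of frame contributes no derivative: the connection form is conjugated by
    [proj a], its lift by [kappa a], and what remains is the rotation of the vector in the
    derivative slot. *)
Lemma frame_nabla_act i V e a x k : H a -> local_spin_frame s i V e ->
  om_cod i x -> V (om_inv i x) ->
  kappa a *m frame_nabla c s i (fun y => ss_act (e y) a) x k =
  \sum_l proj a l k *: frame_nabla c s i e x l.
Proof.
move=> Ha fe ix Vx; have [oV ce He sE] := fe.
have fe' := local_spin_frame_act Ha fe.
have [aa _] := Ha; have aa' := mulmx1C aa.
have oD : open (chart_image i V) := open_chart_image oV.
have Dx : chart_image i V x by [].
have EA y : chart_image i V y -> ss_frame i (ss_act (e (om_inv i y)) a) = ss_frame i (e (om_inv i y)) *m proj a.
  by move=> [iy Vy]; rewrite ss_frame_act// (He _ Vy).1; exact: om_inv_dom.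
have dE b := smooth_on_derivable (k := b) sE Dx.
have pE b : pderiv b (fun y => ss_frame i (ss_act (e (om_inv i y)) a)) x =
    pderiv b (fun y => ss_frame i (e (om_inv i y))) x *m proj a.
  refine (etrans (pderiv_eq_on b oD EA Dx) _).
  exact: pderiv_mulmx_cst.
have nE b : kappa a *m spin_nabla c s i (fun y => ss_act (e y) a) b x = spin_nabla c s i e b x.
  rewrite !spin_nablaE mulmxDr; congr (_ + _).
    have vE y : chart_image i V y -> us_spinor s (e (om_inv i y)) =
        kappa a *m us_spinor s (ss_act (e (om_inv i y)) a).
      by move=> [_ Vy]; rewrite spinor_act//; exact: (He _ Vy).2.
    refine (esym (etrans (pderiv_eq_on b oD vE Dx) _)).
    have dv := smooth_on_derivable (k := b) (spinor_smooth fe') Dx.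
    exact: pderiv_cst_mulmx.
  rewrite mulmxA.
  have -> : connection_form s i (fun y => ss_act (e y) a) b x =
      (proj a)^T *m connection_form s i e b x *m proj a.
    rewrite /connection_form pE (EA x Dx) trmx_mul !mulmxDr mulmxDl.
    by rewrite !mulmxA.
  by rewrite (spin_lift_conj _ aa' (fun x => kc x Ha)) -mulmxA spinor_act//; exact: (He _ Vx).2.
rewrite /frame_nabla mulmx_sumr.
under eq_bigr do rewrite -scalemxAr nE (EA x Dx) mxE scaler_suml.
rewrite exchange_big; apply: eq_bigr => l _ /=; rewrite scaler_sumr.
by apply: eq_bigr => b _; rewrite scalerA mulrC.
Qed.


Lemma near_line {d} (D : set 'cV[R]_d) (x w : 'cV[R]_d) : open D -> D x ->
  \forall h \near (0 : R)^', D (h *: w + x).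
Proof.
move=> oD Dx; apply: nbhs_dnbhs.
have : (fun h : R => h *: w + x) @ (0 : R) --> (0 : R) *: w + x.
  by apply: cvgD; [apply: cvgZr_tmp; exact: cvg_id|exact: cvg_cst].
by rewrite scale0r add0r => Hc; exact: (Hc _ (near_open oD Dx)).
Qed.

Lemma kappa1 : kappa 1%g = 1%:M.
Proof.
have H1 : H 1%g := SOset1 projM proj_det.
have E := kM H1 H1; rewrite mulg1 in E.
have KK := spin_set_orthogonal csq cskew (kspin H1).
by rewrite -KK {3}E mulmxA KK mul1mx.
Qed.

Lemma orthonormal_act_SO i p a : om_dom i (ss_base p) -> orthonormal_spin_frame s p ->
  orthonormal_spin_frame s (ss_act p a) -> H a.
Proof.
move=> ip op opa.
have := @frame_orthonormal _ _ _ _ _ _ _ s i _ _ opa; rewrite ss_base_act => /(_ ip).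
rewrite ss_frame_act// trmx_mul !mulmxA -2!(mulmxA (proj a)^T) frame_orthonormal//.
rewrite mulmx1 => AA; split=> //.
have := congr1 determinant AA; rewrite det_mulmx det_tr det1 -expr2 => /eqP.
by rewrite sqrf_eq1 => /orP[/eqP //|/eqP dA]; have := proj_det a; rewrite dA ltr0N1.
Qed.

(** The transition is read off in a local trivialisation. It is merely continuous, [G] carrying no
    smooth structure, so its lift is only known to tend to 1 where the frames agree. *)
Lemma frame_transition i V e e' : local_spin_frame s i V e -> local_spin_frame s i V e' ->
  forall y0, V y0 -> e y0 = e' y0 -> om_dom i y0 ->
  exists (W : set M) (a : M -> G), [/\ open W, W y0, W `<=` V `&` om_dom i,
    forall y, W y -> H (a y) /\ e' y = ss_act (e y) (a y) &
    kappa (a y) @[y --> y0] --> (1%:M : 'M[R]_N)].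
Proof.
move=> fe fe' y0 Vy0 ee' iy0; have [oV ce He _] := fe; have [_ ce' He' _] := fe'.
have [V0 [oV0 V0y0 [sigma [tau [_ _ ctau st]]]]] := ss_loc_triv P y0.
pose a y := ((tau (e y))^-1 * tau (e' y))%g.
have oW : open (V `&` V0 `&` om_dom i).
  by apply: openI; [exact: openI|exact: om_dom_open].
have aE y : (V `&` V0 `&` om_dom i) y -> e' y = ss_act (e y) (a y).
  move=> [[Vy V0y] _]; have [be _] := He _ Vy; have [be' _] := He' _ Vy.
  rewrite [e y in RHS]st ?be// -ss_actM mulgA mulgV mul1g.
  by rewrite [LHS]st ?be'.
have Ha y : (V `&` V0 `&` om_dom i) y -> H (a y).
  move=> Wy; have [[Vy V0y] iy] := Wy; have [be oe] := He _ Vy; have [be' oe'] := He' _ Vy.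
  by apply: orthonormal_act_SO oe _; [rewrite be; exact: iy|rewrite -(aE y Wy)].
exists (V `&` V0 `&` om_dom i), a; split=> //; first by move=> y [[]].
  by move=> y Wy; split; [exact: Ha|exact: aE].
have ctau' p : V0 (ss_base p) -> {for p, continuous tau}.
  move=> V0p; apply: within_continuous_at ctau V0p; apply: open_comp => // q _; exact: ss_base_cont.
have [be _] := He _ Vy0; have [be' _] := He' _ Vy0.
have c1 : {for y0, continuous (fun y => tau (e y))}.
  apply: continuous_comp; first exact: within_continuous_at oV ce Vy0.
  by apply: ctau'; rewrite be.
have c2 : {for y0, continuous (fun y => tau (e' y))}.
  apply: continuous_comp; first exact: within_continuous_at oV ce' Vy0.
  by apply: ctau'; rewrite be'.
have ca : {for y0, continuous a}.
  apply: (@continuous_comp _ _ _ (fun y => ((tau (e y))^-1%g, tau (e' y))) (fun ab : G * G => (ab.1 * ab.2)%g)).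
    apply: cvg_pair => //; apply: (@continuous_comp _ _ _ (fun y => tau (e y)) (fun a : G => (a^-1)%g)) => //.
    exact: invg_cont.
  exact: mulg_cont.
have a1 : a y0 = 1%g by rewrite /a ee' mulVg.
have H1 : H 1%g := SOset1 projM proj_det.
have k1 : kappa @ within H (nbhs 1%g) --> (1%:M : 'M[R]_N).
  by rewrite -kappa1; have /subspace_continuousP := kcont; exact.
have ca1 : a y @[y --> y0] --> (1%g : G) by rewrite -a1; exact: ca.
apply: cvg_trans k1 => B /= HB; have HB' := ca1 _ HB.
have W0 : \forall y \near y0, (V `&` V0 `&` om_dom i) y by apply: near_open.
exact: (@filterS2 _ (nbhs y0) _ _ _ _ (fun y HBy Wy => HBy (Ha y Wy)) HB' W0).
Qed.

(* Where the frames agree their lifted transition [K] is the identity, and its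
   derivative there is the spin lift of the derivative of the transition matrix. *)
Lemma spin_nabla_frame i V e e' x b : local_spin_frame s i V e -> local_spin_frame s i V e' ->
  om_cod i x -> V (om_inv i x) -> e (om_inv i x) = e' (om_inv i x) ->
  spin_nabla c s i e b x = spin_nabla c s i e' b x.
Proof.
move=> fe fe' ix Vx ee'; have [oV ce He sE] := fe; have [_ ce' He' sE'] := fe'.
have iy0 := om_inv_dom ix.
have [W [a [oW Wx WV Wa ka]]] := frame_transition fe fe' Vx ee' iy0.
pose E y := ss_frame i (e (om_inv i y)); pose E' y := ss_frame i (e' (om_inv i y)).
pose A y := invmx (E y) *m E' y.
pose v y := us_spinor s (e (om_inv i y)); pose v' y := us_spinor s (e' (om_inv i y)).
pose D := chart_image i W; have oD : open D := open_chart_image oW.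
have Dx : D x by [].
have DV : D `<=` chart_image i V by move=> y [iy /WV[Vy _]].
have EE' : E x = E' x by rewrite /E ee'.
have uE y : D y -> E y \in unitmx.
  by move=> /DV[iy Vy]; exact: local_frame_unit fe iy Vy.
have aE y : D y -> proj (a (om_inv i y)) = A y.
  move=> Dy; have [iy Wy] := Dy; have [_ Vy] := DV _ Dy; have [Ha eE] := Wa _ Wy.
  rewrite /A /E' eE ss_frame_act ?(He _ Vy).1; last exact: om_inv_dom.
  by rewrite mulKmx// uE.
have sED : smooth_on D E := smooth_on_sub DV sE.
have sED' : smooth_on D E' := smooth_on_sub DV sE'.
have sA : smooth_on D A.
  apply: (smooth_on_mulmx oD); [apply: (smooth_on_invmx oD); [exact: uE|exact: sED]|exact: sED'].
have dE := smooth_on_derivable (k := b) sED Dx.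
have dA := smooth_on_derivable (k := b) sA Dx.
have dv := smooth_on_derivable (k := b) (smooth_on_sub DV (spinor_smooth fe)) Dx.
have dv' := smooth_on_derivable (k := b) (smooth_on_sub DV (spinor_smooth fe')) Dx.
have A1 : A x = 1%:M by rewrite /A EE' mulVmx// -EE' uE.
have pE' : pderiv b E' x = pderiv b E x + E x *m pderiv b A x.
  have EA y : D y -> E' y = E y *m A y by move=> Dy; rewrite mulKVmx// uE.
  refine (etrans (pderiv_eq_on b oD EA Dx) (etrans (pderiv_mulmx dE dA) _)).
  by rewrite A1 mulmx1.
have nearD : \forall h \near (0 : R)^', D (h *: delta_mx b 0 + x) := near_line (delta_mx b 0) oD Dx.
pose l (h : R) : 'cV[R]_n := h *: delta_mx b 0 + x.
have orth y : D y -> orthonormal_spin_frame s (e (om_inv i y)) /\ orthonormal_spin_frame s (e' (om_inv i y)).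
  by move=> /DV[iy Vy]; split; [exact: (He _ Vy).2|exact: (He' _ Vy).2].
have key : pderiv b v x = pderiv b v' x + spin_lift c (pderiv b A x) *m v x.
  apply: (spin_derivative csq cskew (A := fun h => A (l h)) (K := fun h => kappa (a (om_inv i (l h))))
    (v := fun h => v (l h)) (v' := fun h => v' (l h))).
  - by apply: filterS nearD => h [_ Wh]; apply: kspin; exact: (Wa _ Wh).1.
  - by apply: filterS nearD => h Dh u; rewrite -(aE _ Dh); apply: kc; exact: (Wa _ Dh.2).1.
  - by apply: filterS nearD => h Dh; rewrite -(aE _ Dh); exact: (Wa _ Dh.2).1.1.
  - apply: filterS nearD => h Dh; have [Ha eE] := Wa _ Dh.2.
    by rewrite /v /v' eE spinor_act//; exact: (orth _ Dh).1.
  - by apply: filterS nearD => h Dh; apply: spinor_unit; exact: (orth _ Dh).1.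
  - by apply: filterS nearD => h Dh; apply: spinor_unit; exact: (orth _ Dh).2.
  - by apply: spinor_unit; exact: (orth _ Dx).1.
  - apply: (@cvg_comp _ _ _ (fun h => om_inv i (l h)) (fun y => kappa (a y)) _ (nbhs (om_inv i x))) => //.
    have ci : {for x, continuous (om_inv i)}.
      exact: within_continuous_at (@om_cod_open _ _ M i) (@om_inv_cont _ _ M i) ix.
    apply: (cvg_comp l (om_inv i) _ ci).
    have : l h @[h --> (0 : R)] --> (0 : R) *: delta_mx b 0 + x.
      by apply: cvgD; [apply: cvgZr_tmp; exact: cvg_id|exact: cvg_cst].
    by rewrite scale0r add0r; apply: cvg_trans; apply: cvg_app; exact: nbhs_dnbhs.
  - by rewrite -A1; exact: dA.
  - exact: dv.
  - by rewrite /v ee'; exact: dv'.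
rewrite !spin_nablaE key -addrA; congr (_ + _).
rewrite -[us_spinor s (e' _)]/(v' x) -[us_spinor s (e _)]/(v x) (_ : v' x = v x); last by rewrite /v ee'.
rewrite -mulmxDl -spin_liftD; congr (spin_lift c _ *m _).
(* As [E' = E A] with [A x = 1], the connection form of [e'] is that of [e] plus [E^T g E] times the
   derivative of [A], and [E^T g E = 1]. The lift of this derivative is exactly the difference found
   in [key]. *)
have EgE : (E x)^T *m us_metric s i x *m E x = 1%:M := local_frameE fe ix Vx.
rewrite /connection_form -/(E x) -[ss_frame i (e' _)]/(E' x) -EE'.
rewrite -[pderiv b (fun y => ss_frame i (e' _)) x]/(pderiv b E' x) pE'.
rewrite -[pderiv b (fun y => ss_frame i (e _)) x]/(pderiv b E x).
move: (pderiv b E x) (pderiv b A x) (christoffel s i b x *m E x) => p q r.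
rewrite [p + _ + _]addrAC [RHS]mulmxDr [X in _ = _ + X]mulmxA EgE mul1mx; exact: addrC.
Qed.

Lemma frame_nabla_chart i j V e x k : local_spin_frame s i V e -> local_spin_frame s j V e ->
  V `<=` om_dom i `&` om_dom j -> om_cod i x -> V (om_inv i x) ->
  frame_nabla c s i e x k = frame_nabla c s j e (om_chart j (om_inv i x)) k.
Proof.
move=> fi fj Vij ix Vx; have [oV ce He sEi] := fi; have [_ _ _ sEj] := fj.
pose D := chart_image i V; have oD : open D := open_chart_image oV.
pose U := chart_image j V; have oU : open U := open_chart_image oV.
have Dx : D x by [].
pose phi y := om_chart j (om_inv i y); pose J := jacobian_mx phi.
have phiK y : D y -> om_inv j (phi y) = om_inv i y.
  by move=> [iy /Vij[_ jy]]; exact: om_chartK.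
have DU y : D y -> U (phi y).
  move=> Dy; have [iy Vy] := Dy; split; last by rewrite phiK.
  by apply: om_chart_cod; exact: (Vij _ Vy).2.
have sphi : smooth_on D phi.
  by apply: (smooth_on_sub _ (@om_trans_smooth _ _ M i j)) => y [iy /Vij[_ jy]].
pose Ei y := ss_frame i (e (om_inv i y)); pose Ej y := ss_frame j (e (om_inv j y)).
pose vi y := us_spinor s (e (om_inv i y)); pose vj y := us_spinor s (e (om_inv j y)).
have EJ y : D y -> Ej (phi y) = J y *m Ei y.
  move=> Dy; have [iy Vy] := Dy; rewrite /Ej phiK//.
  rewrite (@ss_frame_trans _ _ _ _ _ _ i j) ?(He _ Vy).1 ?om_invK//.
    exact: om_inv_dom.
  exact: (Vij _ Vy).2.
have sJ : smooth_on D J := smooth_jacobian oD sphi.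
have svj : smooth_on U vj := spinor_smooth fj.
have sEjU : smooth_on U Ej := sEj.
have dJ a := smooth_on_derivable (k := a) sJ Dx.
have dEi a := smooth_on_derivable (k := a) (sEi : smooth_on D Ei) Dx.
have pv a : pderiv a vi x = \sum_b J x b a *: pderiv b vj (phi x).
  refine (etrans (pderiv_eq_on a oD (g := fun y => vj (phi y)) _ Dx) (pderiv_comp_mx oD oU sphi DU a svj Dx)).
  by move=> y Dy; rewrite /vj phiK.
have pE a : \sum_b J x b a *: pderiv b Ej (phi x) = pderiv a J x *m Ei x + J x *m pderiv a Ei x.
  refine (etrans (esym (pderiv_comp_mx oD oU sphi DU a sEjU Dx)) _).
  exact: etrans (pderiv_eq_on a oD EJ Dx) (pderiv_mulmx (dJ a) (dEi a)).
have gE y : D y -> us_metric s i y = (J y)^T *m us_metric s j (phi y) *m J y.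
  by move=> [iy /Vij[_ jy]]; exact: metric_trans.
have jphi : om_cod j (phi x) := (DU _ Dx).1.
have UC y : U y -> om_cod j y by case.
have kz a := koszul_trans a oD oU sphi DU (smooth_on_sub UC (metric_smooth (i := j)))
  (fun y Uy => (metric_posdef (UC _ Uy)).1) gE Dx.
(* The derivative of [J] enters through the frame, as [Ej = J Ei], and through the inhomogeneous
   term of [koszul_trans]. The two contributions match, so the connection form transforms as a
   one-form. *)
have cE a : connection_form s i e a x = \sum_b J x b a *: connection_form s j e b (phi x).
  have CE k' z b : om_cod k' z -> connection_form s k' e b z =
      (ss_frame k' (e (om_inv k' z)))^T *m us_metric s k' z *m pderiv b (fun y => ss_frame k' (e (om_inv k' y))) z +
      (ss_frame k' (e (om_inv k' z)))^T *m koszul (us_metric s k') b z *m ss_frame k' (e (om_inv k' z)).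
    move=> kz'; rewrite /connection_form mulmxDr; congr (_ + _).
    by rewrite -(mulmx_christoffel _ (posdef_unit (metric_posdef kz'))) !mulmxA.
  rewrite (CE i x a ix) -/(Ei x) (kz a).
  under [RHS]eq_bigr do rewrite (CE j (phi x) _ jphi) -[ss_frame j _]/(Ej (phi x)) scalerDr.
  rewrite big_split /= sum_scale_mulmx sum_scale_mulmx2.
  rewrite -[X in _ = _ *m X + _]/(\sum_b J x b a *: pderiv b Ej (phi x)) pE (EJ x Dx) (gE x Dx).
  rewrite -[pderiv a (fun y => ss_frame i _) x]/(pderiv a Ei x) -/(J x).
  move: (\sum_b J x b a *: koszul _ _ _) (pderiv a J x) (pderiv a Ei x) (us_metric s j (phi x)) => KJ dJa dEa g.
  rewrite trmx_mul !mulmxDr !mulmxDl !mulmxA.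
  by rewrite addrA [X in X + _]addrC.
have nE a : spin_nabla c s i e a x = \sum_b J x b a *: spin_nabla c s j e b (phi x).
  rewrite spin_nablaE -[pderiv a (fun y => us_spinor s _) x]/(pderiv a vi x) pv cE.
  under [RHS]eq_bigr do rewrite spin_nablaE scalerDr.
  rewrite big_split /=; congr (_ + _).
  rewrite phiK// (big_morph _ (@spin_liftD _ _ _ c) (_ : spin_lift c 0 = 0)); last first.
    by rewrite -(scale0r 0) spin_liftZ scale0r.
  by rewrite mulmx_suml; apply: eq_bigr => b _; rewrite spin_liftZ -scalemxAl.
rewrite /frame_nabla -/(phi x) -[ss_frame j (e (om_inv j (phi x)))]/(Ej (phi x)) (EJ x Dx).
under eq_bigr do rewrite nE scaler_sumr.
rewrite exchange_big; apply: eq_bigr => b _ /=; rewrite mxE scaler_suml.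
by apply: eq_bigr => a _; rewrite scalerA mulrC.
Qed.

(** Three moves: into a common chart, by a constant rotation to a frame that agrees at [y] with the
    other one, and between frames agreeing at [y], which have the same covariant derivatives
    there. *)
Lemma T_sqnorm_indep r y i V e j V' e' : local_spin_frame s i V e -> local_spin_frame s j V' e' ->
  V y -> V' y -> om_dom i y -> om_dom j y ->
  T_sqnorm c s i e r (om_chart i y) = T_sqnorm c s j e' r (om_chart j y).
Proof.
move=> fe fe' Vy V'y iy jy.
have f1 := local_spin_frame_chart i fe'.
have [oV _ He _] := fe; have [oV1 _ _ _] := f1; have [_ _ He' _] := fe'.
set V1 := (X in local_spin_frame s i X e') in f1 oV1.
have V1y : V1 y by [].
have oV2 : open (V `&` V1) by exact: openI.
have V2V1 : V `&` V1 `<=` V1 by move=> z [].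
have fi := local_spin_frameW oV2 (@subIsetl _ V V1) fe.
have fi' := local_spin_frameW oV2 V2V1 f1.
have fj' : local_spin_frame s j (V `&` V1) e'.
  by apply: local_spin_frameW fe' => // z [_ [[]]].
pose x := om_chart i y; have xy : om_inv i x = y by rewrite /x om_chartK.
have ix : om_cod i x by exact: om_chart_cod.
have Vx : (V `&` V1) (om_inv i x) by rewrite xy.
have jx : om_cod j (om_chart j y) by exact: om_chart_cod.
have Vx' : (V `&` V1) (om_inv j (om_chart j y)) by rewrite om_chartK.
rewrite (T_sqnormE _ _ _ (local_frame_unit fi ix Vx)) (T_sqnormE _ _ _ (local_frame_unit fj' jx Vx')).
rewrite (om_chartK jy) xy.
have be := (He _ Vy).1; have be' := (He' _ V'y).1.
have [a aE] := ss_transitive (etrans be (esym be')).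
have Ha : H a.
  apply: (@orthonormal_act_SO i (e y)); [by rewrite be|exact: (He _ Vy).2|].
  by rewrite -aE; exact: (He' _ V'y).2.
have [aa _] := Ha; have aa' := mulmx1C aa.
rewrite -(@tensor_norm_rotate _ _ _ c cskew r (kappa a) (proj a) _ (frame_nabla c s i e' x) _ (us_spinor s (e' y))) //.
- congr (tensor_norm _ _ _ _ _); apply/funext => k.
  rewrite (frame_nabla_chart k fi' fj' _ ix Vx) ?xy// => z [_ [[_ iz] jz]].
  by split.
- have KK := spin_set_orthogonal csq cskew (kspin Ha); exact: KK.
- by move=> u; exact: kc.
- move=> k; rewrite -(frame_nabla_act k Ha fi ix Vx); congr (_ *m _).
  apply: eq_bigr => b _; rewrite xy aE; congr (_ *: _).
  apply: esym; apply: (spin_nabla_frame b (local_spin_frame_act Ha fi) fi' ix Vx).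
  by rewrite xy aE.
- by rewrite aE; apply: spinor_act => //; exact: (He _ Vy).2.
Qed.

(** By independence the set of local values is a singleton, so [xget] returns its element and not
    the default 0. *)
Lemma T_normsqE r y i V e : local_spin_frame s i V e -> V y -> om_dom i y ->
  T_normsq c r s y = T_sqnorm c s i e r (om_chart i y).
Proof.
move=> fe Vy iy; rewrite /T_normsq; set v := [set q | exists i V e, _].
have vE : v = [set T_sqnorm c s i e r (om_chart i y)].
  apply/seteqP; split => [q [j [V' [e' [fe' V'y jy ->]]]]|q ->] /=.
    exact: T_sqnorm_indep fe' fe V'y Vy jy iy.
  by exists i, V, e.
case: xgetP => [q _ /= vq|/(_ (T_sqnorm c s i e r (om_chart i y)))]; last by rewrite /= vE.
have : v q by rewrite vq.
by rewrite vE.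
Qed.

End FrameIndependence.

(** * Smooth families of orthonormal spin frames *)

Section SchurFrame.
Context {R : realType}.

(* Gram-Schmidt orthonormalisation of the canonical basis, starting from the last
   vector: [schur_frame g] is a lower triangular square root of the inverse of [g]. *)
Fixpoint schur_frame {n : nat} : 'M[R]_n -> 'M[R]_n :=
  match n with
  | 0 => fun g => g
  | m.+1 => fun g : 'M[R]_(1 + m) =>
      let s := (Num.sqrt (schur_scalar g))^-1 in
      block_mx s%:M 0 (- s *: schur_vec g) (schur_frame (drsubmx g))
  end.

Lemma schur_frameS m (g : 'M[R]_(1 + m)) : schur_frame g =
  block_mx (Num.sqrt (schur_scalar g))^-1%:M 0 (- (Num.sqrt (schur_scalar g))^-1 *: schur_vec g)
    (schur_frame (drsubmx g)).
Proof. by []. Qed.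

Lemma schur_frame_orthonormal n (g : 'M[R]_n) : posdef g ->
  (schur_frame g)^T *m g *m schur_frame g = 1%:M.
Proof.
elim: n g => [|m IH]; first by move=> g _; apply/matrixP => -[].
rewrite -[m.+1]/(1 + m)%N => g pg.
have pd := posdef_drsubmx pg; have ud := posdef_unit pd.
have s0 := schur_scalar_gt0 pg ud.
rewrite schur_frameS; set s := (Num.sqrt _)^-1.
have ss : s * s * schur_scalar g = 1.
  by rewrite /s -expr2 exprVn sqr_sqrtr ?ltW// mulVf// gt_eqF.
rewrite [X in _ *m X *m _](block_schur pg.1 ud) -!mulmxA mulmx_block !mulmx0 !mul0mx !add0r !addr0.
have -> : dlsubmx g *m s%:M + drsubmx g *m (- s *: schur_vec g) = 0.
  by rewrite mul_mx_scalar -scalemxAr /schur_vec mulmxA mulmxV// mul1mx scaleNr subrr.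
rewrite mulmxA tr_block_mx mulmx_block !mulmx1 !mulmx0 !addr0.
rewrite linearZ/= tr_scalar_mx mul_scalar_mx scaleNr subrr trmx0 mul0mx add0r.
rewrite mulmx_block !mulmx0 !mul0mx !add0r !addr0 (mulmxA _ (drsubmx g)) IH// -!scalar_mxM.
by rewrite [s * _]mulrC -mulrA mulrC ss -scalar_mx_block.
Qed.

Lemma schur_frame_det n (g : 'M[R]_n) : posdef g -> 0 < \det (schur_frame g).
Proof.
elim: n g => [|m IH]; first by move=> g _; rewrite det_mx00.
rewrite -[m.+1]/(1 + m)%N => g pg.
have pd := posdef_drsubmx pg; have ud := posdef_unit pd.
have s0 := schur_scalar_gt0 pg ud.
by rewrite schur_frameS det_lblock det_scalar1 mulr_gt0 ?IH// invr_gt0 sqrtr_gt0.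
Qed.

Lemma smooth_on_block {d p q r t} (U : set 'cV[R]_d) (A : 'cV[R]_d -> 'M[R]_(p, q)) (B : 'cV[R]_d -> 'M[R]_(p, r))
    (C : 'cV[R]_d -> 'M[R]_(t, q)) (D : 'cV[R]_d -> 'M[R]_(t, r)) : open U ->
  smooth_on U A -> smooth_on U B -> smooth_on U C -> smooth_on U D ->
  smooth_on U (fun x => block_mx (A x) (B x) (C x) (D x)).
Proof.
move=> oU /(smooth_on_mxP oU) sA /(smooth_on_mxP oU) sB /(smooth_on_mxP oU) sC /(smooth_on_mxP oU) sD.
apply/(smooth_on_mxP oU) => i j.
case: (fintype.splitP i) => a ia; case: (fintype.splitP j) => b jb.
- have -> : i = lshift t a by exact: val_inj.
  have -> : j = lshift r b by exact: val_inj.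
  by under eq_fun do rewrite block_mxEul; exact: sA.
- have -> : i = lshift t a by exact: val_inj.
  have -> : j = rshift q b by exact: val_inj.
  by under eq_fun do rewrite block_mxEur; exact: sB.
- have -> : i = rshift p a by exact: val_inj.
  have -> : j = lshift r b by exact: val_inj.
  by under eq_fun do rewrite block_mxEdl; exact: sC.
- have -> : i = rshift p a by exact: val_inj.
  have -> : j = rshift q b by exact: val_inj.
  by under eq_fun do rewrite block_mxEdr; exact: sD.
Qed.

Lemma smooth_on_mxsub {d p q p' q'} (U : set 'cV[R]_d) (A : 'cV[R]_d -> 'M[R]_(p, q))
    (B : 'cV[R]_d -> 'M[R]_(p', q')) (f : 'I_p' -> 'I_p) (h : 'I_q' -> 'I_q) : open U ->
  (forall x i j, B x i j = A x (f i) (h j)) -> smooth_on U A -> smooth_on U B.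
Proof.
move=> oU BE /(smooth_on_mxP oU) sA; apply/(smooth_on_mxP oU) => i j.
by rewrite (_ : (fun x => _) = (fun x => A x (f i) (h j))) //; apply/funext => x.
Qed.

Lemma smooth_on_schur_frame {d n} (U : set 'cV[R]_d) (g : 'cV[R]_d -> 'M[R]_n) : open U ->
  (forall x, U x -> posdef (g x)) -> smooth_on U g -> smooth_on U (fun x => schur_frame (g x)).
Proof.
move=> oU; elim: n g => [|m IH] g pg sg; first exact: sg.
have pgm x : U x -> posdef (g x : 'M[R]_(1 + m)) := pg x.
have pd x Ux := posdef_drsubmx (pgm x Ux); have ud x Ux := posdef_unit (pd x Ux).
have sD : smooth_on U (fun x => drsubmx (g x : 'M[R]_(1 + m))).
  by apply: (smooth_on_mxsub (f := @rshift 1 m) (h := @rshift 1 m) oU _ sg) => x i j; rewrite !mxE.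
have sB : smooth_on U (fun x => dlsubmx (g x : 'M[R]_(1 + m))).
  by apply: (smooth_on_mxsub (f := @rshift 1 m) (h := @lshift 1 m) oU _ sg) => x i j; rewrite !mxE.
have sw : smooth_on U (fun x => schur_vec (g x : 'M[R]_(1 + m))).
  by apply: (smooth_on_mulmx oU _ sB); exact: (smooth_on_invmx oU ud sD).
have ss : smooth_on U (fun x => schur_scalar (g x : 'M[R]_(1 + m))).
  apply: (smooth_on_add oU).
    by have /(smooth_on_mxP oU) := sg; exact.
  apply: (smooth_on_opp oU); apply: (smooth_on_sum oU) => k _; apply: (smooth_on_mul oU).
    by have /(smooth_on_mxP oU) := sB; exact.
  by have /(smooth_on_mxP oU) := sw; exact.
have s0 x : U x -> 0 < schur_scalar (g x : 'M[R]_(1 + m)).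
  by move=> Ux; exact: schur_scalar_gt0 (pgm x Ux) (ud x Ux).
have st : smooth_on U (fun x => (Num.sqrt (schur_scalar (g x : 'M[R]_(1 + m))))^-1).
  apply: (smooth_on_inv oU); last exact: (smooth_on_sqrt oU s0 ss).
  by move=> x Ux; rewrite gt_eqF// sqrtr_gt0 s0.
apply: (smooth_on_eq oU (fun x _ => esym (schur_frameS (g x)))); apply: (smooth_on_block oU).
- apply/(smooth_on_mxP oU) => i j; rewrite !(ord1 i, ord1 j).
  by rewrite (_ : (fun x => _) = (fun x => (Num.sqrt (schur_scalar (g x : 'M[R]_(1 + m))))^-1)) //;
    apply/funext => x; rewrite mxE eqxx mulr1n.
- exact: smooth_on_cst.
- by apply: (smooth_on_scalemx oU _ sw); exact: (smooth_on_opp oU st).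
- by apply: IH.
Qed.

End SchurFrame.

Section FrameFamilies.
Context {R : realType}.

Lemma cvg_bigsum {T : Type} {F : set_system T} {FF : Filter F} {I : Type} (r : seq I)
    (f : I -> T -> R) (l : I -> R) : (forall i, f i x @[x --> F] --> l i) ->
  (\sum_(i <- r) f i x) @[x --> F] --> \sum_(i <- r) l i.
Proof.
move=> fl; elim: r => [|i r IH].
  by under eq_fun do rewrite big_nil; rewrite big_nil; exact: cvg_cst.
by under eq_fun do rewrite big_cons; rewrite big_cons; exact: cvgD.
Qed.

Lemma cvg_bigprod {T : Type} {F : set_system T} {FF : Filter F} {I : Type} (r : seq I)
    (f : I -> T -> R) (l : I -> R) : (forall i, f i x @[x --> F] --> l i) ->
  (\prod_(i <- r) f i x) @[x --> F] --> \prod_(i <- r) l i.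
Proof.
move=> fl; elim: r => [|i r IH].
  by under eq_fun do rewrite big_nil; rewrite big_nil; exact: cvg_cst.
by under eq_fun do rewrite big_cons; rewrite big_cons; exact: cvgM.
Qed.

Lemma continuous_det {T : topologicalType} {p} (A : T -> 'M[R]_p) (x : T) :
  {for x, continuous A} -> {for x, continuous (fun y => \det (A y))}.
Proof.
move=> /continuous_mxP cA; apply: cvg_bigsum => s; apply: cvgM; first exact: cvg_cst.
by apply: cvg_bigprod => i; exact: cA.
Qed.

Lemma continuous_invmx {T : topologicalType} {p} (A : T -> 'M[R]_p) (x : T) :
  A x \in unitmx -> {for x, continuous A} -> {for x, continuous (fun y => invmx (A y))}.
Proof.
move=> uA cA; have cd := continuous_det cA.
have d0 : \det (A x) != 0 by rewrite -unitfE -unitmxE.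
have nd : \forall y \near x, (\det (A y))^-1 *: \adj (A y) = invmx (A y).
  have /= := cd _ (near_open (open_neq (y := 0 : R)) d0).
  by apply: (@filterS _ (nbhs x)) => y; rewrite /= /invmx unitmxE unitfE => ->.
apply: (near_continuous_at nd); apply/continuous_mxP => i j.
rewrite (_ : (fun y => _) = (fun y => (\det (A y))^-1 *
  ((-1) ^+ (j + i) * \det (row' j (col' i (A y)))))); last by apply/funext => y; rewrite !mxE.
apply: continuousM; first exact: continuousV.
apply: continuousM; first exact: cst_continuous.
apply: continuous_det; apply/continuous_mxP => a b.
rewrite (_ : (fun y => _) = (fun y => A y (lift j a) (lift i b))); last by apply/funext => y; rewrite !mxE.
by have /continuous_mxP := cA; exact.
Qed.

Lemma continuous_pair {T U V : topologicalType} (f : T -> U) (g : T -> V) (x : T) :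
  {for x, continuous f} -> {for x, continuous g} -> {for x, continuous (fun y => (f y, g y))}.
Proof. exact: cvg_pair. Qed.

Lemma continuous_time_slice2 {T : topologicalType} {n} (f : T -> R) (h : T -> 'cV[R]_n) (x : T) :
  {for x, continuous f} -> {for x, continuous h} ->
  {for x, continuous (fun y => time_slice (f y) (h y))}.
Proof.
move=> cf ch; apply/continuous_mxP => i j; case: (fintype.splitP i) => a ia.
  have -> : i = lshift n a by exact: val_inj.
  rewrite (_ : (fun y => _) = f)//.
  by apply/funext => y; rewrite /time_slice col_mxEu !(ord1 a, ord1 j) mxE eqxx mulr1n.
have -> : i = rshift 1 a by exact: val_inj.
rewrite (_ : (fun y => _) = (fun y => h y a j)); first by have /continuous_mxP := ch; exact.
by apply/funext => y; rewrite /time_slice col_mxEd.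
Qed.

Context {n N : nat} {M : oriented_manifold R n} {G : topGroupType}
  {proj : G -> 'M[R]_n} (kappa : G -> 'M[R]_N) {P : spin_structure M proj}.

Lemma orthonormal_in_chart (s : univ_section N P) i p : metric_tensor s -> om_dom i (ss_base p) ->
  (ss_frame i p)^T *m us_metric s i (om_chart i (ss_base p)) *m ss_frame i p = 1%:M ->
  orthonormal_spin_frame s p.
Proof.
move=> [_ _ tr] ip E j jp; rewrite (ss_frame_trans ip jp) -E.
rewrite (tr i j); [|exact: om_chart_cod|by rewrite om_chartK].
by rewrite om_chartK// trmx_mul !mulmxA.
Qed.

Lemma family_domain_open i (W : set (R * M)) : open W ->
  open [set z : 'cV[R]_(1 + n) | om_cod i (space z) /\ W (time z, om_inv i (space z))].
Proof.
move=> oW; pose f (z : 'cV[R]_(1 + n)) : R * M := (time z, om_inv i (space z)).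
have oC : open [set z : 'cV[R]_(1 + n) | om_cod i (space z)].
  by apply: open_comp; [move=> z _; exact: continuous_space|exact: om_cod_open].
apply: (@within_continuous_open _ _ _ f) => //; apply: continuous_at_within => // z iz.
apply: continuous_pair; first exact: continuous_time.
apply: (@continuous_comp _ _ _ (@space R n) (om_inv i)); first exact: continuous_space.
exact: within_continuous_at (@om_cod_open _ _ M i) (@om_inv_cont _ _ M i) iz.
Qed.

(** Packages the conditions under which [smooth_family] tests the spinors. *)
Record frame_family (gamma : R -> univ_section N P) i (W : set (R * M)) (e : R -> M -> P) : Prop := {
  ff_open : open W;
  ff_cont : {within W, continuous (fun w => e w.1 w.2)};
  ff_orth : forall t y, W (t, y) -> ss_base (e t y) = y /\ orthonormal_spin_frame (gamma t) (e t y);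
  ff_smooth : smooth_on [set z : 'cV[R]_(1 + n) | om_cod i (space z) /\ W (time z, om_inv i (space z))]
    (fun z => ss_frame i (e (time z) (om_inv i (space z)))) }.

Lemma local_frame_of_family gamma i W e t : frame_family gamma i W e ->
  local_spin_frame (gamma t) i [set y | W (t, y)] (e t).
Proof.
move=> [oW ce He sE].
have ct (y : M) : {for y, continuous (fun y : M => (t, y))}.
  by apply: continuous_pair; [exact: cst_continuous|exact: cvg_id].
have oWt : open [set y | W (t, y)] by apply: (@open_comp _ _ (fun y : M => (t, y))) => // y _; exact: ct.
split=> //.
- apply: continuous_at_within => // y Wy.
  apply: (@continuous_comp _ _ _ (fun y : M => (t, y)) (fun w : R * M => e w.1 w.2)); first exact: ct.
  exact: within_continuous_at oW ce Wy.
- by move=> y Wy; exact: He.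
- have := smooth_on_time_slice (t := t) sE.
  rewrite (_ : (fun x => _) = (fun x => ss_frame i (e t (om_inv i x)))); last first.
    by apply/funext => x; rewrite space_time_slice time_time_slice.
  by apply: smooth_on_sub => x [ix Wx]; rewrite /= space_time_slice time_time_slice.
Qed.

Hypothesis proj_cover : covering_map proj (@GLpos R n).

(** A local section [sigma] of the spin bundle has no reason to be orthonormal. The matrix [F] from
    its frame to the Gram-Schmidt frame of the metric at time [t] has positive determinant and
    lifts, near the base point, through one sheet of [proj]; acting on [sigma] by this lift gives
    the family. *)
Lemma frame_family_exists gamma (t0 : R) (y0 : M) : S1_curve kappa gamma ->
  exists i W e, [/\ frame_family gamma i W e, W (t0, y0) & forall t y, W (t, y) -> om_dom i y].
Proof.
move=> [gs [gsm _]].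
have [i iy0] := om_cover y0.
have [V0 [oV0 V0y0 [sigma [_ [csigma sb _ _]]]]] := ss_loc_triv P y0.
pose C : set 'cV[R]_(1 + n) := [set z | om_cod i (space z)].
pose Eg (z : 'cV[R]_(1 + n)) := schur_frame (us_metric (gamma (time z)) i (space z)).
have oC : open C.
  by apply: open_comp; [move=> z _; exact: continuous_space|exact: om_cod_open].
have pos t x : om_cod i x -> posdef (us_metric (gamma t) i x).
  by move=> ix; have [[sy pd _] _] := gs t; split; [exact: sy|exact: pd].
have sEg : smooth_on C Eg.
  by apply: (smooth_on_schur_frame oC _ (gsm i)) => z Cz; exact: pos.
pose z_of (w : R * M) := time_slice w.1 (om_chart i w.2).
pose F (w : R * M) := invmx (ss_frame i (sigma w.2)) *m Eg (z_of w).
pose W0 : set (R * M) := [set w | (V0 `&` om_dom i) w.2].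
have oW0 : open W0.
  apply: (@open_comp _ _ snd (V0 `&` om_dom i)); first by move=> w _; exact: cvg_snd.
  by apply: openI => //; exact: om_dom_open.
have usig y : (V0 `&` om_dom i) y -> ss_frame i (sigma y) \in unitmx.
  by move=> [V0y iy]; apply: ss_frame_unit; rewrite sb.
have csig y : V0 y -> {for y, continuous sigma}.
  by move=> V0y; exact: within_continuous_at oV0 csigma V0y.
have cF w : W0 w -> {for w, continuous F}.
  move=> [V0w iw]; apply: cvg_mulmx.
    apply: (@continuous_invmx _ _ (fun w : R * M => ss_frame i (sigma w.2))); first exact: usig.
    apply: (@continuous_comp _ _ _ snd (fun y => ss_frame i (sigma y))); first exact: cvg_snd.
    apply: (@continuous_comp _ _ _ sigma (ss_frame i)); first exact: csig.
    apply: (within_continuous_at _ (@ss_frame_cont _ _ _ _ _ P i)); last by rewrite /= sb.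
    by apply: open_comp; [move=> p _; exact: ss_base_cont|exact: om_dom_open].
  apply: (@continuous_comp _ _ _ z_of Eg); last first.
    by apply: (smooth_on_continuous sEg); rewrite /C /= space_time_slice; exact: om_chart_cod.
  apply: continuous_time_slice2; first exact: cvg_fst.
  apply: (@continuous_comp _ _ _ snd (om_chart i)); first exact: cvg_snd.
  exact: within_continuous_at (@om_dom_open _ _ M i) (@om_chart_cont _ _ M i) iw.
have EgE w : W0 w -> Eg (z_of w) = schur_frame (us_metric (gamma w.1) i (om_chart i w.2)).
  by move=> _; rewrite /Eg /z_of time_time_slice space_time_slice.
have W0y0 : W0 (t0, y0) by [].
have F0 : GLpos (F (t0, y0)).
  rewrite /GLpos /= /F EgE// det_mulmx det_inv mulr_gt0//.
    by rewrite invr_gt0 ss_frame_det// sb.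
  by apply: schur_frame_det; apply: pos; exact: om_chart_cod.
have [cproj rproj cov] := proj_cover.
have [V [oV VF VGL [D [sh [csh osh shK shU]]]]] := cov _ F0.
have [g0 _ g0E] : range proj (F (t0, y0)) by rewrite rproj.
have [d [dE _]] : exists! d, sh d (proj g0) = g0 by apply: shU; rewrite g0E.
pose b w := sh d (F w); pose e t y := ss_act (sigma y) (b (t, y)).
pose W := W0 `&` F @^-1` V.
have oW : open W.
  by apply: within_continuous_open => //; apply: continuous_at_within => // w; exact: cF.
have frE t y : W (t, y) -> ss_frame i (e t y) = schur_frame (us_metric (gamma t) i (om_chart i y)).
  move=> [W0w Vw]; have [V0y iy] := W0w.
  by rewrite /e ss_frame_act ?sb// /b shK// /F /= mulKVmx ?usig// EgE.
exists i, W, e; split; last by move=> t y [[]].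
  split=> //.
  - apply: continuous_at_within => // w [W0w Vw].
    apply: (@continuous_comp _ _ _ (fun w : R * M => (sigma w.2, b (w.1, w.2))) (fun pa : P * G => ss_act pa.1 pa.2)); last exact: ss_act_cont.
    apply: continuous_pair.
      by apply: (@continuous_comp _ _ _ snd sigma); [exact: cvg_snd|exact: csig W0w.1].
    rewrite (_ : (fun w : R * M => b (w.1, w.2)) = b); last by apply/funext => -[].
    apply: (@continuous_comp _ _ _ F (sh d)); first exact: cF.
    by case: w Vw {W0w} => t y Vw; exact: within_continuous_at oV (csh d) Vw.
  - move=> t y Wy; have [[V0y iy] Vy] := Wy.
    have be : ss_base (e t y) = y by rewrite /e ss_base_act sb.
    split=> //; apply: (@orthonormal_in_chart _ i); rewrite ?be//; first exact: (gs t).1.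
    rewrite frE//; apply: schur_frame_orthonormal; apply: pos; exact: om_chart_cod.
  - have oU := family_domain_open (i := i) oW.
    apply: (@smooth_on_eq _ _ _ _ Eg _ oU) => [z [iz Wz]|]; last first.
      by apply: (smooth_on_sub _ sEg) => z [iz _].
    by rewrite frE// om_invK.
by split => //=; rewrite /preimage /=.
Qed.

End FrameFamilies.

(** * Joint smoothness of the density in time and space *)

Section JointSmoothness.
Context {R : realType} {n N : nat} {M : oriented_manifold R n} {G : topGroupType}
  {proj : G -> 'M[R]_n} (c : {linear 'cV[R]_n -> 'M[R]_N}) (kappa : G -> 'M[R]_N)
  {P : spin_structure M proj}.

Lemma smooth_on_dot {d m} (U : set 'cV[R]_d) (u v : 'cV[R]_d -> 'cV[R]_m) : open U ->
  smooth_on U u -> smooth_on U v -> smooth_on U (fun x => dot (u x) (v x)).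
Proof.
move=> oU /(smooth_on_mxP oU) su /(smooth_on_mxP oU) sv.
by apply: (smooth_on_sum oU) => k _; apply: (smooth_on_mul oU).
Qed.

Lemma smooth_on_tensor_norm {d} (U : set 'cV[R]_d) r (D : 'cV[R]_d -> 'I_n -> 'cV[R]_N) v :
  open U -> (forall k, smooth_on U (fun z => D z k)) -> smooth_on U v ->
  smooth_on U (fun z => tensor_norm c r 1%:M (D z) (v z)).
Proof.
move=> oU sD sv; apply: (smooth_on_sum oU) => k _; apply: (smooth_on_sum oU) => g _.
apply: (smooth_on_exp oU); apply: (smooth_on_dot oU); first exact: sD.
by apply: (smooth_on_mulmx oU _ sv); exact: smooth_on_cst.
Qed.

Lemma smooth_on_spin_lift {d} (U : set 'cV[R]_d) (B : 'cV[R]_d -> 'M[R]_n) : open U ->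
  smooth_on U B -> smooth_on U (fun z => spin_lift c (B z)).
Proof.
move=> oU /(smooth_on_mxP oU) sB; apply: (smooth_on_scalemx oU); first exact: smooth_on_cst.
apply: (smooth_on_summx oU) => k _; apply: (smooth_on_summx oU) => l _.
by apply: (smooth_on_scalemx oU); [exact: sB|exact: smooth_on_cst].
Qed.

Lemma slice_pderiv {W : normedModType R} (f : R -> 'cV[R]_n -> W) k (z : 'cV[R]_(1 + n)) :
  pderiv k (f (time z)) (space z) = pderiv (rshift 1 k) (fun z => f (time z) (space z)) z.
Proof.
rewrite -[z in RHS]time_slice_eta -pderiv_time_slice; congr (pderiv k _ _).
by apply/funext => x; rewrite time_time_slice space_time_slice.
Qed.

Lemma christoffelE (s : univ_section N P) i a x :
  christoffel s i a x = invmx (us_metric s i x) *m koszul (us_metric s i) a x.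
Proof.
apply/matrixP => b k; rewrite !mxE mulr_sumr; apply: eq_bigr => l _.
by rewrite !mxE mulrCA.
Qed.

(** All the derivatives in the local expression are taken in space, and they are partial derivatives
    of functions smooth in [(t, x)]. The resulting joint continuity is what compactness later makes
    uniform. *)
Lemma T_sqnorm_joint_smooth (gamma : R -> univ_section N P) i (W : set (R * M)) e r : S1_curve kappa gamma -> frame_family gamma i W e ->
  smooth_on [set z : 'cV[R]_(1 + n) | om_cod i (space z) /\ W (time z, om_inv i (space z))]
    (fun z => T_sqnorm c (gamma (time z)) i (e (time z)) r (space z)).
Proof.
move=> [gs [gsm gss]] [oW ce He sE].
set U := [set z | _ /\ _]; have oU : open U := family_domain_open (i := i) oW.
pose E (z : 'cV[R]_(1 + n)) := ss_frame i (e (time z) (om_inv i (space z))).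
pose v (z : 'cV[R]_(1 + n)) := us_spinor (gamma (time z)) (e (time z) (om_inv i (space z))).
pose g (z : 'cV[R]_(1 + n)) := us_metric (gamma (time z)) i (space z).
have sv : smooth_on U v by exact: (gss i W e oW ce He sE).
have sg : smooth_on U g by apply: (smooth_on_sub _ (gsm i)) => z [iz _].
have uE z : U z -> E z \in unitmx.
  by move=> [iz Wz]; apply: ss_frame_unit; rewrite (He _ _ Wz).1; exact: om_inv_dom.
have ug z : U z -> g z \in unitmx.
  move=> [iz _]; apply: posdef_unit; have [[sy pd _] _] := gs (time z).
  by split; [exact: sy|exact: pd].
have sgab a k l : smooth_on U (fun z => pderiv (rshift 1 a) g z k l).
  by have /(smooth_on_mxP oU) := smooth_on_pderiv (rshift 1 a) sg; exact.
have sK a : smooth_on U (fun z => koszul (us_metric (gamma (time z)) i) a (space z)).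
  apply/(smooth_on_mxP oU) => l k.
  apply: (@smooth_on_eq _ _ _ _ (fun z => 2^-1 * (pderiv (rshift 1 a) g z l k +
    pderiv (rshift 1 k) g z l a - pderiv (rshift 1 l) g z a k)) _ oU).
    move=> z _; rewrite [RHS]mxE.
    by rewrite !(slice_pderiv (fun t => us_metric (gamma t) i)).
  apply: (smooth_on_mul oU); first exact: smooth_on_cst.
  apply: (smooth_on_add oU); first by apply: (smooth_on_add oU); exact: sgab.
  by apply: (smooth_on_opp oU); exact: sgab.
have sC a : smooth_on U (fun z => connection_form (gamma (time z)) i (e (time z)) a (space z)).
  apply: (@smooth_on_eq _ _ _ _ (fun z => (E z)^T *m g z *m (pderiv (rshift 1 a) E z +
    invmx (g z) *m koszul (us_metric (gamma (time z)) i) a (space z) *m E z)) _ oU).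
    move=> z _; rewrite /connection_form christoffelE.
    by rewrite (slice_pderiv (fun t x => ss_frame i (e t (om_inv i x)))).
  apply: (smooth_on_mulmx oU); first by apply: (smooth_on_mulmx oU _ sg); exact: (smooth_on_tr oU sE).
  apply: (smooth_on_addmx oU); first exact: smooth_on_pderiv sE.
  apply: (smooth_on_mulmx oU _ sE); apply: (smooth_on_mulmx oU _ (sK a)).
  exact: (smooth_on_invmx oU ug sg).
have sN a : smooth_on U (fun z => spin_nabla c (gamma (time z)) i (e (time z)) a (space z)).
  apply: (@smooth_on_eq _ _ _ _ (fun z => pderiv (rshift 1 a) v z +
    spin_lift c (connection_form (gamma (time z)) i (e (time z)) a (space z)) *m v z) _ oU).
    move=> z _; rewrite spin_nablaE.
    by rewrite (slice_pderiv (fun t x => us_spinor (gamma t) (e t (om_inv i x)))).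
  apply: (smooth_on_addmx oU); first exact: smooth_on_pderiv sv.
  by apply: (smooth_on_mulmx oU _ sv); exact: (smooth_on_spin_lift oU (sC a)).
apply: (@smooth_on_eq _ _ _ _ (fun z => tensor_norm c r 1%:M
   (frame_nabla c (gamma (time z)) i (e (time z)) (space z)) (v z)) _ oU).
  by move=> z Uz; rewrite (T_sqnormE _ _ _ (uE z Uz)).
apply: (smooth_on_tensor_norm _ oU _ sv) => k.
apply: (smooth_on_summx oU) => a _; apply: (smooth_on_scalemx oU _ (sN a)).
by have /(smooth_on_mxP oU) := sE; exact.
Qed.

End JointSmoothness.

(** * The scaling curve *)

Section IntegralScaling.
Import HBNNSimple.
Context {R : realType}.
Local Open Scope ereal_scope.

(** Scaling acts on the simple functions below [f]. Used for [k] and for [k^-1], the inequality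
    becomes the equality [integral_RnZ], still without measurability. *)
Lemma integralZ_nonmeasurable_le d (T : measurableType d) (m : {measure set T -> \bar R})
    (k : R) (f : T -> \bar R) : (0 < k)%R -> (forall x, 0 <= f x) ->
  \int[m]_x (k%:E * f x) <= k%:E * \int[m]_x f x.
Proof.
move=> k0 f0; have kf0 x : 0 <= k%:E * f x by rewrite mule_ge0// lee_fin ltW.
rewrite !ge0_integralTE//; apply: ge_ereal_sup => _ [h hf <-].
have ki0 : (0 <= k^-1)%R by rewrite invr_ge0 ltW.
have -> : sintegral m h = k%:E * sintegral m (scale_nnsfun h ki0).
  rewrite sintegralrM muleA -EFinM mulfV ?mul1e// gt_eqF//.
rewrite lee_pmul2l//; apply: ereal_sup_ubound; exists (scale_nnsfun h ki0) => // x /=.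
by rewrite EFinM lee_pdivrMl// hf.
Qed.

Lemma integral_RnZ_le n (k : R) (f : 'cV[R]_n -> \bar R) : (0 < k)%R -> (forall x, 0 <= f x) ->
  integral_Rn (fun x => k%:E * f x) <= k%:E * integral_Rn f.
Proof.
move=> k0; elim: n f => [//|n IH] f f0 /=.
apply: le_trans; last by apply: integralZ_nonmeasurable_le => // t; exact: integral_Rn_ge0.
apply: le_integral_nonmeasurable => t; last exact: IH.
by apply: integral_Rn_ge0 => x; rewrite mule_ge0// lee_fin ltW.
Qed.

Lemma integral_RnZ n (k : R) (f : 'cV[R]_n -> \bar R) : (0 < k)%R -> (forall x, 0 <= f x) ->
  integral_Rn (fun x => k%:E * f x) = k%:E * integral_Rn f.
Proof.
move=> k0 f0; apply/eqP; rewrite eq_le integral_RnZ_le//=.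
have k1 : (0 < k^-1)%R by rewrite invr_gt0.
rewrite -lee_pdivlMl//; apply: le_trans (integral_RnZ_le k1 _); last first.
  by move=> x; rewrite mule_ge0// lee_fin ltW.
apply: le_integral_Rn => // x.
by rewrite muleA -EFinM mulVf ?mul1e// gt_eqF.
Qed.

(** Slices in the interval are bounded below by induction, the others by 0. The box has sides [2 d];
    the smaller value [d ^ n] is merely convenient. *)
Lemma integral_Rn_box n (f : 'cV[R]_n -> \bar R) (c d : R) (a : 'cV[R]_n) :
  (forall x, 0 <= f x) -> (0 <= c)%R -> (0 < d)%R ->
  (forall x : 'cV[R]_n, (forall i, `|x i 0 - a i 0| < d)%R -> c%:E <= f x) ->
  (c * d ^+ n)%:E <= integral_Rn f.
Proof.
move=> f0 c0 d0; elim: n f a f0 => [|n IH] f a f0 H.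
  by rewrite expr0 mulr1 /=; apply: H => -[].
pose a0 : R := a 0%R 0%R; pose a' : 'cV[R]_n := (\col_i a (lift ord0 i) 0)%R.
pose I := `](a0 - d)%R, (a0 + d)%R[%classic.
have slice (t : R) : I t -> (c * d ^+ n)%:E <= integral_Rn (fun x : 'cV[R]_n => f (col_mx (t%:M : 'M[R]_1) x)).
  rewrite /I /= in_itv/= => /andP[t1 t2]; apply: (IH _ a') => [x|x xa]; first exact: f0.
  apply: H => i; case: (unliftP ord0 i) => [j|] ->.
    have Ej : col_mx (t%:M : 'M[R]_1) x (lift ord0 j) 0%R = x j 0%R.
      by have -> : (lift ord0 j : 'I_(1 + n)) = rshift 1 j by [exact: val_inj]; rewrite col_mxEd.
    by rewrite [X in (X - _)%R]Ej; have := xa j; rewrite mxE.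
  have E0 : col_mx (t%:M : 'M[R]_1) x ord0 0%R = t.
    have -> : (ord0 : 'I_(1 + n)) = lshift n ord0 by exact: val_inj.
    by rewrite col_mxEu mxE eqxx mulr1n.
  rewrite [X in (X - _)%R]E0.
  by rewrite ltr_norml -/a0; apply/andP; split; lra.
apply: (@le_trans _ _ (\int[lebesgue_measure]_(t in [set: R]) ((c * d ^+ n) * \1_I t)%:E)).
  under eq_integral do rewrite EFinM.
  rewrite ge0_integralZl_EFin//; last 2 first.
  - by apply/measurable_EFinP; apply: measurable_indic; exact: measurable_itv.
  - by rewrite mulr_ge0// exprn_ge0// ltW.
  have -> : \int[lebesgue_measure]_x (\1_I x)%:E = lebesgue_measure I.
    by rewrite integral_indic ?setIT//; exact: measurable_itv.
  rewrite lebesgue_measure_itv/= lte_fin ifT; last lra.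
  rewrite -EFinB -EFinM lee_fin exprSr mulrA ler_wpM2l//.
    by rewrite mulr_ge0// exprn_ge0// ltW.
  by lra.
apply: le_integral_nonmeasurable => t.
  by rewrite lee_fin !mulr_ge0// exprn_ge0// ltW.
rewrite indicE; have [/set_mem It|_] := boolP (t \in I); first by rewrite mulr1; exact: slice.
by rewrite mulr0; exact: integral_Rn_ge0.
Qed.

End IntegralScaling.

Section CentralScaling.
Context {R : realType} {n : nat} {G : topGroupType} {proj : G -> 'M[R]_n}.
Hypothesis projM : forall a b, proj (a * b)%g = proj a *m proj b.
Hypothesis proj_det : forall a, 0 < \det (proj a).
Hypothesis proj_cover : covering_map proj (@GLpos R n).

Lemma continuous_mulg {T : topologicalType} (f g : T -> G) x :
  {for x, continuous f} -> {for x, continuous g} -> {for x, continuous (fun y => (f y * g y)%g)}.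
Proof.
move=> cf cg; apply: (@continuous_comp _ _ _ (fun y => (f y, g y)) (fun ab : G * G => (ab.1 * ab.2)%g)).
  exact: continuous_pair.
exact: mulg_cont.
Qed.

Lemma continuous_invg {T : topologicalType} (f : T -> G) x :
  {for x, continuous f} -> {for x, continuous (fun y => (f y)^-1%g)}.
Proof.
by move=> cf; apply: (@continuous_comp _ _ _ f (fun a : G => (a^-1)%g)) => //; exact: invg_cont.
Qed.

Lemma projV1 a : proj (a^-1)%g = invmx (proj a).
Proof.
have ua := proj_unit proj_det a.
rewrite -[LHS]mulmx1 -(mulmxV ua) mulmxA -projM mulVg (proj1E projM proj_det).
by rewrite mul1mx.
Qed.

(* The kernel of a covering homomorphism is discrete, so a continuous path of lifts
   of scalar matrices starting at 1 commutes with everything. *)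
Lemma scalar_lift_central (a : R -> G) (lam : R -> R) : continuous a -> a 0 = 1%g ->
  (forall t, proj (a t) = (lam t)%:M) -> forall t b, (a t * b = b * a t)%g.
Proof.
move=> ca a0 pa t b.
pose k t := ((a t * b) * (b * a t)^-1)%g.
have ck : continuous k.
  move=> u; apply: (@continuous_mulg _ (fun t => a t * b)%g (fun t => ((b * a t)^-1)%g)).
    by apply: (@continuous_mulg _ a (fun=> b)); [exact: ca|exact: cst_continuous].
  apply: (@continuous_invg _ (fun t => b * a t)%g).
  by apply: (@continuous_mulg _ (fun=> b) a); [exact: cst_continuous|exact: ca].
have pk u : proj (k u) = 1%:M.
  rewrite projM projV1 !projM pa mul_scalar_mx mul_mx_scalar -mul_scalar_mx -(pa u) -projM.
  by rewrite mulmxV// proj_unit.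
have [cproj rproj cov] := proj_cover.
have G1 : GLpos (1%:M : 'M[R]_n) by rewrite /GLpos /= det1.
have [V [oV V1 _ [D [sh [_ osh shK shU]]]]] := cov _ G1.
(* All values of [k] lie over the identity matrix, and a sheet contains a single point above it;
   hence [k] is locally constant. *)
have sheet u : exists2 U : set G, open U /\ U (k u) & forall w, U (k w) -> k w = k u.
  have [d [dE _]] : exists! d, sh d (proj (k u)) = k u by apply: shU; rewrite pk.
  exists (sh d @` V); first by split; [exact: osh|exists (proj (k u)); [rewrite pk; exact: V1|exact: dE]].
  by move=> w [v Vv vE]; rewrite -dE -vE pk -(shK d v Vv) vE pk.
pose B := [set u | k u = 1%g].
have -> : (a t * b = b * a t)%g <-> B t.
  by rewrite /B /k /=; split=> [->|/(congr1 (fun g => g * (b * a t))%g)];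
  [rewrite mulgV|rewrite -mulgA mulVg mulg1 mul1g].
suff -> : B = [set: R] by [].
have cR : connected [set: R] by apply/connected_intervalP => x y _ _ z _.
apply: cR.
- by exists 0; rewrite /B /k /= a0 mul1g mulg1 mulgV.
- exists B; last by rewrite setTI.
  rewrite openE => u ku; have [U [oU Uu] HU] := sheet u.
  have /= := ck u _ (near_open oU Uu); apply: (@filterS _ (nbhs u)) => w Uw.
  by rewrite /B /= (HU w Uw).
- exists B; last by rewrite setTI.
  rewrite -[B]setCK; apply: open_closedC.
  rewrite openE => u ku; have [U [oU Uu] HU] := sheet u.
  have /= := ck u _ (near_open oU Uu); apply: (@filterS _ (nbhs u)) => w Uw.
  by rewrite /B /= (HU w Uw).
Qed.

(* The dilation stays within [eps] of 1, so all the scalar matrices lie in one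
   evenly covered neighbourhood of the identity. *)
Definition dilation (eps t : R) := 1 + eps * (t * (1 + t ^+ 2)^-1).

Lemma dilation_close eps t : 0 < eps -> `|dilation eps t - 1| < eps.
Proof.
move=> e0; rewrite /dilation addrC addKr normrM gtr0_norm// gtr_pMr//.
have t0 : 0 < 1 + t ^+ 2 by rewrite ltr_pwDl// sqr_ge0.
rewrite normrM normfV (gtr0_norm t0) ltr_pdivrMr// mul1r.
(* This square gives [|t| <= t ^ 2 + 1/4 < 1 + t ^ 2]. *)
have := sqr_ge0 (`|t| - 2^-1); rewrite sqrrB real_normK ?num_real//.
have -> : `|t| * 2^-1 *+ 2 = `|t| by rewrite -mulr_natr -mulrA mulVf ?mulr1.
have -> : (2^-1 : R) ^+ 2 = 4^-1 by field.
lra.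
Qed.

Lemma dilation_lift : exists (eps : R) (a : R -> G), [/\ 0 < eps, continuous a, a 0 = 1%g,
  forall t, 0 < dilation eps t & forall t, proj (a t) = (dilation eps t)%:M].
Proof.
have [cproj rproj cov] := proj_cover.
have G1 : GLpos (1%:M : 'M[R]_n) by rewrite /GLpos /= det1.
have [V [oV V1 _ [D [sh [csh osh shK shU]]]]] := cov _ G1.
have p1 := proj1E projM proj_det.
have [d [dE _]] : exists! d, sh d (proj 1%g) = 1%g by apply: shU; rewrite p1.
have cs : continuous (fun l : R => l%:M : 'M[R]_n).
  move=> l; apply/continuous_mxP => i j.
  rewrite (_ : (fun y => _) = (fun y : R => y *+ (i == j))); last by apply/funext => y; rewrite mxE.
  case: (i == j); last by rewrite (_ : (fun y => _) = (fun=> 0)); [exact: cst_continuous|apply/funext].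
  by rewrite (_ : (fun y => _) = id); [exact: cvg_id|apply/funext].
have /nbhs_ballP[e /= e0 eV] : \forall l \near (1 : R), V (l%:M) := cs 1 _ (near_open oV V1).
(* The bound [e] keeps the scalar matrices in the evenly covered [V], the bound 1 keeps the
   dilations positive. *)
pose eps := Num.min e 1; have eps0 : 0 < eps by rewrite lt_min e0 ltr01.
have close t := dilation_close t eps0.
have Vl t : V (dilation eps t)%:M.
  apply: eV; rewrite /ball /= distrC; apply: lt_le_trans (close t) _.
  by rewrite ge_min lexx.
have cl : continuous (dilation eps).
  move=> t; suff : {for t, continuous (fun u : R => 1 + eps * (u * (1 + u ^+ 2)^-1))} by [].
  apply: continuousD; first exact: cst_continuous.
  apply: continuousM; first exact: cst_continuous.
  apply: continuousM; first exact: cvg_id.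
  apply: continuousV; first by rewrite gt_eqF// ltr_pwDl// sqr_ge0.
  by apply: continuousD; [exact: cst_continuous|exact: exprn_continuous].
exists eps, (fun t => sh d (dilation eps t)%:M); split => //.
- move=> t; apply: (@continuous_comp _ _ _ (fun t => (dilation eps t)%:M : 'M[R]_n) (sh d)).
    apply: (@continuous_comp _ _ _ (dilation eps) (fun l : R => l%:M : 'M[R]_n)); [exact: cl|exact: cs].
  exact: within_continuous_at oV (csh d) (Vl t).
- by rewrite /dilation mul0r mulr0 addr0 -p1.
- move=> t; have := close t; rewrite ltr_norml => /andP[h _].
  have : eps <= 1 by rewrite ge_min lexx orbT.
  by move: h; lra.
- by move=> t; rewrite shK.
Qed.

End CentralScaling.

(** * Homothetic sections and their energy densities *)

Section ScaledSections.
Context {R : realType} {n N : nat} {M : oriented_manifold R n} {G : topGroupType}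
  {proj : G -> 'M[R]_n} (c : {linear 'cV[R]_n -> 'M[R]_N}) (kappa : G -> 'M[R]_N)
  {P : spin_structure M proj}.
Local Notation H := [set a | SOset (proj a)].
Hypothesis projM : forall a b, proj (a * b)%g = proj a *m proj b.
Hypothesis proj_det : forall a, 0 < \det (proj a).
Hypothesis proj_cover : covering_map proj (@GLpos R n).
Hypothesis csq : forall x, c x *m c x = (- dot x x)%:M.
Hypothesis cskew : forall x, (c x)^T = - c x.
Hypothesis kspin : forall a, H a -> spin_set c (kappa a).
Hypothesis kcont : {within H, continuous kappa}.
Hypothesis kM : forall a b, H a -> H b -> kappa (a * b)%g = kappa a *m kappa b.
Hypothesis kc : forall a x, H a -> kappa a *m c x = c (proj a *m x) *m kappa a.

Variables (s : univ_section N P).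
Hypothesis hs : S1 kappa s.

(** If [a] lies over the scalar matrix [l], it takes an orthonormal spin frame [p] of the metric
    [l ^ 2 g] to the orthonormal spin frame [ss_act p a] of [g]. The spinor keeps its components in
    corresponding frames. *)
Definition scaled (l : R) (a : G) : univ_section N P :=
  UnivSection (fun i x => l ^+ 2 *: us_metric s i x) (fun p => us_spinor s (ss_act p a)).

Lemma scaled_orthonormal l a p : proj a = l%:M ->
  orthonormal_spin_frame (scaled l a) p <-> orthonormal_spin_frame s (ss_act p a).
Proof.
move=> pa.
have E i : om_dom i (ss_base p) ->
    (ss_frame i (ss_act p a))^T *m us_metric s i (om_chart i (ss_base p)) *m ss_frame i (ss_act p a) =
    (ss_frame i p)^T *m (l ^+ 2 *: us_metric s i (om_chart i (ss_base p))) *m ss_frame i p.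
  move=> ip; rewrite ss_frame_act// pa trmx_mul tr_scalar_mx mul_scalar_mx mul_mx_scalar.
  by rewrite -!scalemxAl -!scalemxAr -scalemxAl scalerA expr2.
split=> op i; rewrite ?ss_base_act => ip.
  by rewrite E//; exact: op.
by have := op i; rewrite ss_base_act E//; apply.
Qed.

Lemma scaled_S1_curve (lam : R -> R) (a : R -> G) : continuous a ->
  (forall t, 0 < lam t) -> (forall t, proj (a t) = (lam t)%:M) ->
  (forall t b, (a t * b = b * a t)%g) ->
  (forall U : set 'cV[R]_(1 + n), open U -> smooth_on U (fun z => lam (time z))) ->
  S1_curve kappa (fun t => scaled (lam t) (a t)).
Proof.
move=> ca l0 pa ac sl; have [/(_ 0) [[sy pd tr] [eqv u1]] [sm ss]] := hs.
split=> [t|].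
  split; split.
  - by move=> i x ix; rewrite /= linearZ/= sy.
  - move=> i x ix u u0; rewrite /= -scalemxAl dotZr mulr_gt0//; last exact: pd.
    by rewrite exprn_gt0.
  - by move=> i j x ix jx; rewrite /= (tr i j)// -scalemxAr -scalemxAl.
  (* Equivariance of the scaled spinor requires that [a t] commute with [b]. *)
  - move=> p b /(scaled_orthonormal _ (pa t)) op Hb /=.
    by rewrite -ss_actM -ac ss_actM eqv.
  - by move=> p /(scaled_orthonormal _ (pa t)) op; exact: u1.
split.
  move=> i.
  have oC : open [set z : 'cV[R]_(1 + n) | om_cod i (space z)].
    by apply: open_comp; [move=> z _; exact: continuous_space|exact: om_cod_open].
  apply: (smooth_on_scalemx oC _ (sm i)); apply: (smooth_on_exp oC); exact: sl.
move=> i W e U oW ce He sE.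
have oU : open U := family_domain_open (i := i) oW.
(* Acting by [a t] turns a test family for the scaled curve into a test family for the constant
   curve [s]. *)
apply: (ss i W (fun t y => ss_act (e t y) (a t)) oW).
- apply: continuous_at_within => // w Ww.
  apply: (@continuous_comp _ _ _ (fun w : R * M => (e w.1 w.2, a w.1)) (fun pa : P * G => ss_act pa.1 pa.2)); last exact: ss_act_cont.
  apply: continuous_pair; first exact: within_continuous_at oW ce Ww.
  by apply: (@continuous_comp _ _ _ fst a); [exact: cvg_fst|exact: ca].
- move=> t y Wy; have [be oe] := He t y Wy; rewrite ss_base_act; split=> //.
  exact/(scaled_orthonormal _ (pa t)).
- apply: (@smooth_on_eq _ _ _ _ (fun z => lam (time z) *: ss_frame i (e (time z) (om_inv i (space z)))) _ oU).
    move=> z [iz Wz]; rewrite ss_frame_act ?pa ?mul_mx_scalar// (He _ _ Wz).1.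
    exact: om_inv_dom.
  by apply: (smooth_on_scalemx oU _ sE); exact: sl.
Qed.

Lemma scaled_S1 l a : 0 < l -> proj a = l%:M -> (forall b, (a * b = b * a)%g) ->
  S1 kappa (scaled l a).
Proof.
move=> l0 pa ac; apply: (@scaled_S1_curve (fun=> l) (fun=> a)) => //.
- by move=> t; exact: cst_continuous.
- by move=> U _; exact: smooth_on_cst.
Qed.

Lemma tensor_normZ r k D v : tensor_norm c r 1%:M (fun j => k *: D j) v =
  k ^+ 2 * tensor_norm c r 1%:M D v.
Proof.
rewrite /tensor_norm mulr_sumr; apply: eq_bigr => j _; rewrite mulr_sumr; apply: eq_bigr => g _.
by rewrite dotZl exprMn.
Qed.

Lemma pderiv_scale {d} {W : normedModType R} k (l : R) (f : 'cV[R]_d -> W) x :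
  derivable f x (delta_mx k 0) -> pderiv k (fun y => l *: f y) x = l *: pderiv k f x.
Proof. by move=> df; exact: deriveZ. Qed.

Lemma rescaled_product (l : R) (E g X : 'M[R]_n) : l != 0 ->
  (l^-1 *: E)^T *m (l ^+ 2 *: g) *m (l^-1 *: X) = E^T *m g *m X.
Proof.
move=> l0; rewrite [(l^-1 *: E)^T]linearZ/= -scalemxAr -scalemxAr -!scalemxAl !scalerA.
by rewrite (_ : _ * _ = 1) ?scale1r//; field.
Qed.

Lemma koszul_scale (g g' : 'cV[R]_n -> 'M[R]_n) k a x :
  (forall b, pderiv b g' x = k *: pderiv b g x) -> koszul g' a x = k *: koszul g a x.
Proof.
move=> gg; apply/matrixP => p q.
have E b p' q' : pderiv b g' x p' q' = k * pderiv b g x p' q' by rewrite (gg b) mxE.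
refine (etrans (mxE _ _ _ _) _).
refine (etrans (f_equal3 (fun u v w => 2^-1 * (u + v - w)) (E a p q) (E q p a) (E p a q)) _).
by rewrite [RHS]mxE [X in _ = _ * X]mxE; ring.
Qed.

(** The vectors of the frame [e'] are [l^-1] times those of [e], while spinor, Christoffel symbols
    and connection form are unchanged. Only the vector in the derivative slot shrinks, since the
    Clifford slots see frame coordinates; hence the same factor for every [r]. *)
Lemma T_normsq_scaled r l a y : 0 < l -> proj a = l%:M -> (forall b, (a * b = b * a)%g) ->
  T_normsq c r (scaled l a) y = (l ^+ 2)^-1 * T_normsq c r s y.
Proof.
move=> l0 pa ac; have l0' : l != 0 by rewrite gt_eqF.
have hs' := scaled_S1 l0 pa ac.
have [i [W [e0 [fe0 W0 Wi]]]] := frame_family_exists proj_cover 0 y hs.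
pose V := [set y | W (0, y)]; pose e := e0 0.
have fe : local_spin_frame s i V e := local_frame_of_family 0 fe0.
have Vy : V y by []; have iy : om_dom i y := Wi _ _ W0.
pose e' y := ss_act (e y) (a^-1)%g.
have pai : proj (a^-1)%g = (l^-1)%:M.
  by rewrite (projV1 projM proj_det) pa invmx_scalar.
have [oV ce He sE] := fe.
have EE z : om_dom i z -> V z -> ss_frame i (e' z) = l^-1 *: ss_frame i (e z).
  by move=> iz Vz; rewrite ss_frame_act ?(He _ Vz).1// pai mul_mx_scalar.
have oD : open [set x | om_cod i x /\ V (om_inv i x)] := open_chart_image oV.
have eK z : ss_act (e' z) a = e z by rewrite /e' -ss_actM mulVg ss_act1.
have fe' : local_spin_frame (scaled l a) i V e'.
  split; first exact: oV.
  - apply: continuous_at_within => // z Vz.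
    apply: (@continuous_comp _ _ _ (fun y => (e y, (a^-1)%g)) (fun pa : P * G => ss_act pa.1 pa.2)); last exact: ss_act_cont.
    apply: continuous_pair; first exact: within_continuous_at oV ce Vz.
    exact: cst_continuous.
  - move=> z Vz; have [be oe] := He _ Vz; rewrite ss_base_act; split=> //.
    by apply/(scaled_orthonormal _ pa); rewrite eK.
  - apply: (@smooth_on_eq _ _ _ _ (fun x => l^-1 *: ss_frame i (e (om_inv i x))) _ oD).
      by move=> x [ix Vx]; rewrite EE//; exact: om_inv_dom.
    by apply: (smooth_on_scalemx oD _ sE); exact: smooth_on_cst.
pose x := om_chart i y; have ix : om_cod i x by exact: om_chart_cod.
have xy : om_inv i x = y by exact: om_chartK.
have Dx : [set x | om_cod i x /\ V (om_inv i x)] x by split=> //; rewrite /= xy.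
have Vx : V (om_inv i x) by rewrite xy.
rewrite (T_normsqE projM proj_det csq cskew kspin kcont kM kc hs' r fe' Vy iy).
rewrite (T_normsqE projM proj_det csq cskew kspin kcont kM kc hs r fe Vy iy).
rewrite (T_sqnormE _ _ _ (local_frame_unit fe' ix Vx)) (T_sqnormE _ _ _ (local_frame_unit fe ix Vx)) -/x.
have sg := metric_smooth hs (i := i).
have ug : us_metric s i x \in unitmx by apply: posdef_unit; exact: (metric_posdef hs).
have pg k : pderiv k (fun z => l ^+ 2 *: us_metric s i z) x = l ^+ 2 *: pderiv k (us_metric s i) x.
  by apply: pderiv_scale; exact: smooth_on_derivable sg ix.
have KE b : koszul (us_metric (scaled l a) i) b x = l ^+ 2 *: koszul (us_metric s i) b x.
  exact: koszul_scale.
have CE b : christoffel (scaled l a) i b x = christoffel s i b x.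
  rewrite !christoffelE KE /= invmxZ ?unitmxZ ?unitfE ?expf_neq0//.
  by rewrite -scalemxAl -scalemxAr scalerA mulVf ?expf_neq0// scale1r.
have pE b : pderiv b (fun z => ss_frame i (e' (om_inv i z))) x =
    l^-1 *: pderiv b (fun z => ss_frame i (e (om_inv i z))) x.
  have EA z : [set x | om_cod i x /\ V (om_inv i x)] z ->
      ss_frame i (e' (om_inv i z)) = l^-1 *: ss_frame i (e (om_inv i z)).
    by move=> [iz Vz]; rewrite EE//; exact: om_inv_dom.
  refine (etrans (pderiv_eq_on b oD EA Dx) _); apply: pderiv_scale.
  exact: smooth_on_derivable sE Dx.
have FE b : connection_form (scaled l a) i e' b x = connection_form s i e b x.
  rewrite /connection_form CE pE /= EE ?xy// -[_ *m (l^-1 *: ss_frame i (e y))]scalemxAr -scalerDr.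
  exact: rescaled_product.
have vE : (fun z => us_spinor (scaled l a) (e' (om_inv i z))) = (fun z => us_spinor s (e (om_inv i z))).
  by apply/funext => z; rewrite /= eK.
have NE b : spin_nabla c (scaled l a) i e' b x = spin_nabla c s i e b x.
  rewrite !spin_nablaE FE; have vx : us_spinor (scaled l a) (e' (om_inv i x)) = us_spinor s (e (om_inv i x)) by rewrite /= eK.
  exact: (congr2 (fun u w => u + spin_lift c (connection_form s i e b x) *m w)
    (congr1 (fun f => pderiv b f x) vE) vx).
rewrite -exprVn -tensor_normZ /= eK; congr (tensor_norm _ _ _ _ _).
apply/funext => k; rewrite /frame_nabla scaler_sumr; apply: eq_bigr => b _.
by rewrite NE EE ?xy// mxE scalerA.
Qed.

End ScaledSections.

(** * The energy along a curve *)

Section VolumeIntegral.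
Context {R : realType} {n N : nat} {M : oriented_manifold R n} {G : topGroupType}
  {proj : G -> 'M[R]_n} {P : spin_structure M proj}.
Implicit Types (s : univ_section N P) (f : M -> R).
Local Open Scope ereal_scope.

Definition chart_density s f i (A : set M) (x : 'cV[R]_n) : R :=
  (\1_(chart_image i A) x * f (om_inv i x) * Num.sqrt (\det (us_metric s i x)))%R.

Lemma chart_density_ge0 s f i A x : (forall y, (0 <= f y)%R) -> (0 <= chart_density s f i A x)%R.
Proof. by move=> f0; rewrite !mulr_ge0. Qed.

Lemma integral_vol_ge s f m (i : 'I_m -> om_idx M) (A : 'I_m -> set M) :
  (forall k, <<s [set U : set M | open U] >> (A k)) -> (forall k, A k `<=` om_dom (i k)) ->
  trivIset [set: 'I_m] A ->
  \sum_(k < m) integral_Rn (fun x => (chart_density s f (i k) (A k) x)%:E) <= integral_vol s f.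
Proof. by move=> mA Ai tA; apply: ereal_sup_ubound; exists m, i, A. Qed.

(** The empty family already contributes 0 to the supremum. *)
Lemma integral_vol_ge0 s f : 0 <= integral_vol s f.
Proof.
pose z (T : Type) (k : 'I_0) : T := False_rect T (notF (ltn_ord k)).
have := @integral_vol_ge s f 0 (z _) (z _); rewrite big_ord0; apply.
- by case.
- by case.
- by case.
Qed.

Lemma bounded_volume_metric s : compact [set: M] -> metric_tensor s ->
  (forall i, smooth_on (om_cod i) (us_metric s i)) ->
  exists2 C : R, (0 < C)%R & forall m (i : 'I_m -> om_idx M) (A : 'I_m -> set M),
    (forall k, <<s [set U : set M | open U] >> (A k)) -> (forall k, A k `<=` om_dom (i k)) ->
    trivIset [set: 'I_m] A ->
    \sum_(k < m) chart_volume (us_metric s) (i k) (A k) <= C%:E.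
Proof.
move=> cM [sy pd tr] sm.
have [] := @bounded_volume_compact R n M (us_metric s) sm _ tr cM.
  by move=> i x ix; split; [exact: sy|exact: pd].
move=> C HC; exists (Num.max C 1%R); first by rewrite lt_max ltr01 orbT.
move=> m i A mA Ai tA; have := HC m i A mA Ai tA.
under eq_bigr do rewrite setIT.
by move=> /le_trans; apply; rewrite lee_fin le_max lexx.
Qed.

(** Upper integrals bound each sum by [K] times the upper volume for [s], the form in which
    finiteness of the volume was obtained. *)
Lemma integral_vol_le s s' f (K C : R) : (0 < K)%R -> (forall y, (0 <= f y)%R) ->
  (forall m (i : 'I_m -> om_idx M) (A : 'I_m -> set M),
    (forall k, <<s [set U : set M | open U] >> (A k)) -> (forall k, A k `<=` om_dom (i k)) ->
    trivIset [set: 'I_m] A ->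
    \sum_(k < m) chart_volume (us_metric s) (i k) (A k) <= C%:E) ->
  (forall i x, om_cod i x -> (f (om_inv i x) * Num.sqrt (\det (us_metric s' i x)) <=
    K * Num.sqrt (\det (us_metric s i x)))%R) ->
  integral_vol s' f <= (K * C)%:E.
Proof.
move=> K0 f0 HC fK; apply: ge_ereal_sup => _ [m [i [A [mA Ai tA ->]]]].
rewrite EFinM; apply: le_trans (lee_wpmul2l _ (HC m i A mA Ai tA)); last by rewrite lee_fin ltW.
rewrite ge0_sume_distrr; last by move=> k _; exact: upper_density_ge0.
apply: lee_sum => k _.
apply: le_trans (integral_Rn_le_upper _) _.
  by move=> x; rewrite lee_fin; exact: (chart_density_ge0 s').
apply: (@le_trans _ _ (upper_integral_Rn (fun x => K%:E *
    (\1_(chart_image (i k) (A k)) x * Num.sqrt (\det (us_metric s (i k) x)))%:E))); last first.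
  by apply: upper_integral_RnZ => // x; rewrite lee_fin mulr_ge0.
apply: le_upper_integral_Rn => x; rewrite -/(chart_image (i k) (A k)) -EFinM lee_fin -mulrA [leRHS]mulrCA.
have [/set_mem [ix Ax]|xA] := boolP (x \in chart_image (i k) (A k)); last first.
  by rewrite !indicE (negPf xA) !mul0r.
by rewrite ler_wpM2l// fK.
Qed.

Lemma integral_vol_scale s s' f f' (k : R) : (0 < k)%R -> (forall y, (0 <= f y)%R) ->
  (forall i x, (f' (om_inv i x) * Num.sqrt (\det (us_metric s' i x)) =
    k * (f (om_inv i x) * Num.sqrt (\det (us_metric s i x))))%R) ->
  integral_vol s' f' = k%:E * integral_vol s f.
Proof.
move=> k0 f0 E.
have D m (i : 'I_m -> om_idx M) (A : 'I_m -> set M) :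
    \sum_(j < m) integral_Rn (fun x => (chart_density s' f' (i j) (A j) x)%:E) =
    k%:E * \sum_(j < m) integral_Rn (fun x => (chart_density s f (i j) (A j) x)%:E).
  rewrite ge0_sume_distrr; last first.
    by move=> j _; apply: integral_Rn_ge0 => x; rewrite lee_fin chart_density_ge0.
  apply: eq_bigr => j _; rewrite -integral_RnZ//; last first.
    by move=> x; rewrite lee_fin chart_density_ge0.
  congr integral_Rn; apply/funext => x; rewrite -EFinM /chart_density; congr EFin.
  by rewrite -mulrA E; ring.
apply/eqP; rewrite eq_le; apply/andP; split.
  apply: ge_ereal_sup => _ [m [i [A [mA Ai tA ->]]]].
  by rewrite [leLHS]D lee_pmul2l// integral_vol_ge.
rewrite -lee_pdivlMl//; apply: ge_ereal_sup => _ [m [i [A [mA Ai tA ->]]]].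
by rewrite lee_pdivlMl// -[leLHS]D integral_vol_ge.
Qed.

(** A small coordinate ball around [x0] is by itself an admissible family, and it contains a box on
    which the density is at least [q]. *)
Lemma integral_vol_gt0 s f i x0 (q : R) : om_cod i x0 -> (0 < q)%R -> (forall y, (0 <= f y)%R) ->
  (\forall x \near x0, (q <= f (om_inv i x) * Num.sqrt (\det (us_metric s i x)))%R) ->
  0 < integral_vol s f.
Proof.
move=> ix0 q0 f0 qf.
have [d d0 dB] := near_ball (filterI qf (near_open (om_cod_open (i := i)) ix0)).
pose A : set M := om_dom i `&` om_chart i @^-1` [set x | `|x - x0| < d]%R.
have oA : open A.
  apply: within_continuous_open; [exact: om_dom_open|exact: om_chart_cont|].
  have -> : [set x | `|x - x0| < d]%R = ball x0 d.
    by apply/seteqP; split => x /=; rewrite -ball_normE /ball_ /= distrC.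
  exact: ball_open.
have := @integral_vol_ge s f 1 (fun=> i) (fun=> A).
rewrite big_ord1 => Hle; apply: lt_le_trans (Hle _ _ _); last 3 first.
- by move=> _ ; exact: sub_sigma_algebra.
- by move=> _ y [].
- by move=> j k _ _ _; rewrite (ord1 j) (ord1 k).
apply: lt_le_trans (integral_Rn_box (a := x0) (d := (d / 2)%R) _ (ltW q0) _ _).
- by rewrite lte_fin mulr_gt0// exprn_gt0// divr_gt0.
- by move=> x; rewrite lee_fin chart_density_ge0.
- by rewrite divr_gt0.
- move=> x xd; have xB : (`|x - x0| < d)%R.
    apply: (@le_lt_trans _ _ (d / 2)%R); last by rewrite ltr_pdivrMr// ltr_pMr// ltr1n.
    apply: mx_norm_le => [|a b]; first by rewrite divr_ge0// ltW.
    by rewrite (ord1 b) !mxE ltW.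
  have [qx ix] : (fun x => q <= f (om_inv i x) * Num.sqrt (\det (us_metric s i x)))%R x /\ om_cod i x.
    by apply: dB; rewrite -ball_normE /ball_ /= distrC.
  rewrite lee_fin /chart_density indicE mem_set ?mul1r//.
  split=> //; split; first exact: om_inv_dom.
  by rewrite /= om_invK.
Qed.

End VolumeIntegral.

Section TensorNormValues.
Context {R : realType} {n N : nat} {M : oriented_manifold R n} {G : topGroupType}
  {proj : G -> 'M[R]_n} (c : {linear 'cV[R]_n -> 'M[R]_N}) {P : spin_structure M proj}.
Implicit Types (s : univ_section N P).

Lemma T_sqnorm_ge0 s i e r x : 0 <= T_sqnorm c s i e r x.
Proof. by apply: sumr_ge0 => K _; exact: sqr_ge0. Qed.

Lemma T_normsq_ge0 r s y : 0 <= T_normsq c r s y.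
Proof.
rewrite /T_normsq; set v := [set q | exists i V e, _].
case: xgetP => [q _ /= vq|//].
have : v q by rewrite vq.
by move=> [i [V [e [_ _ _ ->]]]]; exact: T_sqnorm_ge0.
Qed.

(** Frame independence is avoided here: if the local values disagree, [xget] returns its default 0.
    This serves at the sections [gamma t], for which [S1] is not at hand. *)
Lemma T_normsq_le r s y i V e : local_spin_frame s i V e -> V y -> om_dom i y ->
  T_normsq c r s y <= T_sqnorm c s i e r (om_chart i y).
Proof.
move=> fe Vy iy; rewrite /T_normsq; set v := [set q | exists i V e, _].
case: xgetP => [q _ /= vq|_]; last exact: T_sqnorm_ge0.
have : v (T_sqnorm c s i e r (om_chart i y)) by exists i, V, e.
by rewrite vq => ->.
Qed.

End TensorNormValues.

(** * Vanishing and continuity of the energy *)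

Section EnergyEstimates.
Context {R : realType} {n N : nat} {M : oriented_manifold R n} {G : topGroupType}
  {proj : G -> 'M[R]_n} (c : {linear 'cV[R]_n -> 'M[R]_N}) (kappa : G -> 'M[R]_N)
  {P : spin_structure M proj}.
Local Notation H := [set a | SOset (proj a)].
Hypothesis projM : forall a b, proj (a * b)%g = proj a *m proj b.
Hypothesis proj_det : forall a, 0 < \det (proj a).
Hypothesis proj_cover : covering_map proj (@GLpos R n).
Hypothesis csq : forall x, c x *m c x = (- dot x x)%:M.
Hypothesis cskew : forall x, (c x)^T = - c x.
Hypothesis kspin : forall a, H a -> spin_set c (kappa a).
Hypothesis kcont : {within H, continuous kappa}.
Hypothesis kM : forall a b, H a -> H b -> kappa (a * b)%g = kappa a *m kappa b.
Hypothesis kc : forall a x, H a -> kappa a *m c x = c (proj a *m x) *m kappa a.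
Hypothesis cM : compact [set: M].
Implicit Types (s : univ_section N P) (gamma : R -> univ_section N P).

Lemma near_lt (x y : R) : x < y -> \forall q \near x, q < y.
Proof. by move=> xy; exact: (@near_open _ [set q | q < y] x (open_lt (y := y)) xy). Qed.

Lemma near_gt (x y : R) : y < x -> \forall q \near x, y < q.
Proof. by move=> xy; exact: (@near_open _ [set q | y < q] x (open_gt (y := y)) xy). Qed.

Lemma near_prod_open {T : topologicalType} (y0 : T) (Q : R * T -> Prop) :
  (\forall w \near ((0 : R), y0), Q w) ->
  exists U : set T, [/\ open U, U y0 & \forall t \near (0 : R), forall y, U y -> Q (t, y)].
Proof.
move=> [[A B] /= [nA nB] AB]; exists (B°); split => //; first exact: open_interior.
by apply: filterS nA => t At y /interior_subset By; exact: (AB (t, y)).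
Qed.

(** Compactness turns the time intervals attached to the single points into a common one. *)
Lemma compact_uniform (B : R -> M -> Prop) :
  (forall y0, exists U : set M, [/\ open U, U y0 & \forall t \near (0 : R), forall y, U y -> B t y]) ->
  \forall t \near (0 : R), forall y, B t y.
Proof.
move=> loc; suff HQ : nbhs (0 : R) [set t | forall y, [set: M] y -> B t y].
  by apply: (@filterS _ (nbhs (0 : R))) HQ => t Ht y; exact: Ht.
apply: (compact_induction (Q := fun U : set M => nbhs (0 : R) [set t | forall y, U y -> B t y]) cM).
- by apply: (@filterS _ (nbhs (0 : R)) _ setT) (@filterT _ (nbhs (0 : R)) _) => t _ y.
- move=> U V HU HV; apply: (@filterS2 _ (nbhs (0 : R))) HU HV => t HU HV y [Uy|Vy]; [exact: HU|exact: HV].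
- by move=> U V UV; apply: (@filterS _ (nbhs (0 : R))) => t HV y /UV; exact: HV.
- by move=> y _; exact: loc.
Qed.

(** An upper bound is enough, so equality with a local expression is needed at time 0 only and
    [T_normsq_le] handles the other times. *)
Lemma T_normsq_near gamma r y0 (eps : R) : S1_curve kappa gamma -> S1 kappa (gamma 0) -> 0 < eps ->
  exists U : set M, [/\ open U, U y0 & \forall t \near (0 : R), forall y, U y ->
    T_normsq c r (gamma t) y <= T_normsq c r (gamma 0) y0 + eps].
Proof.
move=> hg h0 e0; have [i [W [e [fe W0 Wi]]]] := frame_family_exists proj_cover 0 y0 hg.
have iy0 := Wi _ _ W0.
pose Q (z : 'cV[R]_(1 + n)) := T_sqnorm c (gamma (time z)) i (e (time z)) r (space z).
pose zf (w : R * M) := time_slice w.1 (om_chart i w.2).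
have Uz0 : [set z : 'cV[R]_(1 + n) | om_cod i (space z) /\ W (time z, om_inv i (space z))] (zf (0, y0)).
  rewrite /zf /= space_time_slice time_time_slice om_chartK//; split=> //.
  exact: om_chart_cod.
have cQ : {for zf (0, y0), continuous Q} := smooth_on_continuous (T_sqnorm_joint_smooth c r hg fe) Uz0.
have czf : {for (0, y0), continuous zf}.
  apply: continuous_time_slice2; first exact: cvg_fst.
  apply: (@continuous_comp _ _ _ snd (om_chart i)); first exact: cvg_snd.
  exact: within_continuous_at (@om_dom_open _ _ M i) (@om_chart_cont _ _ M i) iy0.
have QE : Q (zf (0, y0)) = T_normsq c r (gamma 0) y0.
  rewrite (T_normsqE projM proj_det csq cskew kspin kcont kM kc h0 r (local_frame_of_family 0 fe) W0 iy0).
  by rewrite /Q /zf time_time_slice space_time_slice.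
have cQz : {for (0, y0), continuous (Q \o zf)} by exact: continuous_comp.
have nQ : \forall w \near ((0 : R), y0), Q (zf w) < Q (zf (0, y0)) + eps.
  have : \forall q \near Q (zf (0, y0)), q < Q (zf (0, y0)) + eps.
    by apply: near_lt; rewrite ltrDl.
  exact: cQz.
have nW : \forall w \near ((0 : R), y0), W w by exact: near_open (ff_open fe) W0.
have [U [oU Uy0 HU]] := near_prod_open (filterI nQ nW).
exists U; split=> //; apply: filterS HU => t HU y Uy; have [Qt Wt] := HU y Uy.
apply: le_trans (T_normsq_le c r (local_frame_of_family t fe) Wt (Wi _ _ Wt)) _.
by rewrite -QE ltW//; move: Qt; rewrite /Q /zf /= time_time_slice space_time_slice.
Qed.

Lemma T_normsq_uniform gamma r (eps : R) : S1_curve kappa gamma -> S1 kappa (gamma 0) ->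
  (forall y, T_normsq c r (gamma 0) y = 0) -> 0 < eps ->
  \forall t \near (0 : R), forall y, T_normsq c r (gamma t) y <= eps.
Proof.
move=> hg h0 z0 e0.
apply: compact_uniform => y; have [U [oU Uy HU]] := T_normsq_near r y hg h0 e0.
exists U; split=> //; apply: (@filterS _ (nbhs (0 : R))) HU => t HU z /HU.
by rewrite z0 add0r.
Qed.

Lemma T_normsq_bounded s r : S1 kappa s -> exists2 K : R, 0 < K & forall y, T_normsq c r s y <= K.
Proof.
move=> hs; pose Q (U : set M) := exists2 K : R, 0 < K & forall y, U y -> T_normsq c r s y <= K.
suff [K K0 HK] : Q [set: M] by exists K => // y; exact: HK.
apply: (compact_induction cM).
- by exists 1.
- move=> U V [K K0 HK] [K' K'0 HK']; exists (K + K'); first exact: addr_gt0.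
  move=> y [/HK|/HK'] /le_trans; apply; rewrite ?lerDl ?lerDr ltW//.
- by move=> U V UV [K K0 HK]; exists K => // y /UV /HK.
- move=> y _; have [U [oU Uy HU]] := T_normsq_near r y hs hs ltr01.
  exists U; split=> //; exists (T_normsq c r s y + 1); first by rewrite ltr_wpDl// T_normsq_ge0.
  exact: (nbhs_singleton HU).
Qed.

(** Continuity in one chart per point suffices, since a change of chart multiplies both determinants
    by the same squared Jacobian. Any factor above 1 would do; 4 has the square root 2. *)
Lemma metric_det_near gamma : S1_curve kappa gamma ->
  \forall t \near (0 : R), forall i x, om_cod i x ->
    \det (us_metric (gamma t) i x) <= 4 * \det (us_metric (gamma 0) i x).
Proof.
move=> [gs [gsm _]].
suff HQ : \forall t \near (0 : R), forall y, forall i, om_dom i y ->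
    \det (us_metric (gamma t) i (om_chart i y)) <= 4 * \det (us_metric (gamma 0) i (om_chart i y)).
  apply: (@filterS _ (nbhs (0 : R))) HQ => t Ht i x ix; have := Ht (om_inv i x) i (om_inv_dom ix).
  by rewrite om_invK.
apply: compact_uniform => y0; have [i0 iy0] := om_cover y0.
have oC : open [set z : 'cV[R]_(1 + n) | om_cod i0 (space z)].
  by apply: open_comp; [move=> z _; exact: continuous_space|exact: om_cod_open].
pose D (z : 'cV[R]_(1 + n)) := \det (us_metric (gamma (time z)) i0 (space z)).
have sD : smooth_on [set z : 'cV[R]_(1 + n) | om_cod i0 (space z)] D := smooth_on_det oC (gsm i0).
have ix0 : om_cod i0 (om_chart i0 y0) by exact: om_chart_cod.
have cchart : {for y0, continuous (om_chart i0)}.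
  exact: within_continuous_at (@om_dom_open _ _ M i0) (@om_chart_cont _ _ M i0) iy0.
have cD (f : R * M -> R) : {for (0, y0), continuous f} -> 
    {for (0, y0), continuous (fun w => D (time_slice (f w) (om_chart i0 w.2)))}.
  move=> cf; apply: (@continuous_comp _ _ _ (fun w : R * M => time_slice (f w) (om_chart i0 w.2)) D).
    apply: continuous_time_slice2; first exact: cf.
    by apply: (@continuous_comp _ _ _ snd (om_chart i0)); [exact: cvg_snd|exact: cchart].
  by apply: (smooth_on_continuous sD); rewrite /= space_time_slice.
pose h (w : R * M) := D (time_slice 0 (om_chart i0 w.2)) * 4 - D (time_slice w.1 (om_chart i0 w.2)).
have ch : {for (0, y0), continuous h}.
  apply: continuousB; last by apply: (cD fst); exact: cvg_fst.
  apply: continuousM; last exact: cst_continuous.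
  by apply: (cD (fun=> 0)); exact: cst_continuous.
have h0 : 0 < h (0, y0).
  rewrite /h /= /D time_time_slice space_time_slice.
  have : 0 < \det (us_metric (gamma 0) i0 (om_chart i0 y0)).
    by apply: posdef_det; have [[sy pd _] _] := gs 0; split; [exact: sy|exact: pd].
  by move: (\det _) => d; lra.
have nh : \forall w \near ((0 : R), y0), 0 < h w.
  have : \forall q \near h (0, y0), 0 < q by exact: near_gt.
  exact: ch.
have nd : \forall w \near ((0 : R), y0), om_dom i0 w.2.
  have : (@snd R M) @ ((0 : R), y0) --> y0 by exact: cvg_snd.
  by apply; exact: (near_open (@om_dom_open _ _ M i0)).
have [U [oU Uy0 HU]] := near_prod_open (filterI nh nd).
exists U; split=> //; apply: (@filterS _ (nbhs (0 : R))) HU => t HU y Uy i iy; have [ht i0y] := HU y Uy.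
have ix : om_cod i (om_chart i y) by exact: om_chart_cod.
have E u : \det (us_metric (gamma u) i (om_chart i y)) =
    \det (trans_jac i i0 (om_chart i y)) ^+ 2 * \det (us_metric (gamma u) i0 (om_chart i0 y)).
  have [[_ _ tr] _] := gs u; rewrite (tr i i0)//; last by rewrite om_chartK.
  by rewrite !det_mulmx det_tr om_chartK//; ring.
rewrite !E mulrCA ler_wpM2l ?sqr_ge0//.
move: ht; rewrite /h /= /D !time_time_slice !space_time_slice subr_gt0 => /ltW.
by rewrite mulrC.
Qed.

Lemma energy_ge0 r s : 0 <= energy c r s.
Proof. by rewrite mulr_ge0// fine_ge0// integral_vol_ge0. Qed.

Lemma energy_le r s (B : R) : (integral_vol s (T_normsq c r s) <= B%:E)%E -> energy c r s <= B.
Proof.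
move=> IB; have I0 := integral_vol_ge0 s (T_normsq c r s).
have fin : integral_vol s (T_normsq c r s) \is a fin_num.
  by rewrite ge0_fin_numE// (le_lt_trans IB)// ltry.
have : fine (integral_vol s (T_normsq c r s)) <= B by rewrite -lee_fin fineK.
have := fine_ge0 I0; rewrite /energy; move: (fine _) => q; lra.
Qed.

Lemma S1_bounded_volume s : S1 kappa s -> exists2 C : R, 0 < C & forall m (i : 'I_m -> om_idx M) (A : 'I_m -> set M),
    (forall k, <<s [set U : set M | open U] >> (A k)) -> (forall k, A k `<=` om_dom (i k)) ->
    trivIset [set: 'I_m] A ->
    (\sum_(k < m) chart_volume (us_metric s) (i k) (A k) <= C%:E)%E.
Proof.
move=> hs; have [/(_ 0) [mt _] _] := hs; apply: bounded_volume_metric => // i.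
exact: (metric_smooth hs).
Qed.

(** Finite volume and boundedness of the density make the integral finite, so [fine] does not hide
    an infinite value. A positive density at [y0] stays, by continuity, above a positive constant on
    a neighbourhood, and the integral would be positive. *)
Lemma energy_eq0 r s : S1 kappa s -> energy c r s = 0 -> forall y, T_normsq c r s y = 0.
Proof.
move=> hs E0 y0; apply/eqP; rewrite eq_le T_normsq_ge0 andbT leNgt; apply/negP => q0.
have [C C0 HC] := S1_bounded_volume hs; have [K K0 HK] := T_normsq_bounded r hs.
have IK : (integral_vol s (T_normsq c r s) <= (K * C)%:E)%E.
  apply: (integral_vol_le K0 _ HC) => [y|i x ix]; first exact: T_normsq_ge0.
  by rewrite ler_wpM2r.
have fin : integral_vol s (T_normsq c r s) \is a fin_num.
  by rewrite ge0_fin_numE ?integral_vol_ge0// (le_lt_trans IK)// ltry.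
have [i [W [e [fe W0 Wi]]]] := frame_family_exists proj_cover 0 y0 hs.
have iy0 := Wi _ _ W0; pose x0 := om_chart i y0.
have ix0 : om_cod i x0 by exact: om_chart_cod.
have fl := local_frame_of_family 0 fe.
have Vx0 : W (0, om_inv i x0) by rewrite om_chartK.
have sT : smooth_on (chart_image i [set y | W (0, y)]) (fun x => T_sqnorm c s i (e 0) r x).
  have := smooth_on_time_slice (t := 0) (T_sqnorm_joint_smooth c r hs fe).
  rewrite (_ : (fun x => _) = (fun x => T_sqnorm c s i (e 0) r x)); last first.
    by apply/funext => x; rewrite time_time_slice space_time_slice.
  by apply: smooth_on_sub => x [ix Wx]; rewrite /= time_time_slice space_time_slice.
have [oV _ _ _] := fl; have oD := open_chart_image (i := i) oV.
have Dx0 : chart_image i [set y | W (0, y)] x0 by [].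
pose f x := T_sqnorm c s i (e 0) r x * Num.sqrt (\det (us_metric s i x)).
have cf : {for x0, continuous f}.
  apply: continuousM; first exact: smooth_on_continuous sT Dx0.
  apply: (@smooth_on_continuous _ _ _ (om_cod i) (fun x => Num.sqrt (\det (us_metric s i x)))) => //.
  apply: (smooth_on_sqrt (@om_cod_open _ _ M i)) => [x ix|].
    by apply: posdef_det; exact: (metric_posdef hs).
  exact: (smooth_on_det (@om_cod_open _ _ M i) (metric_smooth hs (i := i))).
have TE x : chart_image i [set y | W (0, y)] x -> T_normsq c r s (om_inv i x) = T_sqnorm c s i (e 0) r x.
  move=> [ix Wx]; rewrite (T_normsqE projM proj_det csq cskew kspin kcont kM kc hs r fl Wx (om_inv_dom ix)).
  by rewrite om_invK.
have fx0 : 0 < f x0.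
  rewrite /f -TE// om_chartK// mulr_gt0// sqrtr_gt0.
  by apply: posdef_det; exact: (metric_posdef hs).
have : (0 < integral_vol s (T_normsq c r s))%E.
  have f2 : 0 < f x0 / 2 by rewrite divr_gt0.
  apply: (integral_vol_gt0 ix0 f2); first by move=> y; exact: T_normsq_ge0.
  have nf : \forall x \near x0, f x0 / 2 < f x.
    have : \forall q \near f x0, f x0 / 2 < q.
      by apply: near_gt; rewrite ltr_pdivrMr// ltr_pMr// ltr1n.
    exact: cf.
  by apply: filterS2 nf (near_open oD Dx0) => x fx Dx; rewrite TE// ltW.
move: E0; rewrite /energy -(fineK fin) lte_fin => E0.
by move=> I0; move: E0 => /eqP; rewrite mulf_eq0 invr_eq0 pnatr_eq0/= gt_eqF.
Qed.

Lemma energy_cvg0 gamma r : S1_curve kappa gamma -> S1 kappa (gamma 0) -> energy c r (gamma 0) = 0 ->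
  energy c r (gamma t) @[t --> (0 : R)] --> (0 : R).
Proof.
move=> hg h0 E0; have z0 := energy_eq0 h0 E0.
have [C C0 HC] := S1_bounded_volume h0.
apply/cvgrPdist_le => eps e0.
(* [C] bounds the volume at time 0 and the volume density at most doubles, so a density of energy at
   most [d] integrates to at most [2 * d * C = eps]. *)
pose d := eps / (2 * C); have d0 : 0 < d by rewrite divr_gt0// mulr_gt0.
apply: filterS2 (T_normsq_uniform hg h0 z0 d0) (metric_det_near hg) => t Tt dt.
rewrite sub0r normrN ger0_norm ?energy_ge0//.
have -> : eps = (d * 2) * C by rewrite /d; field; rewrite gt_eqF.
apply: energy_le; apply: (integral_vol_le _ _ HC) => [|y|i x ix].
- by rewrite mulr_gt0.
- exact: T_normsq_ge0.
rewrite -mulrA ler_pM ?T_normsq_ge0// ?sqrtr_ge0//.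
have g0 : 0 < \det (us_metric (gamma 0) i x) by apply: posdef_det; exact: (metric_posdef h0).
have -> : 2 = Num.sqrt 4 :> R.
  by rewrite (_ : 4 = 2 ^+ 2) ?sqrtr_sqr ?ger0_norm// expr2 -natrM.
by rewrite -sqrtrM// ler_wsqrtr// dt.
Qed.

(** The volume density contributes [l ^ n] and the squared norm of the tensor [l ^- 2]. *)
Lemma energy_scaled r l (a : G) s : S1 kappa s -> (2 <= n)%N -> 0 < l -> proj a = l%:M ->
  (forall b, (a * b = b * a)%g) -> energy c r (scaled s l a) = l ^+ (n - 2) * energy c r s.
Proof.
move=> hs n2 l0 pa ac; rewrite /energy.
rewrite (@integral_vol_scale _ _ _ _ _ _ _ s _ (T_normsq c r s) _ (l ^+ (n - 2))).
- case: (integral_vol s _) => [q| |] /=; first by rewrite mulrCA.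
  (* An infinite integral stays infinite under the scaling, and [fine] then makes both sides 0. *)
  + by rewrite gt0_muley ?lte_fin ?exprn_gt0// mulr0 mulr0.
  + by rewrite gt0_muleNy ?lte_fin ?exprn_gt0// mulr0 mulr0.
- by rewrite exprn_gt0.
- by move=> y; exact: T_normsq_ge0.
move=> i x; rewrite (T_normsq_scaled projM proj_det proj_cover csq cskew kspin kcont kM kc hs r _ l0 pa ac).
rewrite /= detZ -exprM mulnC exprM sqrtrM ?sqr_ge0// sqrtr_sqr ger0_norm ?exprn_ge0 ?ltW//.
have -> : l ^+ n = l ^+ (n - 2) * l ^+ 2 by rewrite -exprD subnK.
by rewrite mulrACA [_ * l ^+ 2]mulrC; field; rewrite gt_eqF.
Qed.

End EnergyEstimates.

(** * Second derivatives at a minimum, for total derivatives *)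

Section SecondDerivativeAtMinimum.
Context {R : realType}.

(** Without convergence, [lim] returns the default point of [R], which is 0. *)
Lemma lim_dvg (F : set_system R) : ~ cvg F -> lim F = 0 :> R.
Proof. by move=> /dvgP. Qed.

(* [derive1] is 0 where the difference quotient has no limit. If the second
   derivative were negative, the first one would be nonzero, hence genuine, and
   negative to the right of 0, and [f] would decrease from 0. *)
Lemma derive1n2_ge0 (f : R -> R) : (forall t, 0 <= f t) -> f 0 = 0 ->
  {for 0, continuous f} -> derive1 f 0 = 0 -> 0 <= derive1n 2 f 0.
Proof.
move=> f0 f00 cf df0.
pose g := derive1 f; rewrite -[derive1n 2 f 0]/(derive1 g 0).
have [cg|/lim_dvg] := pselect (cvg (h^-1 *: (g (h + 0) - g 0) @[h --> (0 : R)^'])); last first.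
  by rewrite /derive1 => ->.
rewrite leNgt; apply/negP => L0.
have nL : \forall h \near (0 : R)^', h^-1 *: (g (h + 0) - g 0) < 0.
  have : (h^-1 *: (g (h + 0) - g 0) @[h --> (0 : R)^']) --> derive1 g 0 := cg.
  by move=> Hc; exact: (Hc _ (near_lt L0)).
have [d d0 dP] : exists2 d : R, 0 < d & forall h, 0 < h -> h < d -> g h < 0.
  move/nbhs_ballP : nL => [d /= d0 dP]; exists d => // h h0 hd.
  have := dP h; rewrite /ball /= sub0r normrN gtr0_norm// => /(_ hd).
  rewrite gt_eqF// => /(_ isT).
  by rewrite addr0 /g df0 subr0 /GRing.scale/= pmulr_rlt0// invr_gt0.
(* Where [f] is not derivable, [derive1 f] has the default value 0, which is not negative. *)
have df h : 0 < h -> h < d -> derivable f h 1.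
  move=> h0 hd; apply: contrapT => nd.
  have := dP h h0 hd; rewrite /g derive1E /derive lim_dvg ?ltxx//.
pose h := d / 2; have h0 : 0 < h by rewrite divr_gt0.
have hd : h < d by rewrite ltr_pdivrMr// ltr_pMr// ltr1n.
have [x xh E] : exists2 x, x \in `]0, h[%R & f h - f 0 = g x * (h - 0).
  apply: (@MVT R f g 0 h h0) => [x|].
    rewrite in_itv/= => /andP[x0 xh]; rewrite /g derive1E; apply: derivableP.
    by apply: df => //; exact: lt_trans hd.
  apply/continuous_within_itvP => //; split.
  - move=> x; rewrite in_itv/= => /andP[x0 xh].
    by apply/differentiable_continuous/derivable1_diffP; apply: df => //; exact: lt_trans hd.
  - exact: cvg_at_right_filter.
  - apply: cvg_at_left_filter.
    by apply/differentiable_continuous/derivable1_diffP; apply: df.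
move: xh; rewrite in_itv/= => /andP[x0 xh].
have gx : g x < 0 by apply: dP => //; exact: lt_trans hd.
move: E (f0 h); rewrite f00 !subr0 => ->.
by rewrite leNgt nmulr_rlt0// h0.
Qed.

End SecondDerivativeAtMinimum.

Section DilationDerivative.
Context {R : realType}.

Lemma is_derive_dilation (eps : R) : is_derive (0 : R) 1 (dilation eps) eps.
Proof.
have E : (fun h : R => h^-1 *: (dilation eps (h *: 1 + 0) - dilation eps 0)) @ 0^' --> eps.
  have C : eps * (1 + h ^+ 2)^-1 @[h --> (0 : R)^'] --> eps.
    have H : {for (0 : R), continuous (fun h : R => eps * (1 + h ^+ 2)^-1)}.
      apply: continuousM; first exact: cst_continuous.
      apply: continuousV; first by rewrite expr0n addr0 oner_eq0.
      by apply: continuousD; [exact: cst_continuous|exact: exprn_continuous].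
    rewrite /prop_for /continuous_at expr0n addr0 invr1 mulr1 in H.
    exact: (cvg_trans (cvg_app _ (@nbhs_dnbhs _ (0 : R))) H).
  apply: cvg_trans C; apply: near_eq_cvg; near=> h.
  have h0 : h != 0 by near: h; exact: nbhs_dnbhs_neq.
  have h1 : 1 + h ^+ 2 != 0 by rewrite gt_eqF// ltr_pwDl// sqr_ge0.
  by rewrite /dilation /GRing.scale/= mulr1 addr0 mul0r mulr0; field; rewrite h0 h1.
by apply: DeriveDef; [apply/cvg_ex; exists eps; exact: E|exact/cvg_lim].
Unshelve. all: by end_near. Qed.

Lemma derive1_dilation_power (eps C : R) k :
  derive1 (fun t => dilation eps t ^+ k.+1 * C) 0 = k.+1%:R * eps * C.
Proof.
have d := is_derive_dilation eps; rewrite derive1E.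
have -> : (fun t => dilation eps t ^+ k.+1 * C) = C \*: (dilation eps ^+ k.+1).
  by apply/funext => t; rewrite /= exprfctE mulrC.
have dX := is_deriveX k.+1 d; have dZ := is_deriveZ C dX.
rewrite (@derive_val _ _ _ _ _ _ _ dZ) /dilation mul0r mulr0 addr0 expr1n mulr1.
by rewrite /GRing.scale/= mulrC.
Qed.

End DilationDerivative.

Lemma scaled1 {R : realType} {n N : nat} {M : oriented_manifold R n} {G : topGroupType}
    {proj : G -> 'M[R]_n} {P : spin_structure M proj} (s : univ_section N P) :
  scaled s 1 1%g = s.
Proof.
case: s => g psi; congr UnivSection.
  by apply/funext => i; apply/funext => x /=; rewrite expr1n scale1r.
by apply/funext => p /=; rewrite ss_act1.
Qed.

Theorem proposition3p5 (R : realType) (n N : nat) (hn : (3 <= n)%N)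
    (M : oriented_manifold R n) (hM : closed_connected M)
    (G : topGroupType) (proj : G -> 'M[R]_n) (hpi : is_universal_cover_GLpos proj)
    (c : {linear 'cV[R]_n -> 'M[R]_N}) (hc : is_spin_module c)
    (kappa : G -> 'M[R]_N) (hkappa : is_spin_identification proj c kappa)
    (P : spin_structure M proj) (s : univ_section N P) :
  let F := fun s' : univ_section N P => energy c n.-1 s' + energy c n s' in
  critical_point kappa F s -> hessian_psd kappa F s.
Proof.
move=> F [hs crit] gamma hg g0.
have [cM _] := hM; have [projM pcov _] := hpi; have [csq cskew _ _] := hc.
have [[kspin _ _] kcont kM kc] := hkappa.
have pdet a : 0 < \det (proj a).
  by have [_ rproj _] := pcov; have : range proj (proj a) by [exists a]; rewrite rproj.
have ksp a : SOset (proj a) -> spin_set c (kappa a) by move=> Ha; exact: kspin.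
have n2 : (2 <= n)%N by exact: leq_trans hn.
have [eps [a [eps0 ca a1 l0 pa]]] := dilation_lift projM pdet pcov.
have ac := scalar_lift_central projM pdet pcov ca a1 pa.
have dil0 : dilation eps 0 = 1 by rewrite /dilation mul0r mulr0 addr0.
have hsc : S1_curve kappa (fun t => scaled s (dilation eps t) (a t)).
  apply: (scaled_S1_curve hs ca l0 pa ac) => U oU.
  apply: (smooth_on_add oU); first exact: smooth_on_cst.
  apply: (smooth_on_mul oU); first exact: smooth_on_cst.
  apply: (smooth_on_mul oU); first exact: smooth_on_time.
  apply: (smooth_on_inv oU); first by move=> z _; rewrite gt_eqF// ltr_pwDl// sqr_ge0.
  apply: (smooth_on_add oU); first exact: smooth_on_cst.
  by apply: (smooth_on_exp oU); exact: smooth_on_time.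
have sc0 : scaled s (dilation eps 0) (a 0) = s by rewrite dil0 a1 scaled1.
have Fsc t : F (scaled s (dilation eps t) (a t)) = dilation eps t ^+ (n - 2) * F s.
  rewrite /F mulrDr.
  by rewrite !(energy_scaled projM pdet pcov csq cskew ksp kcont kM kc _ hs n2 (l0 t) (pa t) (ac t)).
have F0 : F s = 0.
  have := crit _ hsc sc0; rewrite /differential; under eq_fun do rewrite Fsc.
  (* As [n >= 3] the exponent is positive, so the derivative at 0 is [(n - 2) * eps * F s] with a
     nonzero factor, and criticality forces [F s = 0]. *)
  have -> : (n - 2)%N = (n - 3).+1 by rewrite subnSK.
  rewrite derive1_dilation_power => /eqP; rewrite !mulf_eq0 pnatr_eq0 (gt_eqF eps0) /=.
  by move/eqP.
have [E1 E2] : energy c n.-1 s = 0 /\ energy c n s = 0.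
  have e1 := energy_ge0 c n.-1 s; have e2 := energy_ge0 c n s.
  by move: F0; rewrite /F => /eqP; rewrite paddr_eq0// => /andP[/eqP ? /eqP ?].
have hg0 : S1 kappa (gamma 0) by rewrite g0.
rewrite /hessian; apply: derive1n2_ge0.
- by move=> t; rewrite addr_ge0 ?energy_ge0.
- by rewrite g0.
(* Continuity cannot be drawn from the vanishing of [differential], since [derive1] is also 0 where
   no derivative exists. *)
- rewrite /prop_for /continuous_at g0 F0 -[X in _ --> X](addr0 (0 : R)).
  have cv r : energy c r s = 0 -> energy c r (gamma t) @[t --> (0 : R)] --> (0 : R).
    move=> Er; apply: (energy_cvg0 projM pdet pcov csq cskew ksp kcont kM kc cM hg hg0).
    by rewrite g0.
  by apply: cvgD; exact: cv.
- exact: crit.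
Qed.
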